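(* Let $\mathcal C$ be a partial Kepler map and let $$h_2(\Lambda_2,u,v)=\frac1{2\pi}\int_{\mathbb T}\frac{d\ell_2}{\|x^{(1)}(\Lambda_2,\ell_2,u,v)-x^{(2)}(\Lambda_2,\ell_2,u,v)\|}$$ be the corresponding partially averaged Newtonian potential. Then the Hamiltonian $h_2$ is integrable by quadratures.
   Context: Let $(y^{(i)},x^{(i)})\in\mathbb R^3\times\mathbb R^3$, $i=1,2$, be impulse--position coordinates of two particles, and let $\mathrm m_2,\mathrm M_2>0$ be mass parameters. A \emph{partial Kepler map} is a change of coordinates $\mathcal C:(\Lambda_2,\ell_2,u,v)\in\mathcal A\times\mathbb T\times V\to(y^{(1)},y^{(2)},x^{(1)},x^{(2)})\in(\mathbb R^3)^4$, where $\mathcal A\subset\mathbb R$ and $V\subset\mathbb R^{10}$ are domains (open connected sets), $\mathbb T=\mathbb R/(2\pi\mathbb Z)$, $u=(u_1,\dots,u_5)$, $v=(v_1,\dots,v_5)$, which preserves the standard two-form, $$dy^{(1)}\wedge dx^{(1)}+dy^{(2)}\wedge dx^{(2)}=d\Lambda_2\wedge d\ell_2+du\wedge dv,$$ and satisfies $$\Big(\frac{\|y^{(2)}\|^2}{2\mathrm m_2}-\frac{\mathrm m_2\mathrm M_2}{\|x^{(2)}\|}\Big)\circ\mathcal C=-\frac{\mathrm m_2^3\mathrm M_2^2}{2\Lambda_2^2}.$$ The image of $\mathcal C$ is contained in the set where $\frac{\|y^{(2)}\|^2}{2\mathrm m_2}-\frac{\mathrm m_2\mathrm M_2}{\|x^{(2)}\|}<0$,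 and the instantaneous Keplerian ellipse generated by $(y^{(2)},x^{(2)})$ has non-vanishing eccentricity. The function $h_2$ is considered where it is well defined and smooth (i.e. $x^{(1)}$ does not lie on that ellipse). Poisson brackets are $\{f,g\}=\sum(\partial_pf\,\partial_qg-\partial_pg\,\partial_qf)$ for conjugate coordinates $(p,q)$; $f,g$ commute if $\{f,g\}=0$, and $g$ is a first integral of $f$ if $\{f,g\}=0$. \emph{Integrable by quadratures} means (Liouville) that the Hamiltonian, seen as a system with $n$ degrees of freedom, possesses $n$ pairwise Poisson-commuting, (generically) independent first integrals, counting the Hamiltonian itself. Here $n=6$ when the angular momenta $x^{(1)}\times y^{(1)}$ and $x^{(2)}\times y^{(2)}$ are not parallel; when they are parallel the problem is planar, and $n=4$. *)

(* Defs.v *)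
From mathcomp Require Import all_boot all_order all_algebra.
From mathcomp Require Import all_classical all_reals all_analysis.
Set Implicit Arguments.
Unset Strict Implicit.
Unset Printing Implicit Defensive.
Import Order.TTheory GRing.Theory Num.Theory.
Import numFieldNormedType.Exports.
Local Open Scope classical_set_scope.
Local Open Scope ring_scope.

(* The norm that MathComp-Analysis puts on row vectors is the sup norm; the
   Euclidean structure is therefore defined here. *)
Definition dot (R : realType) (n : nat) (a b : 'rV[R]_n) : R :=
  \sum_(i < n) a ord0 i * b ord0 i.

Definition enorm (R : realType) (n : nat) (a : 'rV[R]_n) : R :=
  Num.sqrt (dot a a).

(* Indices are added modulo 3. *)
Definition cross (R : realType) (a b : 'rV[R]_3) : 'rV[R]_3 :=
  \row_(k < 3) (a ord0 (k + 1) * b ord0 (k + 2)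
                - a ord0 (k + 2) * b ord0 (k + 1)).

(* [Ck k D f] : all iterated directional derivatives of f of order <= k exist
   and are continuous on D (meant for an open D). *)
Fixpoint Ck (R : realType) (U W : normedModType R) (k : nat) (D : set U)
    (f : U -> W) : Prop :=
  match k with
  | 0 => forall z, D z -> {for z, continuous f}
  | k'.+1 => (forall z, D z -> differentiable f z)
             /\ (forall v : U, Ck k' D (fun z => 'D_v f z))
  end.

Definition smooth_on (R : realType) (U W : normedModType R) (D : set U)
    (f : U -> W) : Prop :=
  forall k : nat, Ck k D f.

(* Points (p, q) of R^n x R^n: momenta first, conjugate positions second. *)
Notation phase R n := ('rV[R]_n * 'rV[R]_n)%type.

(* dp /\ dq *)
Definition two_form (R : realType) (n : nat) (a b : phase R n) : R :=
  dot a.1 b.2 - dot b.1 a.2.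

Definition poisson (R : realType) (n : nat) (f g : phase R n -> R)
    (z : phase R n) : R :=
  let dp (i : 'I_n) : phase R n := (delta_mx ord0 i, 0) in
  let dq (i : 'I_n) : phase R n := (0, delta_mx ord0 i) in
  \sum_(i < n) ('D_(dp i) f z * 'D_(dq i) g z - 'D_(dp i) g z * 'D_(dq i) f z).

Definition independent_at (R : realType) (n : nat) (F : 'I_n -> phase R n -> R)
    (z : phase R n) : Prop :=
  forall c : 'I_n -> R,
    (forall v : phase R n, \sum_(i < n) c i * 'D_v (F i) z = 0) ->
    forall i, c i = 0.

(* Liouville integrability, with n degrees of freedom, of the Hamiltonian H on
   the region D of the quotient of R^2n by the translations Z per; functions on
   this quotient are per-periodic functions on R^2n ([per = 0]: no quotient).
   "Generically" means on a dense
   subset of D, which is open since independence is an open condition. *)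
Definition integrable_by_quadratures (R : realType) (n : nat)
    (per : phase R n) (D : set (phase R n)) (H : phase R n -> R) : Prop :=
  exists F : 'I_n -> phase R n -> R,
    [/\ exists i, forall z, D z -> F i z = H z,
        forall i, smooth_on D (F i),
        forall i z, D z -> F i (z + per) = F i z,
        forall i j z, D z -> poisson (F i) (F j) z = 0
      & D `<=` closure [set z | D z /\ independent_at F z]].

(* Cartesian phase space (R^3)^4: p = (y1, y2), q = (x1, x2). *)
Section Cartesian.
Variable R : realType.
Implicit Type w : phase R 6.

Definition y1 w : 'rV[R]_3 := lsubmx (w.1 : 'rV[R]_(3 + 3)).
Definition y2 w : 'rV[R]_3 := rsubmx (w.1 : 'rV[R]_(3 + 3)).
Definition x1 w : 'rV[R]_3 := lsubmx (w.2 : 'rV[R]_(3 + 3)).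
Definition x2 w : 'rV[R]_3 := rsubmx (w.2 : 'rV[R]_(3 + 3)).

(* In the rest of this section m, M are the mass parameters m_2, M_2. *)

Definition kepler_energy (m M : R) (y x : 'rV[R]_3) : R :=
  enorm y ^+ 2 / (2 * m) - m * M / enorm x.

(* Its direction is that of the pericentre and its length the eccentricity. *)
Definition ecc_vector (m M : R) (y x : 'rV[R]_3) : 'rV[R]_3 :=
  (m ^+ 2 * M)^-1 *: cross y (cross x y) - (enorm x)^-1 *: x.

Definition eccentricity (m M : R) (y x : 'rV[R]_3) : R :=
  enorm (ecc_vector m M y x).

(* Focal equation of the Keplerian conic through x generated by (y, x), in the
   plane orthogonal to the angular momentum; |cross x y|^2 / (m^2 M) is its
   semilatus rectum. *)
Definition kepler_conic (m M : R) (y x : 'rV[R]_3) : set 'rV[R]_3 :=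
  [set r | dot (cross x y) r = 0 /\
           enorm r = enorm (cross x y) ^+ 2 / (m ^+ 2 * M)
                     - dot (ecc_vector m M y x) r].

End Cartesian.

(* Kepler-map coordinates: p = (Lambda2, u), q = (l2, v). *)
Section KeplerMap.
Variable R : realType.
Implicit Type z : phase R 6.

Definition Lambda2 z : R := (z.1 : 'rV[R]_(1 + 5)) ord0 ord0.
Definition ell2 z : R := (z.2 : 'rV[R]_(1 + 5)) ord0 ord0.
Definition uv z : phase R 5 :=
  (rsubmx (z.1 : 'rV[R]_(1 + 5)), rsubmx (z.2 : 'rV[R]_(1 + 5))).

Definition set_ell2 (t : R) z : phase R 6 :=
  (z.1, row_mx (t%:M : 'rV[R]_1) (uv z).2).

(* The angle l2 is lifted to the real line; this is the corresponding period. *)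
Definition ell2_period : phase R 6 :=
  (0, row_mx ((2 * pi)%:M : 'rV[R]_1) (0 : 'rV[R]_5)).

Definition coord_domain (A : set R) (V : set (phase R 5)) : set (phase R 6) :=
  [set z | A (Lambda2 z) /\ V (uv z)].

Record partial_kepler_map (m M : R) (A : set R) (V : set (phase R 5))
    (C : phase R 6 -> phase R 6) : Prop := PartialKeplerMap {
  pk_A_domain : open A /\ connected A ;
  pk_V_domain : open V /\ connected V ;
  pk_smooth : smooth_on (coord_domain A V) C ;
  pk_periodic : forall z, coord_domain A V z -> C (z + ell2_period) = C z ;
  pk_injective : forall z z', coord_domain A V z -> coord_domain A V z' ->
    C z = C z' -> exists k : int, z' = z + ell2_period *~ k ;
  pk_symplectic : forall z, coord_domain A V z -> forall a b : phase R 6,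
    two_form ('D_a C z) ('D_b C z) = two_form a b ;
  pk_energy : forall z, coord_domain A V z ->
    kepler_energy m M (y2 (C z)) (x2 (C z))
    = - (m ^+ 3 * M ^+ 2 / (2 * Lambda2 z ^+ 2)) ;
  pk_negative_energy : forall z, coord_domain A V z ->
    kepler_energy m M (y2 (C z)) (x2 (C z)) < 0 ;
  (* the instantaneous orbit is a genuine, non-circular ellipse *)
  pk_eccentricity : forall z, coord_domain A V z ->
    0 < eccentricity m M (y2 (C z)) (x2 (C z)) < 1
}.

Definition h2 (C : phase R 6 -> phase R 6) z : R :=
  (2 * pi)^-1 *
  \int[lebesgue_measure]_(t in `[0, 2 * pi])
     (enorm (x1 (C (set_ell2 t z)) - x2 (C (set_ell2 t z))))^-1.

Definition regular_region (m M : R) (A : set R) (V : set (phase R 5))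
    (C : phase R 6 -> phase R 6) : set (phase R 6) :=
  [set z | coord_domain A V z /\
           ~ kepler_conic m M (y2 (C z)) (x2 (C z)) (x1 (C z))].

Definition nonparallel_region (m M : R) (A : set R) (V : set (phase R 5))
    (C : phase R 6 -> phase R 6) : set (phase R 6) :=
  [set z | regular_region m M A V C z /\
           cross (cross (x1 (C z)) (y1 (C z)))
                 (cross (x2 (C z)) (y2 (C z))) <> 0].

(* The rows of E are an orthonormal basis of a plane of R^3. *)
Definition orthonormal_frame (E : 'M[R]_(2, 3)) : Prop := E *m E^T = 1%:M.

(* Phase space ((R^2)^4, p = (y1, y2), q = (x1, x2)) of the planar problem,
   placed in the plane of E.  The restriction of dp /\ dq to its image is
   dp /\ dq. *)
Definition planar_embedding (E : 'M[R]_(2, 3)) (w : phase R 4) : phase R 6 :=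
  (row_mx (lsubmx (w.1 : 'rV[R]_(2 + 2)) *m E)
          (rsubmx (w.1 : 'rV[R]_(2 + 2)) *m E),
   row_mx (lsubmx (w.2 : 'rV[R]_(2 + 2)) *m E)
          (rsubmx (w.2 : 'rV[R]_(2 + 2)) *m E)).

(* If the (non-zero) angular momenta are parallel to k, all of y1, y2, x1, x2 lie
   in the plane orthogonal to k, i.e. the state is in the range of
   [planar_embedding E] for an orthonormal frame E of that plane. *)
Definition planar_region (m M : R) (A : set R) (V : set (phase R 5))
    (C : phase R 6 -> phase R 6) (E : 'M[R]_(2, 3)) : set (phase R 4) :=
  [set w | exists2 z, regular_region m M A V C z & C z = planar_embedding E w].

(* H is h2 o C^-1 restricted to the planar problem in the plane of E. *)
Definition planar_restriction (m M : R) (A : set R) (V : set (phase R 5))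
    (C : phase R 6 -> phase R 6) (E : 'M[R]_(2, 3)) (H : phase R 4 -> R) : Prop :=
  forall z w, regular_region m M A V C z -> C z = planar_embedding E w ->
    H w = h2 C z.

End KeplerMap.

(* Main.v *)
From HB Require Import structures.
Require Import Defs.
From mathcomp Require Import all_boot all_order all_algebra.
From mathcomp Require Import all_classical all_reals all_analysis.
From mathcomp Require Import ring lra zify.
Set Implicit Arguments.
Unset Strict Implicit.
Unset Printing Implicit Defensive.
Import Order.TTheory GRing.Theory Num.Theory.
Import numFieldNormedType.Exports.
Local Open Scope classical_set_scope.
Local Open Scope ring_scope.

(** In Cartesian coordinates the averaged potential depends on the first particle
    through its position [x1] only, and on the second one through its Kepler orbit.
    Besides [h2] and [Lambda2] this gives elementary integrals: the components of [x1],
    which commute with everything in which [y1] does not occur, and the component along [x1]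
    of the angular momentum [L] of the second particle, which generates the
    rotations of the second particle about [x1] and hence preserves the distance
    of the two. These are six commuting functions. In the planar problem the two
    components of [x1], the Kepler energy and [h2] are four. The brackets with
    [h2] are means of brackets with [1 / |x1 - x2|], because the other functions are
    constant along the orbits ([avg_along]).

    The point is the generic independence, that is, that [h2] is not locally a
    function of the other integrals. Rotating the orbit of the second particle about
    its own normal leaves those unchanged, and changes [h2] at the rate given by the
    mean of [W / |x1 - x2| ^ 3], where [W] is the triple product of [x1], [x2] and
    [L]. Suppose that this mean vanishes on an open set. Differentiating
    in [x1], along the normal if [x1] is off the orbital plane ([vertical_step]) and
    by the Laplacian of the plane in the planar problem ([planar_step]), shows that
    the means of [W / |x1 - x2| ^ (3 + 2 j)] vanish for all [j]. Since powers of
    [1 / |x1 - x2|] are uniform limits of polynomials in its square, the mean of [W]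
    itself vanishes ([moments_vanish]). It is linear in [x1], and its vanishing
    forces the mean of the component of [x2] along the eccentricity vector to
    vanish. That mean is negative: by the focal equation it is the
    difference of the semilatus rectum and of the mean of [|x2|], while the mean of
    [|x2|] is at least the semi-major axis by the virial identity
    ([mean_dot_ecc_lt0]). The eccentricity being positive, the semi-major axis
    exceeds the semilatus rectum.

    The Kepler motion enters through [ell_dir_derive]: as the Kepler energy is a
    function of [Lambda2], translations of [ell2] follow the Kepler flow. In the
    planar problem the Hamiltonian is [h2] composed with the inverse of the symplectic map
    [C]. Its smoothness results from local surjectivity of [C], obtained by
    minimizing a distance ([local_surjectivity]), and from the formula for the
    inverse of a symplectic matrix ([chart_derive]). *)

(** * Differentials and directional derivatives *)

Section Frechet.
Context {R : realType} {U W : normedModType R}.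
Implicit Types (f : U -> W) (z v : U).

Lemma differentiable_expansion f z : differentiable f z ->
  forall e, 0 < e ->
  \forall h \near 0, `|f (h + z) - f z - 'D_h f z| <= e * `|h|.
Proof.
move=> df e e0.
have /diff_locallyP[_ /eqaddoP/(_ e e0)] := df.
by apply: filterS => h /=; rewrite deriveE// opprD addrA.
Qed.

Lemma differentiable_of_linear f z (L : {linear U -> W}) :
  continuous L ->
  (forall e, 0 < e -> \forall h \near 0, `|f (h + z) - f z - L h| <= e * `|h|) ->
  differentiable f z /\ forall v, 'D_v f z = L v.
Proof.
move=> Lc fL.
have fo : f \o shift z = cst (f z) + L +o_ 0 id.
  apply/eqaddoP => e e0; apply: filterS (fL e e0) => h /=.
  by rewrite opprD addrA.
have dL := diff_unique Lc fo.
have df : differentiable f z by apply/diff_locallyP; rewrite dL.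
by split=> // v; rewrite deriveE// dL.
Qed.

(** On a finite-dimensional domain the bound on the candidate differential is
    automatic; as a hypothesis it replaces a continuity proof. *)
Lemma differentiable_of_expansion f z (L : U -> W) (K : R) :
  linear L -> (forall h, `|L h| <= K * `|h|) ->
  (forall e, 0 < e -> \forall h \near 0, `|f (h + z) - f z - L h| <= e * `|h|) ->
  differentiable f z /\ forall v, 'D_v f z = L v.
Proof.
move=> Llin LK fL.
pose L' : {linear U -> W} :=
  HB.pack_for {linear U -> W} L (GRing.isLinear.Build R U W _ L Llin).
apply: (@differentiable_of_linear f z L') => //.
apply/linear_bounded_continuous/linear_boundedP; near=> r => x.
by apply: le_trans (LK x) _; rewrite ler_wpM2r.
Unshelve. all: by end_near. Qed.

Lemma near_eq_differentiable f g z :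
  (\forall y \near z, f y = g y) -> differentiable f z -> differentiable g z.
Proof.
move=> fg df; have := diff_continuous df.
move=> /differentiable_of_linear-/(_ g z)[]// e e0.
have fg0 : \forall h \near (0 : U), f (h + z) = g (h + z).
  by have := fg; rewrite (near_shift 0) subr0.
apply: filterS2 (differentiable_expansion df e0) fg0 => h.
by rewrite -(nbhs_singleton fg) deriveE// => /[swap] ->.
Qed.

Lemma derive_linear f z : differentiable f z -> linear (fun v => 'D_v f z).
Proof. by move=> df a u v; rewrite !deriveE// linearP. Qed.

Lemma deriveDv f z u v : differentiable f z ->
  'D_(u + v) f z = 'D_u f z + 'D_v f z.
Proof. by move=> df; rewrite !deriveE// linearD. Qed.

Lemma deriveZv f z a v : differentiable f z -> 'D_(a *: v) f z = a *: 'D_v f z.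
Proof. by move=> df; rewrite !deriveE// linearZ. Qed.

Lemma deriveNv f z v : differentiable f z -> 'D_(- v) f z = - 'D_v f z.
Proof. by move=> df; rewrite !deriveE// linearN. Qed.

Lemma derive_sumv f z I (r : seq I) (P : pred I) (v : I -> U) :
  differentiable f z ->
  'D_(\sum_(i <- r | P i) v i) f z = \sum_(i <- r | P i) 'D_(v i) f z.
Proof.
by move=> df; rewrite deriveE// linear_sum; apply: eq_bigr => i _; rewrite deriveE.
Qed.

End Frechet.

Section DirectionalRules.
Context {R : realType} {U : normedModType R}.
Implicit Types (z v : U).

Lemma is_derive_ext (W : normedModType R) (f g : U -> W) z v df dg :
  is_derive z v f df -> f =1 g -> df = dg -> is_derive z v g dg.
Proof. by move=> fd /funext <- <-. Qed.

Lemma is_derive_lincomp (W X : normedModType R) (L : {linear W -> X})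
    (f : U -> W) z v df :
  continuous L -> is_derive z v f df -> is_derive z v (fun x => L (f x)) (L df).
Proof.
move=> Lc [fd <-].
have : (fun h => h^-1 *: ((fun x => L (f x)) (h *: v + z) - L (f z))) @ 0^'
    --> L ('D_v f z).
  under eq_fun do rewrite -linearB -linearZ.
  by apply: continuous_cvg; [exact: Lc|exact: fd].
move=> H; apply: DeriveDef; first by apply/cvg_ex; exists (L ('D_v f z)).
exact: cvg_lim H.
Qed.

Lemma is_derive_mul (f g : U -> R) z v df dg :
  is_derive z v f df -> is_derive z v g dg ->
  is_derive z v (fun x => f x * g x) (f z * dg + g z * df).
Proof. by move=> ff gg; exact: is_deriveM. Qed.

Lemma is_derive_add (W : normedModType R) (f g : U -> W) z v df dg :
  is_derive z v f df -> is_derive z v g dg ->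
  is_derive z v (fun x => f x + g x) (df + dg).
Proof. by move=> ff gg; exact: is_deriveD. Qed.

Lemma is_derive_sub (W : normedModType R) (f g : U -> W) z v df dg :
  is_derive z v f df -> is_derive z v g dg ->
  is_derive z v (fun x => f x - g x) (df - dg).
Proof. by move=> ff gg; exact: is_deriveB. Qed.

Lemma is_derive_scal (W : normedModType R) (f : U -> W) (a : R) z v df :
  is_derive z v f df -> is_derive z v (fun x => a *: f x) (a *: df).
Proof. by move=> ff; exact: is_deriveZ. Qed.

Lemma is_derive_pow (f : U -> R) n z v df : is_derive z v f df ->
  is_derive z v (fun x => f x ^+ n) (n%:R * f z ^+ n.-1 * df).
Proof.
move=> ff; have := @is_deriveX _ _ f n z v df ff.
by move=> H; apply: (is_derive_ext H) => // x; rewrite exprfctE.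
Qed.

Lemma is_derive_const (W : normedModType R) (a : W) z v :
  is_derive z v (fun=> a) 0.
Proof. exact: is_derive_cst. Qed.

Lemma is_derive_bigsum n (F : 'I_n -> U -> R) z v (dF : 'I_n -> R) :
  (forall i, is_derive z v (F i) (dF i)) ->
  is_derive z v (fun x => \sum_(i < n) F i x) (\sum_(i < n) dF i).
Proof.
move=> FF; have := @is_derive_sum _ _ _ n F z v dF FF.
by move=> H; apply: (is_derive_ext H) => // x; rewrite fct_sumE.
Qed.

Lemma derive_lineE (W : normedModType R) (f : U -> W) z v :
  'D_v f z = 'D_1 (fun h : R => f (h *: v + z)) 0.
Proof.
rewrite /derive; set g1 := fun h => h^-1 *: _; set g2 := fun h => h^-1 *: _.
suff -> : g1 = g2 by [].
by apply/funext => h; rewrite /g1 /g2 /= addr0 scale0r add0r [_%:A]mulr1.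
Qed.

Lemma is_derive_line (W : normedModType R) (f : U -> W) z v df :
  is_derive z v f df <-> is_derive (0 : R) 1 (fun h : R => f (h *: v + z)) df.
Proof.
split=> -[fd fE]; apply: DeriveDef.
- exact: (derivable1P _ _ _).1 fd.
- by rewrite -derive_lineE.
- exact: (derivable1P _ _ _).2 fd.
- by rewrite derive_lineE.
Qed.

Lemma is_derive_comp1 (f : U -> R) (g : R -> R) z v df dg :
  is_derive z v f df -> is_derive (f z) 1 g dg ->
  is_derive z v (fun x => g (f x)) (dg * df).
Proof.
move=> /is_derive_line fd gd; apply/is_derive_line.
by apply: is_derive1_comp => //; rewrite scale0r add0r.
Qed.

Lemma is_derive_inv (f : U -> R) z v df : f z != 0 -> is_derive z v f df ->
  is_derive z v (fun x => (f x)^-1) (- (f z) ^- 2 * df).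
Proof.
move=> f0 fd; apply: (@is_derive_comp1 f (fun y => y^-1)) => //.
have := @is_deriveV _ id (f z) 1 1 f0 (is_derive_id _ _).
by move=> H; apply: (is_derive_eq H); rewrite [_ *: _]mulr1.
Qed.

Lemma is_derive_invsqrt (f : U -> R) z v df : 0 < f z -> is_derive z v f df ->
  is_derive z v (fun x => (Num.sqrt (f x))^-1)
    (- 2^-1 * (Num.sqrt (f z))^-1 ^+ 3 * df).
Proof.
move=> f0 fd; have s0 : Num.sqrt (f z) != 0 by rewrite gt_eqF// sqrtr_gt0.
have sd := is_derive_comp1 fd (is_derive1_sqrt f0).
apply: (is_derive_eq (@is_derive_inv (fun x => Num.sqrt (f x)) z v _ s0 sd)).
by field.
Qed.

Lemma is_derive_coord m n (f : U -> 'M[R]_(m, n)) z v (df : 'M[R]_(m, n)) i j :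
  is_derive z v f df -> is_derive z v (fun x => f x i j) (df i j).
Proof.
move=> [fd <-]; apply: DeriveDef; first by apply: (derivable_mxP _ _ _).1.
by rewrite derive_mx// mxE.
Qed.

Lemma is_derive_rV n (f : U -> 'rV[R]_n) z v (df : 'rV[R]_n) :
  (forall j, is_derive z v (fun x => f x ord0 j) (df ord0 j)) ->
  is_derive z v f df.
Proof.
move=> ff; have fd : derivable f z v.
  by apply/derivable_mxP => i j; rewrite ord1; apply: ex_derive.
apply: DeriveDef => //; rewrite derive_mx//; apply/rowP => j.
by rewrite mxE; apply: derive_val.
Qed.

Lemma is_derive_dot n (f g : U -> 'rV[R]_n) z v (df dg : 'rV[R]_n) :
  is_derive z v f df -> is_derive z v g dg ->
  is_derive z v (fun x => dot (f x) (g x)) (dot df (g z) + dot (f z) dg).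
Proof.
move=> ff gg; rewrite /dot -big_split /=; apply: (@is_derive_bigsum n (fun i x => f x ord0 i * g x ord0 i)
  z v (fun i => df ord0 i * g z ord0 i + f z ord0 i * dg ord0 i)) => i.
have := is_derive_mul (is_derive_coord ord0 i ff) (is_derive_coord ord0 i gg).
by move=> HH; apply: (is_derive_eq HH); ring.
Qed.

Lemma is_derive_cross (f g : U -> 'rV[R]_3) z v (df dg : 'rV[R]_3) :
  is_derive z v f df -> is_derive z v g dg ->
  is_derive z v (fun x => cross (f x) (g x)) (cross df (g z) + cross (f z) dg).
Proof.
move=> ff gg; apply: is_derive_rV => k; rewrite !mxE.
have fc j := is_derive_coord ord0 j ff; have gc j := is_derive_coord ord0 j gg.
have := is_derive_sub (is_derive_mul (fc (k + 1)) (gc (k + 2)))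
  (is_derive_mul (fc (k + 2)) (gc (k + 1))).
by move=> H; apply: (is_derive_ext H) => [x|]; [rewrite mxE|ring].
Qed.

Lemma is_derive_scalfun n (f : U -> R) (g : U -> 'rV[R]_n) z v df (dg : 'rV[R]_n) :
  is_derive z v f df -> is_derive z v g dg ->
  is_derive z v (fun x => f x *: g x) (df *: g z + f z *: dg).
Proof.
move=> ff gg; apply: is_derive_rV => j; rewrite !mxE.
have := is_derive_mul ff (is_derive_coord ord0 j gg).
by move=> H; apply: (is_derive_ext H) => [x|]; [rewrite mxE|ring].
Qed.

End DirectionalRules.

(** * Smooth functions *)

Section SmoothBasics.
Context {R : realType} {U W : normedModType R} (D : set U).
Hypothesis Do : open D.
Implicit Types (f g : U -> W) (z v : U).

Lemma open_near_eq f g z : (forall y, D y -> f y = g y) -> D z ->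
  \forall y \near z, f y = g y.
Proof.
move=> fg Dz; have : nbhs z D by exact: open_nbhs_nbhs.
by apply: filterS => y /fg.
Qed.

Lemma Ck_eq k f g : (forall y, D y -> f y = g y) -> Ck k D f -> Ck k D g.
Proof.
elim: k f g => [|k IH] f g fg.
  move=> fc z Dz; have fgz := open_near_eq fg Dz.
  rewrite /prop_for /continuous_at -(fg z Dz).
  by apply: cvg_trans (fc z Dz); exact: near_eq_cvg.
move=> [fd fk]; split=> [z Dz|v].
  exact: near_eq_differentiable (open_near_eq fg Dz) (fd z Dz).
apply: IH (fk v) => y Dy; apply: near_eq_derive.
exact: open_near_eq.
Qed.

Lemma smooth_eq f g : (forall y, D y -> f y = g y) -> smooth_on D f ->
  smooth_on D g.
Proof. by move=> fg fs k; exact: Ck_eq (fs k). Qed.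

Lemma smooth_differentiable f z : smooth_on D f -> D z -> differentiable f z.
Proof. by move=> /(_ 1%N)[+ _]; apply. Qed.

Lemma smooth_derive f v : smooth_on D f -> smooth_on D (fun z => 'D_v f z).
Proof. by move=> fs k; have [_] := fs k.+1; apply. Qed.

Lemma smooth_continuous f z : smooth_on D f -> D z -> {for z, continuous f}.
Proof. by move=> /(_ 0%N); apply. Qed.

Lemma smooth_is_derive f z v : smooth_on D f -> D z ->
  is_derive z v f ('D_v f z).
Proof.
by move=> fs Dz; apply/derivableP/diff_derivable/smooth_differentiable.
Qed.

(** Smoothness is coinductive: a class of differentiable functions that is
    stable, on [D], under directional derivatives consists of smooth
    functions. *)
Lemma smooth_coind (P : (U -> W) -> Prop) :
  (forall f, P f -> (forall z, D z -> differentiable f z) /\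
    forall v, exists g, P g /\ forall z, D z -> 'D_v f z = g z) ->
  forall f, P f -> smooth_on D f.
Proof.
move=> PD f Pf k; elim: k f Pf => [|k IH] f /PD[fd fv].
  by move=> z /fd; exact: differentiable_continuous.
split=> // v; have [g [Pg fg]] := fv v.
by apply: Ck_eq (IH g Pg) => y Dy; rewrite fg.
Qed.

Lemma smooth_cst (a : W) : smooth_on D (fun=> a).
Proof.
apply: (@smooth_coind (fun f => exists a, f = cst a)); last by exists a.
move=> _ [b ->]; split=> [z _|v]; first exact: differentiable_cst.
by exists (cst 0); split; [exists 0|move=> z _; rewrite derive_cst].
Qed.

End SmoothBasics.

Lemma smooth_subset (R : realType) (U W : normedModType R) (D E : set U)
    (f : U -> W) : D `<=` E -> smooth_on E f -> smooth_on D f.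
Proof.
move=> DE fs k; elim: k f {fs}(fs k) => [|k IH] f; first by move=> fc z /DE/fc.
by move=> [fd fk]; split=> [z /DE/fd//|v]; exact: IH (fk v).
Qed.

Lemma smooth_id (R : realType) (U : normedModType R) (D : set U) : open D ->
  smooth_on D (@id U).
Proof.
move=> Do; apply: (@smooth_coind _ _ _ _ Do
  (fun f => f = id \/ exists a, f = cst a)); last by left.
move=> f [->|[b ->]]; split=> [z _|v].
- by apply: ex_diff.
- exists (cst v); split; first by right; exists v.
  by move=> z _; rewrite derive_id.
- exact: differentiable_cst.
by exists (cst 0); split; [right; exists 0|move=> z _; rewrite derive_cst].
Qed.

Lemma smooth_lincomp (R : realType) (U W X : normedModType R) (D : set U)
    (L : {linear W -> X}) (f : U -> W) :
  open D -> continuous L -> smooth_on D f -> smooth_on D (fun z => L (f z)).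
Proof.
move=> Do Lc fs; apply: (@smooth_coind _ _ _ _ Do
  (fun h => exists2 f, smooth_on D f & h = L \o f)); last by exists f.
move=> _ [g gs ->]; split=> [z Dz|v].
  apply: differentiable_comp; first exact: smooth_differentiable Dz.
  exact: linear_differentiable.
exists (L \o (fun z => 'D_v g z)); split.
  by exists (fun z => 'D_v g z) => //; exact: smooth_derive.
move=> z Dz; apply: derive_val; apply: is_derive_lincomp => //.
exact: smooth_is_derive Dz.
Qed.

Section SmoothAlgebra.
Context {R : realType} {U : normedModType R} (D : set U).
Hypothesis Do : open D.
Implicit Types (f g : U -> R).

(** Closure of the smooth functions under the operations below; it is stable
    under differentiation by the usual rules, hence made of smooth functions. *)
Inductive smooth_closure : (U -> R) -> Prop :=
| SCbase f : smooth_on D f -> smooth_closure f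
| SCadd f g : smooth_closure f -> smooth_closure g ->
    smooth_closure (fun z => f z + g z)
| SCmul f g : smooth_closure f -> smooth_closure g ->
    smooth_closure (fun z => f z * g z)
| SCinvsqrt f : smooth_closure f -> (forall z, D z -> 0 < f z) ->
    smooth_closure (fun z => (Num.sqrt (f z))^-1).

Lemma smooth_closure_smooth f : smooth_closure f -> smooth_on D f.
Proof.
apply: smooth_coind f => // f; elim=> {f} [f fs|f g _ [fd fv] _ [gd gv]|
    f g sf [fd fv] sg [gd gv]|f sf [fd fv] f0].
- split=> [z Dz|v]; first exact: smooth_differentiable Dz.
  by exists (fun z => 'D_v f z); split=> //; apply/SCbase/smooth_derive.
- split=> [z Dz|v]; first by apply: differentiableD; [exact: fd|exact: gd].
  have [f' [sf' fE]] := fv v; have [g' [sg' gE]] := gv v.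
  exists (fun z => f' z + g' z); split; first exact: SCadd.
  move=> z Dz; rewrite -fE// -gE//; apply: derive_val; apply: is_derive_add;
    apply/derivableP/diff_derivable; [exact: fd|exact: gd].
- split=> [z Dz|v]; first by apply: differentiableM; [exact: fd|exact: gd].
  have [f' [sf' fE]] := fv v; have [g' [sg' gE]] := gv v.
  exists (fun z => f z * g' z + g z * f' z).
  split; first by apply: SCadd; apply: SCmul.
  move=> z Dz; rewrite -fE// -gE//; apply: derive_val; apply: is_derive_mul;
    apply/derivableP/diff_derivable; [exact: fd|exact: gd].
- split=> [z Dz|v].
    have s0 : 0 < Num.sqrt (f z) by rewrite sqrtr_gt0 f0.
    apply: (@differentiableV _ _ (Num.sqrt \o f)); last by rewrite /= gt_eqF.
    apply: differentiable_comp; first exact: fd.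
    by apply/derivable1_diffP; have := is_derive1_sqrt (f0 z Dz); case.
  have [f' [sf' fE]] := fv v; have sV := SCinvsqrt sf f0.
  exists (fun z => - 2^-1 * ((Num.sqrt (f z))^-1 * ((Num.sqrt (f z))^-1 *
    (Num.sqrt (f z))^-1)) * f' z); split.
    do ?[apply: SCmul => //]; first exact/SCbase/smooth_cst.
  move=> z Dz; rewrite -fE// -[_ * (_ * _)]/(_ ^+ 3); apply: derive_val.
  by apply: is_derive_invsqrt; [exact: f0|apply/derivableP/diff_derivable/fd].
Qed.

Lemma smooth_add f g : smooth_on D f -> smooth_on D g ->
  smooth_on D (fun z => f z + g z).
Proof. by move=> fs gs; apply: smooth_closure_smooth; apply: SCadd; apply: SCbase. Qed.

Lemma smooth_mul f g : smooth_on D f -> smooth_on D g ->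
  smooth_on D (fun z => f z * g z).
Proof. by move=> fs gs; apply: smooth_closure_smooth; apply: SCmul; apply: SCbase. Qed.

Lemma smooth_invsqrt f : smooth_on D f -> (forall z, D z -> 0 < f z) ->
  smooth_on D (fun z => (Num.sqrt (f z))^-1).
Proof. by move=> fs f0; apply: smooth_closure_smooth; apply: SCinvsqrt => //; apply: SCbase. Qed.

Lemma smooth_sub f g : smooth_on D f -> smooth_on D g ->
  smooth_on D (fun z => f z - g z).
Proof.
move=> fs gs; apply: (@smooth_eq _ _ _ _ Do (fun z => f z + -1 * g z)).
  by move=> z _; rewrite mulN1r.
by apply: smooth_add => //; apply: smooth_mul => //; exact: smooth_cst.
Qed.

Lemma smooth_pow f n : smooth_on D f -> smooth_on D (fun z => f z ^+ n).
Proof.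
move=> fs; elim: n => [|n IH]; first exact: smooth_cst.
apply: (@smooth_eq _ _ _ _ Do (fun z => f z * f z ^+ n)).
  by move=> z _; rewrite exprS.
exact: smooth_mul.
Qed.

Lemma smooth_sum n (F : 'I_n -> U -> R) : (forall i, smooth_on D (F i)) ->
  smooth_on D (fun z => \sum_(i < n) F i z).
Proof.
elim: n F => [|n IH] F Fs.
  by apply: (smooth_eq Do) (smooth_cst Do 0) => z _; rewrite big_ord0.
apply: (@smooth_eq _ _ _ _ Do (fun z => \sum_(i < n) F (widen_ord (leqnSn n) i) z
  + F ord_max z)); first by move=> z _; rewrite big_ord_recr.
exact: smooth_add (IH _ _) (Fs _).
Qed.

End SmoothAlgebra.

(** * Linear symplectic algebra *)

Section Symplectic.
Context {R : realType} {n : nat}.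
Implicit Types (a b u v z : phase R n) (f g : phase R n -> R).

Definition basis_p (i : 'I_n) : phase R n := (delta_mx ord0 i, 0).
Definition basis_q (i : 'I_n) : phase R n := (0, delta_mx ord0 i).

Lemma dot_delta (x : 'rV[R]_n) i : dot x (delta_mx ord0 i) = x ord0 i.
Proof.
rewrite /dot (bigD1 i)//= mxE !eqxx mulr1 big1 ?addr0// => j ji.
by rewrite mxE (negbTE ji) andbF mulr0.
Qed.

Lemma dotC m (x y : 'rV[R]_m) : dot x y = dot y x.
Proof. by apply: eq_bigr => i _; rewrite mulrC. Qed.

Lemma dot0l m (x : 'rV[R]_m) : dot 0 x = 0.
Proof. by rewrite /dot big1// => i _; rewrite mxE mul0r. Qed.

Lemma dot0r m (x : 'rV[R]_m) : dot x 0 = 0. Proof. by rewrite dotC dot0l. Qed.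

Lemma dotDl m (x y w : 'rV[R]_m) : dot (x + y) w = dot x w + dot y w.
Proof. by rewrite -big_split; apply: eq_bigr => i _; rewrite mxE mulrDl. Qed.

Lemma dotZl m k (x w : 'rV[R]_m) : dot (k *: x) w = k * dot x w.
Proof. by rewrite mulr_sumr; apply: eq_bigr => i _; rewrite mxE mulrA. Qed.

Lemma dotNl m (x w : 'rV[R]_m) : dot (- x) w = - dot x w.
Proof. by rewrite -scaleN1r dotZl mulN1r. Qed.

Lemma dotDr m (x y w : 'rV[R]_m) : dot w (x + y) = dot w x + dot w y.
Proof. by rewrite dotC dotDl !(dotC w). Qed.

Lemma dotZr m k (x w : 'rV[R]_m) : dot w (k *: x) = k * dot w x.
Proof. by rewrite dotC dotZl (dotC w). Qed.

Lemma dotNr m (x w : 'rV[R]_m) : dot w (- x) = - dot w x.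
Proof. by rewrite dotC dotNl (dotC w). Qed.

Lemma phase_decomp v :
  v = \sum_i v.1 ord0 i *: basis_p i + \sum_i v.2 ord0 i *: basis_q i.
Proof.
have E1 (w : 'rV[R]_n) : w = \sum_i w ord0 i *: delta_mx ord0 i by exact: row_sum_delta.
rewrite [LHS]surjective_pairing; apply/pair_equal_spec; split=> /=.
- rewrite !(raddf_sum (@fst 'rV[R]_n 'rV[R]_n))/=.
  by rewrite [X in _ + X]big1 ?addr0 => [|i _]; rewrite ?scaler0 -?E1.
- rewrite !(raddf_sum (@snd 'rV[R]_n 'rV[R]_n))/=.
  by rewrite [X in X + _]big1 ?add0r => [|i _]; rewrite ?scaler0 -?E1.
Qed.

Lemma two_formDl a b u : two_form (a + b) u = two_form a u + two_form b u.
Proof. by rewrite /two_form/= dotDl dotDr; ring. Qed.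

Lemma two_formZl k a u : two_form (k *: a) u = k * two_form a u.
Proof. by rewrite /two_form/= dotZl dotZr; ring. Qed.

Lemma two_formC a b : two_form a b = - two_form b a.
Proof. by rewrite /two_form opprB. Qed.

Lemma two_formZr k a u : two_form u (k *: a) = k * two_form u a.
Proof. by rewrite two_formC two_formZl (two_formC u); ring. Qed.

Lemma two_formDr a b u : two_form u (a + b) = two_form u a + two_form u b.
Proof. by rewrite two_formC two_formDl !(two_formC u); ring. Qed.

Lemma linear_phase (h : phase R n -> R) v : scalar h ->
  h v = \sum_i v.1 ord0 i * h (basis_p i) + \sum_i v.2 ord0 i * h (basis_q i).
Proof.
move=> hlin.
pose h' : {scalar phase R n} :=
  HB.pack_for {scalar phase R n} h (GRing.isLinear.Build R (phase R n) R _ h hlin).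
rewrite -[h]/(h' : _ -> _) {1}[v]phase_decomp linearD !linear_sum.
by congr (_ + _); apply: eq_bigr => i _; rewrite linearZ.
Qed.

Lemma two_form_nondeg a : (forall b, two_form a b = 0) -> a = 0.
Proof.
move=> a0; rewrite [a]surjective_pairing; apply/pair_equal_spec; split.
  apply/rowP => i; have := a0 (basis_q i).
  by rewrite /two_form/= dot0l subr0 dot_delta mxE.
apply/rowP => i; have := a0 (basis_p i).
rewrite /two_form/= dot0r sub0r dotC dot_delta mxE => /eqP.
by rewrite oppr_eq0 => /eqP.
Qed.

Lemma two_form_inj a a' : (forall b, two_form a b = two_form a' b) -> a = a'.
Proof.
move=> aa; apply/eqP; rewrite -subr_eq0; apply/eqP/two_form_nondeg => b.
by rewrite two_formDl -scaleN1r two_formZl aa; ring.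
Qed.

Definition ham g z : phase R n :=
  (\row_i 'D_(basis_q i) g z, - \row_i 'D_(basis_p i) g z).

Lemma derive_phase (W : normedModType R) (f : phase R n -> W) z v :
  differentiable f z ->
  'D_v f z = \sum_i v.1 ord0 i *: 'D_(basis_p i) f z +
             \sum_i v.2 ord0 i *: 'D_(basis_q i) f z.
Proof.
move=> df; rewrite {1}[v]phase_decomp deriveDv// !derive_sumv//.
by congr (_ + _); apply: eq_bigr => i _; rewrite deriveZv.
Qed.

Lemma two_form_ham g z b : differentiable g z -> two_form (ham g z) b = 'D_b g z.
Proof.
move=> dg; rewrite [RHS]derive_phase// /two_form /ham /= dotNr opprK addrC.
by congr (_ + _); apply: eq_bigr => i _; rewrite mxE// mulrC.
Qed.

Lemma poissonE f g z : differentiable f z -> poisson f g z = 'D_(ham g z) f z.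
Proof.
move=> df; rewrite [RHS]derive_phase// /poisson /ham /= -big_split /=.
apply: eq_bigr => i _; rewrite !mxE scaleNr; congr (_ - _).
by rewrite mulrC.
Qed.

Lemma poissonC f g z : poisson f g z = - poisson g f z.
Proof. by rewrite /poisson -sumrN; apply: eq_bigr => i _; rewrite opprB; ring. Qed.

(** A linear map that preserves the symplectic form is injective, hence
    surjective by dimension. *)
Lemma symplectic_surj (L : phase R n -> phase R n) : linear L ->
  (forall a b, two_form (L a) (L b) = two_form a b) -> forall u, exists v, L v = u.
Proof.
move=> Llin LL u.
pose f (w : 'rV[R]_(n + n)) : 'rV[R]_(n + n) :=
  row_mx (L (lsubmx w, rsubmx w)).1 (L (lsubmx w, rsubmx w)).2.
have flin : linear f.
  move=> k x y; rewrite /f -[X in L X]/(_, _) !linearP/=.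
  have -> : (k *: lsubmx x + lsubmx y, k *: rsubmx x + rsubmx y) =
    k *: (lsubmx x, rsubmx x) + (lsubmx y, rsubmx y) :> phase R n by [].
  by rewrite Llin /= scale_row_mx add_row_mx.
pose f' : {linear 'rV[R]_(n + n) -> 'rV[R]_(n + n)} :=
  HB.pack_for {linear 'rV[R]_(n + n) -> 'rV[R]_(n + n)} f
  (GRing.isLinear.Build R 'rV[R]_(n + n) 'rV[R]_(n + n) _ f flin).
have fE w : w *m lin1_mx f' = f w by rewrite mul_rV_lin1.
have : row_free (lin1_mx f').
  apply: inj_row_free => w; rewrite fE => /eqP; rewrite row_mx_eq0.
  case/andP => /eqP f1 /eqP f2.
  have L0 : L (lsubmx w, rsubmx w) = 0 by rewrite [LHS]surjective_pairing f1 f2.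
  have : (lsubmx w, rsubmx w) = 0 :> phase R n.
    apply: two_form_nondeg => b.
    by rewrite -LL L0 /two_form /= dot0l dot0r subr0.
  by case=> l0 r0; rewrite -[w]hsubmxK l0 r0 row_mx0.
rewrite row_free_unit => Mu.
pose w := row_mx u.1 u.2 *m invmx (lin1_mx f').
exists (lsubmx w, rsubmx w).
have := fE w; rewrite /w mulmxKV// -/w /f => /eq_row_mx[u1 u2].
by rewrite [LHS]surjective_pairing -u1 -u2 -surjective_pairing.
Qed.

(** The symplectic adjoint of the differential of [C], applied to [u]. When [C]
    is symplectic it is the inverse of that differential. *)
Definition symp_lift (C : phase R n -> phase R n) z u : phase R n :=
  (\row_i two_form u ('D_(basis_q i) C z),
   - \row_i two_form u ('D_(basis_p i) C z)).

Section At.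
Variables (C : phase R n -> phase R n) (z : phase R n).
Hypothesis dC : differentiable C z.

Lemma two_form_symp_lift u b :
  two_form (symp_lift C z u) b = two_form u ('D_b C z).
Proof.
have lin : scalar (fun v => two_form u ('D_v C z)).
  by move=> k x y; rewrite deriveDv// deriveZv// two_formDr two_formZr.
rewrite (linear_phase b lin) /two_form /symp_lift /= dotNr opprK addrC.
by congr (_ + _); apply: eq_bigr => i _; rewrite mxE// mulrC.
Qed.

Hypothesis sC : forall a b, two_form ('D_a C z) ('D_b C z) = two_form a b.

Lemma symp_lift_derive b : symp_lift C z ('D_b C z) = b.
Proof. by apply: two_form_inj => c; rewrite two_form_symp_lift. Qed.

Lemma derive_surj u : exists v, 'D_v C z = u.
Proof. exact: (symplectic_surj (derive_linear dC) sC). Qed.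

Lemma derive_symp_lift u : 'D_(symp_lift C z u) C z = u.
Proof. by have [v <-] := derive_surj u; rewrite symp_lift_derive. Qed.

(** With [derive_symp_lift]: the differential of [C] sends the Hamiltonian vector
    field of [g] to [u]. *)
Lemma ham_symp_lift g u : (forall b, 'D_b g z = two_form u ('D_b C z)) ->
  ham g z = symp_lift C z u.
Proof.
move=> gu; congr (_, - _); apply/rowP => i; rewrite !mxE; exact: gu.
Qed.

End At.
End Symplectic.

(** * Integrals over the circle and vanishing moments *)

Section CircleIntegral.
Context {R : realType}.
Implicit Types f g q W : R -> R.

Definition circle_int f : R := \int[lebesgue_measure]_(t in `[0, 2 * pi]) f t.

Let T0 : 0 < 2 * pi :> R. Proof. by rewrite mulr_gt0// pi_gt0. Qed.

Let cint f : continuous f ->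
  (@lebesgue_measure R).-integrable `[0, 2 * pi] (EFin \o f).
Proof.
move=> fc; apply: continuous_compact_integrable; first exact: segment_compact.
exact: continuous_subspaceT.
Qed.

Lemma eq_circle_int f g : (forall t, f t = g t) -> circle_int f = circle_int g.
Proof. by move=> fg; apply: eq_Rintegral => t _; exact: fg. Qed.

Lemma circle_intD f g : continuous f -> continuous g ->
  circle_int (fun t => f t + g t) = circle_int f + circle_int g.
Proof. by move=> fc gc; apply: RintegralD => //; exact: cint. Qed.

Lemma circle_intZ k f : continuous f ->
  circle_int (fun t => k * f t) = k * circle_int f.
Proof. by move=> fc; apply: RintegralZl => //; exact: cint. Qed.

Lemma circle_intB f g : continuous f -> continuous g ->
  circle_int (fun t => f t - g t) = circle_int f - circle_int g.
Proof. by move=> fc gc; apply: RintegralB => //; exact: cint. Qed.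

Lemma circle_int_cst k : circle_int (fun=> k) = 2 * pi * k.
Proof.
rewrite /circle_int (@Rintegral_cst _ _ _ lebesgue_measure)//= lebesgue_measure_itv/= lte_fin T0.
by rewrite -EFinD /= subr0 mulrC.
Qed.

Lemma le_circle_int f g : continuous f -> continuous g ->
  (forall t, f t <= g t) -> circle_int f <= circle_int g.
Proof. by move=> fc gc fg; apply: le_Rintegral => //; exact: cint. Qed.

Lemma circle_int_bound f M : continuous f ->
  (forall t, 0 <= t <= 2 * pi -> `|f t| <= M) -> `|circle_int f| <= 2 * pi * M.
Proof.
move=> fc fM; rewrite -circle_int_cst.
apply: le_trans (le_normr_Rintegral _ (cint fc)) _ => //.
apply: le_Rintegral; first by [].
- by apply: (cint (f := fun t => `|f t|)) => t; apply: cvg_norm; exact: fc.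
- by apply: (cint (f := fun=> M)) => t; exact: cvg_cst.
- by move=> t; rewrite /= in_itv/= => /fM.
Qed.

Lemma circle_int_derive (F f : R -> R) : (forall t : R, is_derive t 1 F (f t)) -> continuous f ->
  circle_int f = F (2 * pi) - F 0.
Proof.
move=> Fd fc.
have Fc t : {for t, continuous F}.
  by apply/differentiable_continuous/derivable1_diffP; case: (Fd t).
rewrite /circle_int /Rintegral (@continuous_FTC2 _ f F)//=.
- exact: continuous_subspaceT.
- split.
  + by move=> t _; case: (Fd t).
  + by apply: cvg_at_right_filter; exact: Fc.
  + by apply: cvg_at_left_filter; exact: Fc.
- by move=> t _; rewrite derive1E; apply: derive_val.
Qed.

Lemma geometric_bound_eq0 (x K r : R) : 0 <= r < 1 ->
  (forall n, `|x| <= K * r ^+ n) -> x = 0.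
Proof.
move=> /andP[r0 r1] xK; apply/eqP; rewrite -normr_le0.
have Kr : (fun n => K * r ^+ n) @ \oo --> (0 : R).
  by rewrite -[X in _ --> X](mulr0 K); apply: cvgMr; apply: cvg_expr; rewrite ger0_norm.
rewrite -(cvg_lim _ Kr)//; apply: limr_ge; first by apply/cvg_ex; exists 0.
exact: nearW.
Qed.

(** Polynomials instead of monomials, so that the condition passes to uniform
    limits. *)
Definition null_moments (q g : R -> R) :=
  forall p : {poly R}, circle_int (fun t => g t * p.[q t ^+ 2]) = 0.

Lemma continuous_hornerf (p : {poly R}) f : continuous f ->
  continuous (fun t => p.[f t]).
Proof. by move=> fc t; apply: continuous_comp; [exact: fc|exact: continuous_horner]. Qed.

Lemma continuous_mulf f g : continuous f -> continuous g ->
  continuous (fun t => f t * g t).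
Proof. by move=> fc gc t; apply: cvgM; [exact: fc|exact: gc]. Qed.

Lemma null_moments_monomials (q g : R -> R) : continuous q -> continuous g ->
  (forall j : nat, circle_int (fun t => g t * (q t ^+ 2) ^+ j) = 0) -> null_moments q g.
Proof.
move=> qc gc gj p.
have q2 : continuous (fun t => q t ^+ 2) by exact: continuous_mulf.
elim/poly_ind : p g gc gj => [|p c IH] g gc gj.
  rewrite (@eq_circle_int _ (fun=> 0)) ?circle_int_cst ?mulr0// => t.
  by rewrite horner0 mulr0.
rewrite (@eq_circle_int _ (fun t => g t * q t ^+ 2 * p.[q t ^+ 2] + c * g t)).
  have gq : continuous (fun t => g t * q t ^+ 2) by exact: continuous_mulf.
  rewrite circle_intD; last 2 first.
  - by apply: continuous_mulf => //; exact: continuous_hornerf.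
  - by apply: continuous_mulf => // t; exact: cvg_cst.
  rewrite IH// ?add0r; last first.
    move=> j; rewrite -[RHS](gj j.+1); apply: eq_circle_int => t.
    by rewrite -mulrA -exprS.
  rewrite circle_intZ// -[circle_int g](_ : circle_int (fun t => g t * (q t ^+ 2) ^+ 0) = _).
    by rewrite gj mulr0.
  by apply: eq_circle_int => t; rewrite expr0 mulr1.
by move=> t; rewrite hornerD hornerM hornerX hornerC; ring.
Qed.

(** The Newton iteration [s := s * (3 - s ^+ 2) / 2] for the inverse square root,
    started below its limit [1], increases to it at a geometric rate. *)
Lemma newton_step (d s : R) : 0 < d -> d <= s -> s <= 1 ->
  let s' := s * ((3 - s ^+ 2) / 2) in
  [/\ d <= s', s' <= 1 & 1 - s' <= (1 - s) * (1 - d / 2)].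
Proof.
move=> d0 ds s1 s'; have s0 : 0 < s by exact: lt_le_trans ds.
have ss1 : s * s <= 1 by rewrite mulr_ile1// ltW.
have ss0 : 0 <= s * s by rewrite mulr_ge0// ltW.
rewrite /s' expr2; split.
- suff : s <= s * ((3 - s * s) / 2) by exact: le_trans.
  by apply: ler_peMr; [exact: ltW|lra].
- have -> : s * ((3 - s * s) / 2) = 1 - (1 - s) ^+ 2 * (2 + s) / 2 by field.
  by rewrite gerBl divr_ge0// mulr_ge0 ?sqr_ge0//; lra.
have -> : 1 - s * ((3 - s * s) / 2) = (1 - s) * ((2 - s - s * s) / 2) by field.
by rewrite ler_wpM2l ?subr_ge0//; lra.
Qed.

(** [1 / q] is a uniform limit on a period of polynomials in [q ^+ 2]: the Newton
    iterates for the inverse square root of [q ^+ 2]. *)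
Lemma null_moments_div (q g : R -> R) : continuous q -> continuous g ->
  (forall t, 0 < q t) -> null_moments q g -> null_moments q (fun t => g t / q t).
Proof.
move=> qc gc q0 gP p.
have T0' : 0 <= 2 * pi :> R by exact: ltW.
have [tm tmT qm] := EVT_min T0' (continuous_subspaceT qc).
have [tM tMT qM] := EVT_max T0' (continuous_subspaceT qc).
(* The first iterate is the constant [1 / max q], so that [s 0 t] lies between
   [d] and [1]. *)
pose d := q tm / q tM; have d0 : 0 < d by rewrite divr_gt0.
pose P := fix P n : {poly R} := if n is k.+1 then
  P k * (2^-1%:P * (3%:P - 'X * P k ^+ 2)) else (q tM)^-1%:P.
pose s n t := q t * (P n).[q t ^+ 2].
have sS n t : s n.+1 t = s n t * ((3 - s n t ^+ 2) / 2).
  by rewrite /s /= !(hornerM, hornerD, hornerN, hornerC, hornerX, horner_exp); field.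
have sn n t : 0 <= t <= 2 * pi ->
    [/\ d <= s n t, s n t <= 1 & 1 - s n t <= (1 - d / 2) ^+ n].
  move=> tT; have tI : t \in `[0, 2 * pi]%R by rewrite in_itv.
  elim: n => [|n [ds s1 sr]].
    rewrite /s /= hornerC expr0 /d; split.
    - by apply: ler_wpM2r; [rewrite invr_ge0 ltW|exact: qm].
    - by rewrite ler_pdivrMr// mul1r qM.
    - by rewrite gerBl ltW// divr_gt0.
  have [h1 h2 h3] := newton_step d0 ds s1.
  rewrite sS; split=> //; apply: le_trans h3 _; rewrite exprSr ler_wpM2r//.
  have : d <= 1 by exact: le_trans s1.
  by lra.
have q2 : continuous (fun t => q t ^+ 2) by exact: continuous_mulf.
have gqc : continuous (fun t => g t / q t).
  apply: continuous_mulf => // t; apply: cvgV; [exact: lt0r_neq0|exact: qc].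
(* Replacing [1 / q] by [P n] in the integrand leaves the factor [1 - s n]. *)
pose G t := g t / q t * p.[q t ^+ 2].
have Gc : continuous G by apply: continuous_mulf => //; exact: continuous_hornerf.
have Gnc : continuous (fun t => `|G t|) by move=> t; apply: cvg_norm; exact: Gc.
have [tB _ GB] := EVT_max T0' (continuous_subspaceT Gnc).
have dT : 0 <= 1 - d / 2 < 1.
  have T00 : 0 <= (0 : R) <= 2 * pi by rewrite lexx.
  by have [h1 h2 _] := sn 0%N 0 T00; lra.
apply: (geometric_bound_eq0 (K := 2 * pi * `|G tB|) dT) => n.
have sc : continuous (s n) by apply: continuous_mulf => //; exact: continuous_hornerf.
have Gsc : continuous (fun t => G t * (1 - s n t)).
  by apply: continuous_mulf => // t; apply: cvgB; [exact: cvg_cst|exact: sc].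
rewrite (@eq_circle_int _ (fun t => G t * (1 - s n t) + g t * (p * P n).[q t ^+ 2])).
  rewrite circle_intD//; last first.
    by apply: continuous_mulf => //; exact: continuous_hornerf.
  rewrite gP addr0 -mulrA; apply: circle_int_bound => // t tT.
  have [h1 h2 h3] := sn n t tT.
  rewrite normrM ler_pM// ?GB ?in_itv//.
  by rewrite ger0_norm// subr_ge0.
by move=> t; rewrite /G /s hornerM; field; rewrite gt_eqF.
Qed.

(** Functions of [q] are uniform limits of polynomials in [q ^+ 2]; the
    powers of [q] in the moments can therefore be stripped. *)
Lemma moments_vanish (q W : R -> R) : continuous q -> continuous W -> (forall t, 0 < q t) ->
  (forall j : nat, circle_int (fun t => W t * q t ^+ (3 + j.*2)) = 0) ->
  circle_int W = 0.
Proof.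
move=> qc Wc q0 Wj.
have Wk k : continuous (fun t => W t * q t ^+ k).
  apply: continuous_mulf => //.
  elim: k => [|k IH]; first by move=> t; exact: cvg_cst.
  rewrite (_ : (fun t => q t ^+ k.+1) = (fun t => q t * q t ^+ k)).
    exact: continuous_mulf.
  by apply/funext => t; rewrite exprS.
have W3 : null_moments q (fun t => W t * q t ^+ 3).
  apply: null_moments_monomials => // j; rewrite -[RHS](Wj j).
  by apply: eq_circle_int => t; rewrite -mulrA -exprM -exprD -mul2n.
(* Three divisions by [q] remove the exponent three. *)
have step k : null_moments q (fun t => W t * q t ^+ k.+1) ->
    null_moments q (fun t => W t * q t ^+ k).
  move=> /(null_moments_div qc (Wk _) q0) H p; rewrite -[RHS](H p).
  apply: eq_circle_int => t; congr (_ * _); rewrite exprSr.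
  by field; rewrite gt_eqF.
rewrite -[RHS](step _ (step _ (step _ W3)) 1).
by apply: eq_circle_int => t; rewrite expr0 hornerC !mulr1.
Qed.

End CircleIntegral.

(** * Strict differentiability *)

(** Chain rule along an affine curve: the difference quotients coincide. *)
Lemma is_derive_along (R : realType) (U W : normedModType R) (f : U -> W)
    (c : R -> U) (t : R) (v : U) df :
  (forall h, c (h + t) = h *: v + c t) -> is_derive (c t) v f df ->
  is_derive t 1 (fun s => f (c s)) df.
Proof.
move=> cE /is_derive_line fd; apply/is_derive_line.
by apply: (is_derive_ext fd) => // h; rewrite -cE [_%:A]mulr1.
Qed.

Lemma scalar_derive_sub (R : realType) (U : normedModType R) (f : U -> R) y z :
  differentiable f y -> differentiable f z ->
  scalar (fun h => 'D_h f y - 'D_h f z).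
Proof.
move=> dy dz k u v; rewrite !deriveDv// !deriveZv//.
have E (w : U) : k *: 'D_u f w = k * 'D_u f w by [].
by rewrite !E; ring.
Qed.

Section PhaseNorm.
Context {R : realType} {n : nat}.
Implicit Types (u v z : phase R n) (f : phase R n -> R).

Lemma coord_le_norm m (x : 'rV[R]_m) i : `|x ord0 i| <= `|x|.
Proof.
rewrite [leRHS]/Num.Def.normr/= mx_normrE.
exact: (le_bigmax _ (fun i : 'I_1 * 'I_m => `|x i.1 i.2|) (ord0, i)).
Qed.

Lemma coord1_le_norm v i : `|v.1 ord0 i| <= `|v|.
Proof. by apply: le_trans (coord_le_norm _ _) _; rewrite prod_normE le_max lexx. Qed.

Lemma coord2_le_norm v i : `|v.2 ord0 i| <= `|v|.
Proof.
by apply: le_trans (coord_le_norm _ _) _; rewrite prod_normE le_max lexx orbT.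
Qed.

(** The norm of scalar linear maps dual to the sup norm. *)
Definition basis_sum (h : phase R n -> R) : R :=
  \sum_i `|h (basis_p i)| + \sum_i `|h (basis_q i)|.

Lemma scalar_phase_bound (h : phase R n -> R) v : scalar h ->
  `|h v| <= basis_sum h * `|v|.
Proof.
move=> hlin; rewrite (linear_phase v hlin) /basis_sum mulrDl !mulr_suml.
apply: le_trans (ler_normD _ _) _; apply: lerD.
  apply: le_trans (ler_norm_sum _ _ _) _; apply: ler_sum => i _.
  by rewrite normrM mulrC; apply: ler_wpM2l => //; exact: coord1_le_norm.
apply: le_trans (ler_norm_sum _ _ _) _; apply: ler_sum => i _.
by rewrite normrM mulrC; apply: ler_wpM2l => //; exact: coord2_le_norm.
Qed.

Lemma basis_sum0 : basis_sum (fun=> 0) = 0.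
Proof. by rewrite /basis_sum normr0 !big1// addr0. Qed.

(** A smooth function is strictly differentiable: by the mean value theorem
    along the segment from [z] to [h + z], the error is the variation of the
    partial derivatives. *)
Lemma strictly_differentiable (D : set (phase R n)) f z0 (e : R) :
  open D -> smooth_on D f -> D z0 -> 0 < e ->
  \forall z \near z0 & h \near (0 : phase R n),
    `|f (h + z) - f z - 'D_h f z| <= e * `|h|.
Proof.
move=> Do fs Dz0 e0.
(* [S y] bounds the norm of the difference of the differentials at [y] and [z0]. *)
pose S y := basis_sum (fun b => 'D_b f y - 'D_b f z0).
have Sc : {for z0, continuous S}.
  have tc b : {for z0, continuous (fun y => `|'D_b f y - 'D_b f z0|)}.
    apply: cvg_norm; apply: cvgB; last exact: cvg_cst.
    exact: (smooth_continuous (smooth_derive b fs) Dz0).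
  by apply: cvgD; (apply: cvg_big => [|i _]; last exact: tc);
    exact: add_continuous.
have S0 : S z0 = 0.
  by rewrite -[RHS]basis_sum0; congr basis_sum; apply/funext => b; exact: subrr.
have e20 : 0 < e / 2 by rewrite divr_gt0.
have : \forall y \near z0, D y /\ S y < e / 2.
  apply: filterI; first exact: open_nbhs_nbhs.
  by apply: (cvgr_lt (S z0) Sc); rewrite S0.
move=> /nbhs_normP[r /= r0 rD].
have r20 : 0 < r / 2 by rewrite divr_gt0.
near=> z h.
have zr : `|z0 - z| < r / 2 by near: z; apply: cvgr_dist_lt.
have hr : `|h| < r / 2.
  by near: h; apply: (@cvgr_norm_lt _ _ _ _ _ id (0 : phase R n)); rewrite ?normr0.
have segD (s : R) : 0 <= s <= 1 -> D (s *: h + z) /\ S (s *: h + z) < e / 2.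
  move=> /andP[s0 s1]; apply: rD => /=.
  rewrite opprD addrCA; apply: le_lt_trans (ler_normD _ _) _.
  rewrite [r]splitr; apply: ltrD => //; rewrite normrN normrZ ger0_norm//.
  by apply: le_lt_trans hr; rewrite ler_piMl.
have gd (s : R) : 0 <= s <= 1 ->
    is_derive s 1 (fun s => f (s *: h + z)) ('D_h f (s *: h + z)).
  move=> s01; apply: (@is_derive_along _ _ _ _ (fun s => s *: h + z) _ h).
    by move=> k; rewrite scalerDl addrA.
  by apply: smooth_is_derive => //; have [] := segD s s01.
have gc : {within `[0, 1], continuous (fun s : R => f (s *: h + z))}.
  apply: derivable_within_continuous => s.
  by rewrite in_itv/= => /gd; case.
have gd' (s : R) : s \in `]0, 1[%R ->
    is_derive s 1 (fun s => f (s *: h + z)) ('D_h f (s *: h + z)).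
  by rewrite in_itv/= => /andP[s0 s1]; apply: gd; rewrite !ltW.
have [c] := MVT_segment ler01 gd' gc.
rewrite in_itv/= => c01; rewrite scale1r scale0r add0r subr0 mulr1 => ->.
have [Dc Sy] := segD c c01.
have [Dz Sz] : D z /\ S z < e / 2.
  by have := segD 0; rewrite lexx ler01 scale0r add0r; apply.
set y := c *: h + z in Dc Sy *.
have dy := smooth_differentiable fs Dc; have dz := smooth_differentiable fs Dz.
have d0 := smooth_differentiable fs Dz0.
have -> : 'D_h f y - 'D_h f z =
  ('D_h f y - 'D_h f z0) - ('D_h f z - 'D_h f z0) by ring.
apply: le_trans (ler_normB _ _) _.
have := scalar_phase_bound h (scalar_derive_sub dy d0).
have := scalar_phase_bound h (scalar_derive_sub dz d0).
rewrite -/(S y) -/(S z) => hz hy.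
have hn : 0 <= `|h| by [].
by rewrite [e]splitr mulrDl; apply: lerD; [apply: le_trans hy _|apply: le_trans hz _];
  rewrite ler_wpM2r// ltW.
Unshelve. all: by end_near. Qed.

End PhaseNorm.

(** * Averages over the mean anomaly *)

Section Averages.
Context {R : realType}.
Implicit Types (z h v : phase R 6) (t : R) (f g : phase R 6 -> R).

Definition ell_dir : phase R 6 := basis_q ord0.

Lemma ell_dirE : ell_dir = (0, row_mx (1%:M : 'rV[R]_1) (0 : 'rV[R]_5)).
Proof.
congr (_, _); apply/rowP => i; rewrite !mxE; case: splitP => j /= ij; rewrite !mxE.
  by rewrite !ord1 eqxx -val_eqE /= ij ord1.
by rewrite -val_eqE /= ij.
Qed.

Lemma set_ell2E t z : set_ell2 t z = z + (t - ell2 z) *: ell_dir.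
Proof.
rewrite ell_dirE /set_ell2 [RHS]surjective_pairing /=; congr (_, _).
  by rewrite scaler0 addr0.
apply/rowP => i; rewrite !mxE; case: splitP => j ij; rewrite !mxE.
  have -> : i = ord0 by apply: val_inj; rewrite /= ij ord1.
  by rewrite ord1 /= /ell2 !mulr1n mulr1; ring.
have -> : i = rshift 1 j by exact: val_inj.
by rewrite mulr0 addr0.
Qed.

Lemma ell2_ell_dir : ell2 ell_dir = 1.
Proof. by rewrite /ell2 ell_dirE /= mxE; case: splitP => // j _; rewrite mxE !ord1. Qed.

Lemma ell2D z h : ell2 (z + h) = ell2 z + ell2 h.
Proof. by rewrite /ell2 mxE. Qed.

Lemma ell2Z k h : ell2 (k *: h) = k * ell2 h.
Proof. by rewrite /ell2 mxE. Qed.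

Lemma set_ell2D t h z : set_ell2 t (h + z) = set_ell2 0 h + set_ell2 t z.
Proof.
rewrite !set_ell2E ell2D sub0r addrACA -scalerDl; congr (_ + _ *: _); ring.
Qed.

Lemma set_ell2_lin k v h : set_ell2 0 (k *: v + h) = k *: set_ell2 0 v + set_ell2 0 h.
Proof.
rewrite !set_ell2E ell2D ell2Z !sub0r scalerDr scalerA addrACA -scalerDl.
by congr (_ + _ *: _); ring.
Qed.

Lemma set_ell2_norm h : `|set_ell2 0 h| <= `|h|.
Proof.
rewrite [leRHS]prod_normE [leLHS]prod_normE /= ge_max !le_max lexx /=.
apply/orP; right; rewrite {1}/Num.Def.normr/= mx_normrE.
apply/bigmax_leP; split=> //= -[i j] _ /=; rewrite ord1 mxE.
case: splitP => k jk; rewrite mxE; first by rewrite mul0rn normr0.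
by rewrite (_ : rshift 1 k = j) ?coord_le_norm//; exact: val_inj.
Qed.

Lemma set_ell2_step t k z : set_ell2 (k + t) z = k *: ell_dir + set_ell2 t z.
Proof. by rewrite !set_ell2E addrCA -scalerDl; congr (_ + _ *: _); ring. Qed.

Lemma set_ell2_continuous z : continuous (fun t => set_ell2 t z).
Proof.
rewrite (_ : (fun t => _) = fun t => z + (t - ell2 z) *: ell_dir).
  move=> t; apply: cvgD; first exact: cvg_cst.
  by apply: cvgZr_tmp; apply: cvgB => //; exact: cvg_cst.
by apply/funext => t; exact: set_ell2E.
Qed.

Lemma set_ell2_self z : set_ell2 (ell2 z) z = z.
Proof. by rewrite set_ell2E subrr scale0r addr0. Qed.

(** Without the factor [(2 * pi)^-1]; the averaged potential restores it. *)
Definition avg f z : R := circle_int (fun t => f (set_ell2 t z)).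

Section Domain.
Variable D : set (phase R 6).
Hypotheses (Do : open D) (Dell : forall z t, D z -> D (set_ell2 t z)).

Lemma orbit_continuous f z : smooth_on D f -> D z ->
  continuous (fun t => f (set_ell2 t z)).
Proof.
move=> fs Dz t; apply: continuous_comp; first exact: set_ell2_continuous.
exact: smooth_continuous fs (Dell t Dz).
Qed.

Lemma orbit_is_derive f z t : smooth_on D f -> D z ->
  is_derive t 1 (fun t => f (set_ell2 t z)) ('D_ell_dir f (set_ell2 t z)).
Proof.
move=> fs Dz; apply: (@is_derive_along _ _ _ _ (fun t => set_ell2 t z) _ ell_dir).
  by move=> k; exact: set_ell2_step.
by apply: smooth_is_derive fs _; exact: Dell.
Qed.

(** Differentiation under the integral sign. Strict differentiability at each
    point of the orbit segment becomes, by compactness, an estimate uniform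
    along it. *)
Lemma avg_diff f z : smooth_on D f -> D z ->
  differentiable (avg f) z /\ forall v, 'D_v (avg f) z = avg (fun z' => 'D_(set_ell2 0 v) f z') z.
Proof.
move=> fs Dz; pose L v := avg (fun z' => 'D_(set_ell2 0 v) f z') z.
have Dc v : continuous (fun t => 'D_v f (set_ell2 t z)).
  exact: (orbit_continuous (smooth_derive v fs) Dz).
have Llin : scalar L.
  move=> k u v; rewrite /L /avg -circle_intZ; last exact: Dc.
  rewrite -circle_intD; last exact: Dc; last first.
    by apply: continuous_mulf; [move=> t; exact: cvg_cst|exact: Dc].
  apply: eq_circle_int => t.
  have fd := smooth_differentiable fs (Dell t Dz).
  by rewrite set_ell2_lin deriveDv// deriveZv.
apply: (@differentiable_of_expansion _ _ _ _ _ L (basis_sum L)) => //.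
  by move=> h; exact: scalar_phase_bound.
move=> e e0; have pe0 : 0 < e / (2 * pi) by rewrite divr_gt0// mulr_gt0// pi_gt0.
have unif : \forall h \near (0 : phase R 6), `[0, 2 * pi]%classic `<=`
    (fun t => `|f (h + set_ell2 t z) - f (set_ell2 t z) - 'D_h f (set_ell2 t z)|
      <= e / (2 * pi) * `|h|).
  have /compact_near_coveringP cov := @segment_compact R 0 (2 * pi).
  apply: (cov _ (nbhs (0 : phase R 6)) (fun h t =>
    `|f (h + set_ell2 t z) - f (set_ell2 t z) - 'D_h f (set_ell2 t z)|
      <= e / (2 * pi) * `|h|)) => t _.
  have [[P Q] /= [Pz Q0] PQ] := strictly_differentiable Do fs (Dell t Dz) pe0.
  exists ((fun s => set_ell2 s z) @^-1` P, Q) => /=.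
    by split=> //; have := @set_ell2_continuous z t; apply.
  by move=> [s h] /= [Ps Qh]; exact: (PQ (_, _)).
have Dnear : \forall h \near (0 : phase R 6), D (h + z).
  have : \forall y \near z, D y by exact: open_nbhs_nbhs.
  by rewrite (near_shift 0) subr0.
have unif0 : \forall h \near (0 : phase R 6), `[0, 2 * pi]%classic `<=`
    (fun t => `|f (set_ell2 0 h + set_ell2 t z) - f (set_ell2 t z) -
      'D_(set_ell2 0 h) f (set_ell2 t z)| <= e / (2 * pi) * `|set_ell2 0 h|).
  have [r /= r0 rP] := nbhs_norm0P.1 unif.
  apply/nbhs_norm0P; exists r => //= h hr; apply: rP => /=.
  exact: le_lt_trans (set_ell2_norm h) hr.
apply: filterS2 Dnear unif0 => h Dh hP.
have fc := orbit_continuous fs Dz; have fhc := orbit_continuous fs Dh.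
rewrite /L /avg -circle_intB// -circle_intB//; last first.
  by move=> t; apply: cvgB; [exact: fhc|exact: fc].
rewrite (_ : e * `|h| = 2 * pi * (e / (2 * pi) * `|h|)); last first.
  by rewrite mulrA [2 * pi * _]mulrC divfK ?gt_eqF ?mulr_gt0 ?pi_gt0.
apply: circle_int_bound.
  by move=> t; apply: cvgB; [apply: cvgB; [exact: fhc|exact: fc]|exact: Dc].
move=> t tT; rewrite set_ell2D; apply: le_trans (hP t _) _.
  by rewrite /= in_itv.
by apply: ler_wpM2l; [exact: ltW|exact: set_ell2_norm].
Qed.

Lemma smooth_avg f : smooth_on D f -> smooth_on D (avg f).
Proof.
move=> fs; pose P (h : phase R 6 -> R) := exists2 g : phase R 6 -> R, smooth_on D g & h = avg g.
have Pf : P (avg f) by exists f.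
apply: (smooth_coind Do _ Pf) => {Pf}.
move=> _ [g gs ->]; split=> [z Dz|v]; first by case: (avg_diff gs Dz).
exists (avg (fun z => 'D_(set_ell2 0 v) g z)); split.
  by exists (fun z => 'D_(set_ell2 0 v) g z) => //; exact: smooth_derive.
by move=> z Dz; have [_] := avg_diff gs Dz; apply.
Qed.

Definition ell_periodic (X : Type) (f : phase R 6 -> X) :=
  forall z, D z -> f (z + ell2_period R) = f z.

Definition ell_invariant (X : Type) (f : phase R 6 -> X) :=
  forall z t, D z -> f (set_ell2 t z) = f z.

Lemma ell2_periodE : ell2_period R = (2 * pi) *: ell_dir.
Proof.
rewrite /ell2_period ell_dirE [RHS]surjective_pairing /= scaler0.
congr (_, _); apply/rowP => i; rewrite !mxE; case: splitP => j ij; rewrite !mxE.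
  by rewrite ord1 mulr1.
by rewrite mulr0.
Qed.

(** The fundamental theorem of calculus over one period. *)
Lemma avg_ell_dir f z : smooth_on D f -> ell_periodic f -> D z ->
  avg (fun z' => 'D_ell_dir f z') z = 0.
Proof.
move=> fs fper Dz; have fd t := orbit_is_derive t fs Dz.
rewrite /avg (circle_int_derive fd).
  apply/eqP; rewrite subr_eq0 -(fper _ (Dell 0 Dz)) ell2_periodE addrC.
  by rewrite -set_ell2_step addr0.
exact: (orbit_continuous (smooth_derive ell_dir fs) Dz).
Qed.

(** The mean of a periodic function does not see the displacement in [ell2]. *)
Lemma avg_derive f z v : smooth_on D f -> ell_periodic f -> D z ->
  'D_v (avg f) z = avg (fun z' => 'D_v f z') z.
Proof.
move=> fs fper Dz; have [_ ->] := avg_diff fs Dz.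
have c1 b := orbit_continuous (smooth_derive b fs) Dz.
have -> : avg (fun z' => 'D_(set_ell2 0 v) f z') z =
    avg (fun z' => 'D_v f z') z + - ell2 v * avg (fun z' => 'D_ell_dir f z') z.
  rewrite /avg -circle_intZ// -circle_intD//; last first.
    by apply: continuous_mulf => // t; exact: cvg_cst.
  apply: eq_circle_int => t; have fd := smooth_differentiable fs (Dell t Dz).
  by rewrite (set_ell2E 0 v) sub0r deriveDv// deriveZv.
by rewrite avg_ell_dir// mulr0 addr0.
Qed.

(** Near [set_ell2 t z] the function is a translate of itself near [z]. *)
Lemma ell_invariant_derive (W : normedModType R) (f : phase R 6 -> W) b :
  ell_invariant f -> ell_invariant (fun z => 'D_b f z).
Proof.
move=> fi z t Dz; rewrite /derive.
have [s sE] : exists s, set_ell2 t z = s *: ell_dir + z.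
  by exists (t - ell2 z); rewrite set_ell2E addrC.
have fi' w s' : D w -> f (s' *: ell_dir + w) = f w.
  by move=> Dw; rewrite -[in LHS](set_ell2_self w) -set_ell2_step fi.
have Dn : \forall h \near (0 : R), D (h *: b + z).
  have : {for (0 : R), continuous (fun h : R => h *: b + z)}.
    by apply: cvgD; [apply: cvgZr_tmp; exact: cvg_id|exact: cvg_cst].
  by apply; rewrite scale0r add0r; exact: open_nbhs_nbhs.
congr (lim _); rewrite eqEsubset; split; apply: near_eq_cvg;
  apply: cvg_within; (apply: filterS Dn => h Dh /=; rewrite sE fi'//;
  by rewrite addrCA fi').
Qed.

End Domain.
End Averages.

(** * Vectors of space and Cartesian coordinates *)

Section Vectors.
Context {R : realType}.
Implicit Types (a b c d : 'rV[R]_3).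

Lemma dot3 a b : dot a b = a ord0 0 * b ord0 0 + a ord0 1 * b ord0 1 + a ord0 2 * b ord0 2.
Proof.
rewrite /dot !big_ord_recr big_ord0 /= add0r.
congr (_ + _ + _); congr (a ord0 _ * b ord0 _); exact: val_inj.
Qed.

Lemma row3P a b : a ord0 0 = b ord0 0 -> a ord0 1 = b ord0 1 ->
  a ord0 2 = b ord0 2 -> a = b.
Proof.
move=> h0 h1 h2; apply/rowP => -[[|[|[|//]]] i3].
- by rewrite (_ : Ordinal i3 = 0) //; exact: val_inj.
- by rewrite (_ : Ordinal i3 = 1) //; exact: val_inj.
- by rewrite (_ : Ordinal i3 = 2) //; exact: val_inj.
Qed.

Lemma crossE0 a b : cross a b ord0 0 = a ord0 1 * b ord0 2 - a ord0 2 * b ord0 1.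
Proof. by rewrite mxE !add0r. Qed.

Lemma crossE1 a b : cross a b ord0 1 = a ord0 2 * b ord0 0 - a ord0 0 * b ord0 2.
Proof.
by rewrite mxE (_ : 1 + 1 = 2)// (_ : 1 + 2 = 0 :> 'I_3)//; exact: val_inj.
Qed.

Lemma crossE2 a b : cross a b ord0 2 = a ord0 0 * b ord0 1 - a ord0 1 * b ord0 0.
Proof.
rewrite mxE (_ : 2 + 1 = 0 :> 'I_3); last exact: val_inj.
by rewrite (_ : 2 + 2 = 1 :> 'I_3)//; exact: val_inj.
Qed.

Definition vecE := (dot3, crossE0, crossE1, crossE2).

Ltac vec3 := rewrite ?vecE; try (apply: row3P; rewrite !(vecE, mxE)); rewrite ?vecE ?mxE; ring.

Lemma dot_crossr a b : dot b (cross a b) = 0. Proof. vec3. Qed.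
Lemma dot_crossl a b : dot a (cross a b) = 0. Proof. vec3. Qed.
Lemma dot_cross_cyc a b c : dot a (cross b c) = dot b (cross c a).
Proof. vec3. Qed.
Lemma dot_cross_cross a b c d :
  dot (cross a b) (cross c d) = dot a c * dot b d - dot a d * dot b c.
Proof. vec3. Qed.
Lemma cross_cross a b c : cross a (cross b c) = dot a c *: b - dot a b *: c.
Proof. vec3. Qed.
Lemma dot_cross_twice a b : dot (cross b (cross a b)) a = dot (cross a b) (cross a b).
Proof. vec3. Qed.
Lemma crossC a b : cross a b = - cross b a. Proof. vec3. Qed.
Lemma crossvv a : cross a a = 0. Proof. vec3. Qed.
Lemma cross0l a : cross 0 a = 0. Proof. vec3. Qed.
Lemma cross0r a : cross a 0 = 0. Proof. vec3. Qed.
Lemma crossZl k a c : cross (k *: a) c = k *: cross a c. Proof. vec3. Qed.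
Lemma crossZr k a c : cross c (k *: a) = k *: cross c a. Proof. vec3. Qed.

Lemma dot_ge0 n (a : 'rV[R]_n) : 0 <= dot a a.
Proof. by apply: sumr_ge0 => i _; rewrite -expr2 sqr_ge0. Qed.

Lemma dot_eq0 n (a : 'rV[R]_n) : (dot a a == 0) = (a == 0).
Proof.
apply/eqP/eqP => [/eqP|->]; last by rewrite dot0l.
rewrite psumr_eq0 => [/allP a0|i _]; last by rewrite -expr2 sqr_ge0.
apply/rowP => i; rewrite mxE; have := a0 i (mem_index_enum _).
by rewrite /= -expr2 sqrf_eq0 => /eqP.
Qed.

Lemma dot_gt0 n (a : 'rV[R]_n) : (0 < dot a a) = (a != 0).
Proof. by rewrite lt_def dot_ge0 andbT dot_eq0. Qed.

Lemma enorm_sqr n (a : 'rV[R]_n) : enorm a ^+ 2 = dot a a.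
Proof. by rewrite sqr_sqrtr// dot_ge0. Qed.

Lemma enorm_gt0 n (a : 'rV[R]_n) : (0 < enorm a) = (a != 0).
Proof. by rewrite sqrtr_gt0 dot_gt0. Qed.

Lemma enormN n (a : 'rV[R]_n) : enorm (- a) = enorm a.
Proof. by rewrite /enorm dotNl dotNr opprK. Qed.

Lemma enormZ n k (a : 'rV[R]_n) : enorm (k *: a) = `|k| * enorm a.
Proof. by rewrite /enorm dotZl dotZr mulrA -expr2 sqrtrM ?sqr_ge0// sqrtr_sqr. Qed.

End Vectors.

Section Cartesian.
Context {R : realType}.
Implicit Types (u w : phase R 6).

Definition cart (a b c d : 'rV[R]_3) : phase R 6 :=
  (row_mx a b : 'rV[R]_(3 + 3), row_mx c d : 'rV[R]_(3 + 3)).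

Lemma y1_cart a b c d : y1 (cart a b c d) = a. Proof. exact: row_mxKl. Qed.
Lemma y2_cart a b c d : y2 (cart a b c d) = b. Proof. exact: row_mxKr. Qed.
Lemma x1_cart a b c d : x1 (cart a b c d) = c. Proof. exact: row_mxKl. Qed.
Lemma x2_cart a b c d : x2 (cart a b c d) = d. Proof. exact: row_mxKr. Qed.
Definition cartE := (y1_cart, y2_cart, x1_cart, x2_cart).

Lemma cart_eta w : cart (y1 w) (y2 w) (x1 w) (x2 w) = w.
Proof. by case: w => p q; congr (_, _); exact: (@hsubmxK R 1 3 3). Qed.

Lemma dot_row_mx m n (a c : 'rV[R]_m) (b d : 'rV[R]_n) :
  dot (row_mx a b) (row_mx c d) = dot a c + dot b d.
Proof.
rewrite /dot big_split_ord; congr (_ + _); apply: eq_bigr => i _.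
  by rewrite !row_mxEl.
by rewrite !row_mxEr.
Qed.

Lemma two_form_cart u w : two_form u w =
  dot (y1 u) (x1 w) + dot (y2 u) (x2 w) - dot (y1 w) (x1 u) - dot (y2 w) (x2 u).
Proof.
have E (a b c d : 'rV[R]_3) :
  @dot R 6 (row_mx a b) (row_mx c d) = dot a c + dot b d := dot_row_mx a c b d.
rewrite -{1}[u]cart_eta -{1}[w]cart_eta /two_form /cart /= !E.
by rewrite opprD addrA.
Qed.

Lemma y1_linear : linear (@y1 R). Proof. by move=> k u w; rewrite /y1 -linearP. Qed.
Lemma y2_linear : linear (@y2 R). Proof. by move=> k u w; rewrite /y2 -linearP. Qed.
Lemma x1_linear : linear (@x1 R). Proof. by move=> k u w; rewrite /x1 -linearP. Qed.
Lemma x2_linear : linear (@x2 R). Proof. by move=> k u w; rewrite /x2 -linearP. Qed.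

HB.instance Definition _ := GRing.isLinear.Build R (phase R 6) 'rV[R]_3 *:%R (@y1 R) y1_linear.
HB.instance Definition _ := GRing.isLinear.Build R (phase R 6) 'rV[R]_3 *:%R (@y2 R) y2_linear.
HB.instance Definition _ := GRing.isLinear.Build R (phase R 6) 'rV[R]_3 *:%R (@x1 R) x1_linear.
HB.instance Definition _ := GRing.isLinear.Build R (phase R 6) 'rV[R]_3 *:%R (@x2 R) x2_linear.

Lemma y1_continuous : continuous (@y1 R).
Proof.
move=> w; apply: (@continuous_comp _ _ _ fst (fun p : 'rV[R]_(3 + 3) => lsubmx p)).
  exact: cvg_fst.
exact: continuous_lsubmx.
Qed.
Lemma y2_continuous : continuous (@y2 R).
Proof.
move=> w; apply: (@continuous_comp _ _ _ fst (fun p : 'rV[R]_(3 + 3) => rsubmx p)).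
  exact: cvg_fst.
exact: continuous_rsubmx.
Qed.
Lemma x1_continuous : continuous (@x1 R).
Proof.
move=> w; apply: (@continuous_comp _ _ _ snd (fun p : 'rV[R]_(3 + 3) => lsubmx p)).
  exact: cvg_snd.
exact: continuous_lsubmx.
Qed.
Lemma x2_continuous : continuous (@x2 R).
Proof.
move=> w; apply: (@continuous_comp _ _ _ snd (fun p : 'rV[R]_(3 + 3) => rsubmx p)).
  exact: cvg_snd.
exact: continuous_rsubmx.
Qed.
End Cartesian.

(** * The Kepler motion in the coordinates of a partial Kepler map *)

Section VectorSmooth.
Context {R : realType} {U : normedModType R} (D : set U).
Hypothesis Do : open D.

Definition vsmooth n (f : U -> 'rV[R]_n) :=
  forall i, smooth_on D (fun z => f z ord0 i).

Lemma smooth_dot n (f g : U -> 'rV[R]_n) : vsmooth f -> vsmooth g ->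
  smooth_on D (fun z => dot (f z) (g z)).
Proof. by move=> fs gs; apply: smooth_sum => // i; exact: smooth_mul. Qed.

Lemma vsmooth_cross (f g : U -> 'rV[R]_3) : vsmooth f -> vsmooth g ->
  vsmooth (fun z => cross (f z) (g z)).
Proof.
move=> fs gs k; apply: (@smooth_eq _ _ _ _ Do (fun z =>
  f z ord0 (k + 1) * g z ord0 (k + 2) - f z ord0 (k + 2) * g z ord0 (k + 1))).
  by move=> z _; rewrite mxE.
by apply: smooth_sub => //; apply: smooth_mul.
Qed.

Lemma vsmooth_sub n (f g : U -> 'rV[R]_n) : vsmooth f -> vsmooth g ->
  vsmooth (fun z => f z - g z).
Proof.
move=> fs gs k; apply: (@smooth_eq _ _ _ _ Do (fun z => f z ord0 k - g z ord0 k)).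
  by move=> z _; rewrite !mxE.
exact: smooth_sub.
Qed.

Lemma vsmooth_cst n (a : 'rV[R]_n) : vsmooth (fun=> a).
Proof. by move=> k; exact: smooth_cst. Qed.

Lemma coord_continuous n i : continuous (fun x : 'rV[R]_n => x ord0 i).
Proof. by move=> x; apply: differentiable_continuous; exact: differentiable_coord. Qed.

Lemma vsmooth_lincomp (W : normedModType R) n (L : {linear W -> 'rV[R]_n})
    (f : U -> W) : continuous L -> smooth_on D f -> vsmooth (fun z => L (f z)).
Proof.
move=> Lc fs i; have Ls := smooth_lincomp Do Lc fs.
have clin : scalar (fun x : 'rV[R]_n => x ord0 i) by move=> k x y; rewrite !mxE.
pose c : {linear 'rV[R]_n -> R} := HB.pack_for {linear 'rV[R]_n -> R}
  (fun x : 'rV[R]_n => x ord0 i)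
  (GRing.isLinear.Build R 'rV[R]_n R *%R (fun x : 'rV[R]_n => x ord0 i) clin).
exact: (@smooth_lincomp R U _ _ D c _ Do (@coord_continuous n i) Ls).
Qed.
End VectorSmooth.

Section KeplerMap.
Context {R : realType} (m M : R) (hm : 0 < m) (hM : 0 < M).
Variables (A : set R) (V : set (phase R 5)) (C : phase R 6 -> phase R 6).
Hypothesis hC : partial_kepler_map m M A V C.
Implicit Types (z v b : phase R 6).

Let Dom := coord_domain A V.

Lemma Lambda2_linear : scalar (@Lambda2 R).
Proof. by move=> k u v; rewrite /Lambda2 /= !mxE. Qed.

HB.instance Definition _ :=
  GRing.isLinear.Build R (phase R 6) R *%R (@Lambda2 R) Lambda2_linear.

Lemma Lambda2_continuous : continuous (@Lambda2 R).
Proof.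
move=> w; apply: (@continuous_comp _ _ _ fst (fun p : 'rV[R]_6 => p ord0 ord0)).
  exact: cvg_fst.
exact: coord_continuous.
Qed.

Lemma uv_continuous : continuous (@uv R).
Proof.
move=> w; apply: (@cvg_pair _ _ _ _ (nbhs _) (nbhs _)).
  apply: (@continuous_comp _ _ _ fst (fun p : 'rV[R]_(1 + 5) => rsubmx p)).
    exact: cvg_fst.
  exact: continuous_rsubmx.
apply: (@continuous_comp _ _ _ snd (fun p : 'rV[R]_(1 + 5) => rsubmx p)).
  exact: cvg_snd.
exact: continuous_rsubmx.
Qed.

Lemma coord_domain_open : open Dom.
Proof.
have [Ao _] := pk_A_domain hC; have [Vo _] := pk_V_domain hC.
apply: openI.
  by apply: open_comp Ao => w _; exact: Lambda2_continuous.
by apply: open_comp Vo => w _; exact: uv_continuous.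
Qed.

Lemma uv_set_ell2 t z : uv (set_ell2 t z) = uv z.
Proof. by rewrite /uv /set_ell2 /= row_mxKr. Qed.

Lemma coord_domain_ell z t : Dom z -> Dom (set_ell2 t z).
Proof. by case=> Az Vz; split=> //=; rewrite uv_set_ell2. Qed.

Let Do := coord_domain_open.

Lemma C_diff z : Dom z -> differentiable C z.
Proof. exact: smooth_differentiable (pk_smooth hC). Qed.

Lemma is_derive_C z v : Dom z -> is_derive z v C ('D_v C z).
Proof. by move=> Dz; apply: smooth_is_derive Dz; exact: pk_smooth hC. Qed.

Lemma is_derive_y1 z v : Dom z -> is_derive z v (fun z => y1 (C z)) (y1 ('D_v C z)).
Proof. by move=> Dz; apply: is_derive_lincomp (is_derive_C v Dz); exact: y1_continuous. Qed.
Lemma is_derive_y2 z v : Dom z -> is_derive z v (fun z => y2 (C z)) (y2 ('D_v C z)).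
Proof. by move=> Dz; apply: is_derive_lincomp (is_derive_C v Dz); exact: y2_continuous. Qed.
Lemma is_derive_x1 z v : Dom z -> is_derive z v (fun z => x1 (C z)) (x1 ('D_v C z)).
Proof. by move=> Dz; apply: is_derive_lincomp (is_derive_C v Dz); exact: x1_continuous. Qed.
Lemma is_derive_x2 z v : Dom z -> is_derive z v (fun z => x2 (C z)) (x2 ('D_v C z)).
Proof. by move=> Dz; apply: is_derive_lincomp (is_derive_C v Dz); exact: x2_continuous. Qed.

Lemma vsmooth_y1 : vsmooth Dom (fun z => y1 (C z)).
Proof. exact: (vsmooth_lincomp Do y1_continuous (pk_smooth hC)). Qed.
Lemma vsmooth_y2 : vsmooth Dom (fun z => y2 (C z)).
Proof. exact: (vsmooth_lincomp Do y2_continuous (pk_smooth hC)). Qed.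
Lemma vsmooth_x1 : vsmooth Dom (fun z => x1 (C z)).
Proof. exact: (vsmooth_lincomp Do x1_continuous (pk_smooth hC)). Qed.
Lemma vsmooth_x2 : vsmooth Dom (fun z => x2 (C z)).
Proof. exact: (vsmooth_lincomp Do x2_continuous (pk_smooth hC)). Qed.

(** A collision state has zero eccentricity vector, by the convention
    [0^-1 = 0]. *)
Lemma x2_neq0 z : Dom z -> x2 (C z) != 0.
Proof.
move=> Dz; apply/eqP => x0; have /andP[+ _] := pk_eccentricity hC Dz.
by rewrite /eccentricity /ecc_vector x0 cross0l cross0r !scaler0 subr0 enorm_gt0 eqxx.
Qed.

(** A radial state has eccentricity one. *)
Lemma angmom_neq0 z : Dom z -> cross (x2 (C z)) (y2 (C z)) != 0.
Proof.
move=> Dz; apply/eqP => L0; have /andP[_] := pk_eccentricity hC Dz.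
have e0 : 0 < enorm (x2 (C z)) by rewrite enorm_gt0 x2_neq0.
rewrite /eccentricity /ecc_vector L0 cross0r scaler0 sub0r enormN enormZ.
by rewrite gtr0_norm ?invr_gt0// mulVf ?gt_eqF// ltxx.
Qed.

(** At [Lambda2 = 0] the energy would be [0] by the convention [x / 0 = 0],
    contrary to its negativity. *)
Lemma Lambda2_neq0 z : Dom z -> Lambda2 z != 0.
Proof.
move=> Dz; apply/eqP => L0; have := pk_negative_energy hC Dz.
by rewrite (pk_energy hC Dz) L0 expr0n mulr0 invr0 mulr0 oppr0 ltxx.
Qed.

Lemma two_form_ell_dir b : two_form ell_dir b = - Lambda2 b.
Proof. by rewrite /two_form /= dot0l sub0r dot_delta. Qed.

(** The Hamiltonian vector field of the Kepler energy: [two_form] against it is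
    the differential of the energy. *)
Definition kepler_energy_gradient (w : phase R 6) : phase R 6 :=
  cart 0 (m * M * (enorm (x2 w))^-1 ^+ 3 *: x2 w) 0 (- m^-1 *: y2 w).

Lemma is_derive_kepler_energy (U : normedModType R) (y x : U -> 'rV[R]_3) (z v : U)
    (dy dx : 'rV[R]_3) :
  x z != 0 -> is_derive z v y dy -> is_derive z v x dx ->
  is_derive z v (fun w : U => kepler_energy m M (y w) (x w))
    (dot (y z) dy / m + m * M * (enorm (x z))^-1 ^+ 3 * dot (x z) dx).
Proof.
move=> x0 yd xd.
have d1 := is_derive_mul (is_derive_dot yd yd) (is_derive_const (2 * m)^-1 z v).
have xx0 : 0 < dot (x z) (x z) by rewrite dot_gt0.
have d2 := @is_derive_invsqrt _ _ (fun w => dot (x w) (x w)) z v _ xx0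
  (is_derive_dot xd xd).
have d3 := is_derive_mul (is_derive_const (m * M) z v) d2.
apply: (is_derive_ext (is_derive_sub d1 d3)) => [w|].
  by rewrite /kepler_energy enorm_sqr.
rewrite /enorm (dotC dy) (dotC dx); field.
by apply/andP; split; rewrite gt_eqF// sqrtr_gt0.
Qed.

(** The time elapsed per unit of [ell2], inverse of the mean motion. *)
Definition kappa z := Lambda2 z ^+ 3 / (m ^+ 3 * M ^+ 2).

(** Since the Kepler energy is a function of [Lambda2] alone, the Hamiltonian
    flow of [ell2]-translations is a reparametrized Kepler motion. *)
Lemma ell_dir_derive z : Dom z ->
  'D_ell_dir C z = - kappa z *: kepler_energy_gradient (C z).
Proof.
move=> Dz; have L0 := Lambda2_neq0 Dz.
have dE b : kappa z * two_form (kepler_energy_gradient (C z)) ('D_b C z) = Lambda2 b.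
  have d1 := @is_derive_kepler_energy _ (fun z => y2 (C z)) (fun z => x2 (C z))
    z b _ _ (x2_neq0 Dz) (is_derive_y2 b Dz)
    (is_derive_x2 b Dz).
  have dL : is_derive z b (@Lambda2 R) (Lambda2 b).
    by apply: (is_derive_lincomp Lambda2_continuous (is_derive_id z b)).
  have L20 : 2 * Lambda2 z ^+ 2 != 0 by rewrite mulf_neq0// expf_neq0.
  have d2 := @is_derive_inv _ _ (fun z => 2 *: Lambda2 z ^+ 2) z b _ L20
    (is_derive_scal 2 (is_derive_pow 2 dL)).
  have d3 := is_derive_scal (- (m ^+ 3 * M ^+ 2)) d2.
  have EE : \forall y \near z, - (m ^+ 3 * M ^+ 2) *: (2 *: Lambda2 y ^+ 2)^-1 =
      kepler_energy m M (y2 (C y)) (x2 (C y)).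
    apply: (open_near_eq Do) Dz => y Dy; rewrite (pk_energy hC Dy).
    exact: mulNr.
  have d4 := near_eq_is_derive EE d3.
  have := etrans (esym (@derive_val _ _ _ _ _ _ _ d1)) (@derive_val _ _ _ _ _ _ _ d4).

  rewrite two_form_cart /kepler_energy_gradient !cartE dot0l dot0r dotZl dotZr.
  set P := dot (y2 _) _; set Q := dot (x2 _) _.
  rewrite [dot (y2 ('D_b C z)) _]dotC -/P.
  have sE (a c : R) : a *: c = a * c by [].
  rewrite !sE => PQ; rewrite /kappa.
  have -> : 0 + m * M * (enorm (x2 (C z)))^-1 ^+ 3 * Q - 0 - - m^-1 * P =
    P / m + m * M * (enorm (x2 (C z)))^-1 ^+ 3 * Q by ring.
  by rewrite PQ; field; rewrite L0 !gt_eqF.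
have sC := pk_symplectic hC Dz.
have -> : ell_dir = symp_lift C z (- kappa z *: kepler_energy_gradient (C z)).
  apply: two_form_inj => b; rewrite (two_form_symp_lift (C_diff Dz)).
  by rewrite two_form_ell_dir two_formZl -dE; ring.
exact: (derive_symp_lift (C_diff Dz) sC).
Qed.

Lemma kappa_neq0 z : Dom z -> kappa z != 0.
Proof.
by move=> Dz; rewrite mulf_neq0 ?expf_neq0 ?Lambda2_neq0// invr_neq0// mulf_neq0//
  expf_neq0// gt_eqF.
Qed.

Definition angmom z := cross (x2 (C z)) (y2 (C z)).
Definition ecc z := ecc_vector m M (y2 (C z)) (x2 (C z)).
Definition inv_radius z := (enorm (x2 (C z)))^-1.

Section EllDerivatives.
Variable z : phase R 6.
Hypothesis Dz : Dom z.

Lemma is_derive_ell_x1 : is_derive z ell_dir (fun z => x1 (C z)) 0.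
Proof.
apply: (is_derive_eq (is_derive_x1 ell_dir Dz)).
by rewrite (ell_dir_derive Dz) linearZ /= cartE scaler0.
Qed.

Lemma is_derive_ell_y1 : is_derive z ell_dir (fun z => y1 (C z)) 0.
Proof.
apply: (is_derive_eq (is_derive_y1 ell_dir Dz)).
by rewrite (ell_dir_derive Dz) linearZ /= cartE scaler0.
Qed.

Lemma is_derive_ell_x2 :
  is_derive z ell_dir (fun z => x2 (C z)) (kappa z / m *: y2 (C z)).
Proof.
apply: (is_derive_eq (is_derive_x2 ell_dir Dz)).
by rewrite (ell_dir_derive Dz) linearZ /= cartE scalerA mulrNN.
Qed.

Lemma is_derive_ell_y2 : is_derive z ell_dir (fun z => y2 (C z))
  (- (kappa z * (m * M * inv_radius z ^+ 3)) *: x2 (C z)).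
Proof.
apply: (is_derive_eq (is_derive_y2 ell_dir Dz)).
by rewrite (ell_dir_derive Dz) linearZ /= cartE scalerA mulNr.
Qed.

Lemma is_derive_ell_angmom : is_derive z ell_dir angmom 0.
Proof.
apply: (is_derive_eq (is_derive_cross is_derive_ell_x2 is_derive_ell_y2)).
by rewrite crossZl crossZr !crossvv !scaler0 addr0.
Qed.

Lemma inv_radius_gt0 : 0 < inv_radius z.
Proof. by rewrite invr_gt0 enorm_gt0 x2_neq0. Qed.

Lemma inv_radius_sqr : inv_radius z ^+ 2 * dot (x2 (C z)) (x2 (C z)) = 1.
Proof.
by rewrite -enorm_sqr -exprMn mulVf ?expr1n// gt_eqF// enorm_gt0 x2_neq0.
Qed.

Lemma is_derive_ell_ecc : is_derive z ell_dir ecc 0.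
Proof.
have d1 := is_derive_scal (m ^+ 2 * M)^-1
  (is_derive_cross is_derive_ell_y2 is_derive_ell_angmom).
have xx0 : 0 < dot (x2 (C z)) (x2 (C z)) by rewrite dot_gt0 x2_neq0.
have d2 := @is_derive_invsqrt _ _ (fun z => dot (x2 (C z)) (x2 (C z))) z _ _ xx0
  (is_derive_dot is_derive_ell_x2 is_derive_ell_x2).
have d3 := is_derive_scalfun d2 is_derive_ell_x2.
apply: (is_derive_eq (is_derive_sub d1 d3)).
rewrite -/(enorm _) -/(inv_radius z) cross0r addr0 crossZl /angmom cross_cross.
rewrite dotZl dotZr (dotC (y2 _)); set X := x2 (C z); set Y := y2 (C z).
have r2 := inv_radius_sqr; rewrite -/X in r2.
move: X Y r2 => X Y r2.
apply/rowP => k; rewrite !mxE.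
(* All terms along [X] cancel, and those along [Y] do since [|x2| ^+ 2] is the inverse
   square of [inv_radius]. *)
transitivity (kappa z / m * Y ord0 k * inv_radius z * (inv_radius z ^+ 2 * dot X X - 1)).
  by field; rewrite !gt_eqF.
by rewrite r2 subrr mulr0.
Qed.
End EllDerivatives.

Lemma ell_invariant_scalar (f : phase R 6 -> R) :
  (forall z, Dom z -> is_derive z ell_dir f 0) -> ell_invariant Dom f.
Proof.
move=> fd z t Dz; rewrite -[in RHS](set_ell2_self z).
apply: (@is_derive_0_is_cst _ (fun t => f (set_ell2 t z))) => s.
apply: (@is_derive_along _ _ _ _ (fun t => set_ell2 t z) _ ell_dir).
  by move=> k; exact: set_ell2_step.
by apply: fd; exact: coord_domain_ell.
Qed.

Lemma ell_invariant_vector (f : phase R 6 -> 'rV[R]_3) :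
  (forall z, Dom z -> is_derive z ell_dir f 0) -> ell_invariant Dom f.
Proof.
move=> fd z t Dz; apply/rowP => i.
apply: (@ell_invariant_scalar (fun z => f z ord0 i)) => // w Dw.
by have := is_derive_coord ord0 i (fd w Dw); rewrite mxE.
Qed.

Lemma x1_invariant : ell_invariant Dom (fun z => x1 (C z)).
Proof. exact: ell_invariant_vector is_derive_ell_x1. Qed.
Lemma y1_invariant : ell_invariant Dom (fun z => y1 (C z)).
Proof. exact: ell_invariant_vector is_derive_ell_y1. Qed.
Lemma angmom_invariant : ell_invariant Dom angmom.
Proof. exact: ell_invariant_vector is_derive_ell_angmom. Qed.
Lemma ecc_invariant : ell_invariant Dom ecc.
Proof. exact: ell_invariant_vector is_derive_ell_ecc. Qed.

(** The focal equation of the orbit. *)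
Lemma dot_ecc z : Dom z ->
  dot (ecc z) (x2 (C z)) = dot (angmom z) (angmom z) / (m ^+ 2 * M) - enorm (x2 (C z)).
Proof.
move=> Dz; have e0 : enorm (x2 (C z)) != 0 by rewrite gt_eqF// enorm_gt0 x2_neq0.
rewrite /ecc /ecc_vector dotDl dotNl !dotZl -enorm_sqr expr2 mulrA mulVf// mul1r.
by congr (_ - _); rewrite mulrC dot_cross_twice.
Qed.

Lemma dot_angmom_ecc z : dot (angmom z) (ecc z) = 0.
Proof.
rewrite /ecc /ecc_vector dotDr dotNr !dotZr -/(angmom z) dot_crossr.
by rewrite (dotC _ (x2 _)) dot_crossl !mulr0 subr0.
Qed.

(** The moving body stays on the conic of its instantaneous state, so that
    [x1] off the conic means no collision along the whole orbit. *)
Lemma x2_on_conic z : Dom z -> kepler_conic m M (y2 (C z)) (x2 (C z)) (x2 (C z)).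
Proof.
move=> Dz; split; first by rewrite dotC dot_crossl.
have := dot_ecc Dz; rewrite /ecc => ->; rewrite enorm_sqr -/(angmom z); ring.
Qed.

Lemma kepler_conicE z r : kepler_conic m M (y2 (C z)) (x2 (C z)) r <->
  dot (angmom z) r = 0 /\
  enorm r = enorm (angmom z) ^+ 2 / (m ^+ 2 * M) - dot (ecc z) r.
Proof. by []. Qed.

Lemma energy_invariant z t : Dom z ->
  kepler_energy m M (y2 (C (set_ell2 t z))) (x2 (C (set_ell2 t z))) =
  kepler_energy m M (y2 (C z)) (x2 (C z)).
Proof.
by move=> Dz; rewrite (pk_energy hC Dz) (pk_energy hC (coord_domain_ell t Dz)).
Qed.

Lemma sqr_ecc z : Dom z -> dot (ecc z) (ecc z) =
  1 + 2 * kepler_energy m M (y2 (C z)) (x2 (C z)) *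
      dot (angmom z) (angmom z) / (m ^+ 3 * M ^+ 2).
Proof.
move=> Dz; have e0 : enorm (x2 (C z)) != 0 by rewrite gt_eqF// enorm_gt0 x2_neq0.
have nr := enorm_sqr (x2 (C z)).
rewrite /kepler_energy enorm_sqr /ecc /ecc_vector /angmom.
rewrite !dotDl !dotDr !dotNl !dotNr !dotZl !dotZr !dot_cross_cross.
rewrite (dotC (x2 (C z)) (cross (y2 _) _)) !dot_cross_twice dot_crossr.
rewrite (dotC (cross _ _) (y2 _)) dot_crossr -nr.
rewrite dot_cross_cross -nr.
by field; rewrite e0 !gt_eqF.
Qed.

Lemma smooth_inv_radius : smooth_on Dom inv_radius.
Proof.
apply: smooth_invsqrt => //; last by move=> z Dz; rewrite dot_gt0 x2_neq0.
exact: (smooth_dot Do vsmooth_x2 vsmooth_x2).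
Qed.

Let energy z := kepler_energy m M (y2 (C z)) (x2 (C z)).

Lemma C_periodic (X : Type) (f : phase R 6 -> X) : ell_periodic Dom (fun z => f (C z)).
Proof. by move=> z Dz; rewrite (pk_periodic hC). Qed.

(** Virial identity: the mean of the derivative of [x2 . y2] vanishes. *)
Lemma mean_inv_radius z : Dom z ->
  m * M * avg inv_radius z = - (2 * pi * (2 * energy z)).
Proof.
move=> Dz; pose f z := dot (x2 (C z)) (y2 (C z)).
have fs : smooth_on Dom f := smooth_dot Do vsmooth_x2 vsmooth_y2.
have fE z' : Dom z' -> 'D_ell_dir f z' = kappa z' * (2 * energy z' + m * M * inv_radius z').
  move=> Dz'; have H := is_derive_dot (is_derive_ell_x2 Dz') (is_derive_ell_y2 Dz').
  rewrite (@derive_val _ _ _ _ _ _ _ H) dotZl dotZr /energy /kepler_energy enorm_sqr.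
  rewrite -/(inv_radius z'); have r2 := inv_radius_sqr Dz'.
  transitivity (kappa z' / m * dot (y2 (C z')) (y2 (C z')) -
    kappa z' * m * M * inv_radius z' * (inv_radius z' ^+ 2 * dot (x2 (C z')) (x2 (C z')))).
    by ring.
  by rewrite r2; field; rewrite gt_eqF.
have := avg_ell_dir coord_domain_ell fs (C_periodic (fun w => dot (x2 w) (y2 w))) Dz.
rewrite /avg; rewrite (@eq_circle_int _ _
  (fun t => kappa z * (2 * energy z + m * M * inv_radius (set_ell2 t z)))); last first.
  by move=> t; rewrite fE; [rewrite /energy energy_invariant|exact: coord_domain_ell].
have ic := orbit_continuous coord_domain_ell smooth_inv_radius Dz.
have cc (k : R) : continuous (fun _ : R => k) by move=> t; exact: cvg_cst.
have ic' : continuous (fun t => m * M * inv_radius (set_ell2 t z)).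
  by apply: continuous_mulf => //; exact: cc.
rewrite circle_intZ; last first.
  by move=> t; apply: cvgD; [exact: cc|exact: ic'].
rewrite (circle_intD (cc _) ic').
rewrite circle_int_cst circle_intZ// => /eqP.
by rewrite mulf_eq0 (negbTE (kappa_neq0 Dz)) /= addrC addr_eq0 => /eqP.
Qed.

(** The mean position lies on the side of the apocentre: the mean of [|x2|]
    is at least the harmonic one, the semi-major axis, which exceeds the
    semilatus rectum. *)
Lemma mean_dot_ecc_lt0 z : Dom z ->
  circle_int (fun t => dot (ecc z) (x2 (C (set_ell2 t z)))) < 0.
Proof.
move=> Dz; pose p := dot (angmom z) (angmom z) / (m ^+ 2 * M).
have h0 : energy z < 0 := pk_negative_energy hC Dz.
(* [p] is the semilatus rectum and [a] the semi-major axis. *)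
pose a := m * M / (- (2 * energy z)).
have mM : 0 < m * M by rewrite mulr_gt0.
have a0 : 0 < a by rewrite divr_gt0// oppr_gt0 pmulr_rlt0.
have pa : p < a.
  have := sqr_ecc Dz; have [/andP[e0 _]] := pk_eccentricity hC Dz.
  rewrite -/(energy z) => ee; have : 0 < dot (ecc z) (ecc z).
    by rewrite dot_gt0 -enorm_gt0.
  rewrite ee => e1; rewrite /p /a ltr_pdivlMr ?oppr_gt0 ?pmulr_rlt0//.
  rewrite -[X in _ < X]mul1r -ltr_pdivrMr// -subr_gt0.
  apply: lt_le_trans e1 _; rewrite le_eqVlt; apply/orP; left; apply/eqP.
  by field; rewrite !gt_eqF.
have cc (k : R) : continuous (fun _ : R => k) by move=> t; exact: cvg_cst.
have ic := orbit_continuous coord_domain_ell smooth_inv_radius Dz.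
have ec : continuous (fun t => dot (ecc z) (x2 (C (set_ell2 t z)))).
  apply: (orbit_continuous (f := fun z' => dot (ecc z) (x2 (C z')))
    coord_domain_ell) Dz.
  exact: (smooth_dot Do (vsmooth_cst Do (ecc z)) vsmooth_x2).
have ic' : continuous (fun t => a ^+ 2 * inv_radius (set_ell2 t z)).
  by apply: continuous_mulf => //; exact: cc.
have le t : dot (ecc z) (x2 (C (set_ell2 t z))) <=
    (p - 2 * a) + a ^+ 2 * inv_radius (set_ell2 t z).
  have Dt := coord_domain_ell t Dz.
  have := dot_ecc Dt; rewrite ecc_invariant// angmom_invariant// -/p => ->.
  have i0 : 0 < inv_radius (set_ell2 t z) := inv_radius_gt0 Dt.
  have -> : enorm (x2 (C (set_ell2 t z))) = (inv_radius (set_ell2 t z))^-1 by rewrite invrK.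
  (* [r + a ^+ 2 / r >= 2 * a]; the mean of [1 / r] is [1 / a] by the virial identity. *)
  rewrite -subr_ge0; set i := inv_radius _ in i0 *.
  have -> : p - 2 * a + a ^+ 2 * i - (p - i^-1) = (a * i - 1) ^+ 2 / i.
    by field; rewrite gt_eqF.
  by rewrite divr_ge0 ?sqr_ge0// ltW.
have c2 : continuous (fun t => p - 2 * a + a ^+ 2 * inv_radius (set_ell2 t z)).
  by move=> t; apply: cvgD; [exact: cc|exact: ic'].
apply: le_lt_trans (le_circle_int ec c2 le) _.
rewrite (circle_intD (cc _) ic').
rewrite circle_int_cst circle_intZ// -/(avg inv_radius z).
have -> : avg inv_radius z = 2 * pi * a^-1.
  apply: (mulfI (lt0r_neq0 mM)); rewrite mean_inv_radius// /a invf_div.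
  by rewrite [RHS]mulrCA [m * M * (_ / _)]mulrC divfK ?gt_eqF// mulrN.
rewrite [a ^+ 2 * _]mulrCA -mulrDr pmulr_rlt0; last by rewrite mulr_gt0// pi_gt0.
rewrite expr2 mulfK ?gt_eqF//; lra.
Qed.

End KeplerMap.

(** * The averaged potential and its multipole moments *)

Section Potential.
Context {R : realType} (m M : R) (hm : 0 < m) (hM : 0 < M).
Variables (A : set R) (V : set (phase R 5)) (C : phase R 6 -> phase R 6).
Hypothesis hC : partial_kepler_map m M A V C.
Implicit Types (z v b : phase R 6) (a : 'rV[R]_3).

Let Dom := coord_domain A V.
Let Reg := regular_region m M A V C.
Let Do : open Dom := coord_domain_open hC.
Local Notation L := (angmom C).
Local Notation e := (ecc m M C).

Let vx1 := vsmooth_x1 hC.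
Let vx2 := vsmooth_x2 hC.
Let vy2 := vsmooth_y2 hC.

Lemma vsmooth_angmom : vsmooth Dom L.
Proof. exact: (vsmooth_cross Do vx2 vy2). Qed.

Lemma regular_dom : Reg `<=` Dom. Proof. by move=> z []. Qed.

Lemma vsmooth_ecc : vsmooth Dom e.
Proof.
move=> i; apply: (@smooth_eq _ _ _ _ Do (fun z =>
  (m ^+ 2 * M)^-1 * cross (y2 (C z)) (L z) ord0 i - inv_radius C z * x2 (C z) ord0 i)).
  by move=> z _; rewrite !mxE.
apply: smooth_sub => //; apply: smooth_mul => //.
- exact: smooth_cst.
- exact: (vsmooth_cross Do vy2 vsmooth_angmom).
- exact: (smooth_inv_radius hC).
Qed.

(** The focal equations of the conic say that a sum of two squares vanishes. *)
Lemma regular_open : open Reg.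
Proof.
pose G z := dot (L z) (x1 (C z)) ^+ 2 +
  (enorm (x1 (C z)) - (dot (L z) (L z) / (m ^+ 2 * M) - dot (e z) (x1 (C z)))) ^+ 2.
have GE z : Reg z <-> Dom z /\ G z != 0.
  split=> [[Dz nc]|[Dz G0]]; last first.
    split=> // -[c1 c2]; move/negP: G0; apply; rewrite /G.
    by rewrite c1 expr0n add0r c2 enorm_sqr subrr expr0n.
  split=> //; apply/eqP => G0; apply: nc.
  move/eqP: G0; rewrite paddr_eq0 ?sqr_ge0// !sqrf_eq0 subr_eq0.
  by case/andP => /eqP c1 /eqP c2; split=> //; rewrite enorm_sqr.
have Gc z : Dom z -> {for z, continuous G}.
  move=> Dz; have sc f (fs : smooth_on Dom f) := smooth_continuous fs Dz.
  apply: cvgD.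
    by apply: sc; apply: smooth_pow => //; exact: (smooth_dot Do vsmooth_angmom vx1).
  have h : {for z, continuous (fun z => enorm (x1 (C z)) -
      (dot (L z) (L z) / (m ^+ 2 * M) - dot (e z) (x1 (C z))))}.
    apply: cvgB.
      apply: (@continuous_comp _ _ _ (fun z => dot (x1 (C z)) (x1 (C z))) Num.sqrt).
        by apply: sc; exact: (smooth_dot Do vx1 vx1).
      exact: sqrt_continuous.
    apply: sc; apply: smooth_sub => //; last exact: (smooth_dot Do vsmooth_ecc vx1).
    apply: smooth_mul => //; last exact: smooth_cst.
    exact: (smooth_dot Do vsmooth_angmom vsmooth_angmom).
  by rewrite /G; under eq_fun do rewrite expr2; apply: cvgM.
rewrite openE => z /GE[Dz G0].
have : \forall y \near z, Dom y /\ G y != 0.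
  apply: filterI; first exact: open_nbhs_nbhs.
  exact: (cvgr_neq0 (G z) (Gc z Dz) G0).
by apply: filterS => y /GE.
Qed.

Lemma regular_ell z t : Reg z -> Reg (set_ell2 t z).
Proof.
move=> [Dz nc]; split; first exact: coord_domain_ell.
move=> cc; apply: nc; move: cc; rewrite !kepler_conicE.
by rewrite (angmom_invariant hm hM hC)// (ecc_invariant hm hM hC)// (x1_invariant hm hM hC).
Qed.

Let Ro := regular_open.
Let RD := regular_dom.

Definition gap z := x1 (C z) - x2 (C z).
Definition invgap z := (enorm (gap z))^-1.
Definition torque z := dot (x1 (C z)) (cross (x2 (C z)) (L z)).
(** For [k = 3] this is the derivative of the potential under the rotation of the
    orbit about its normal; the higher ones arise by differentiating in [x1]. *)
Definition multipole k z := torque z * invgap z ^+ k.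

Lemma gap_neq0 z : Reg z -> gap z != 0.
Proof.
move=> [Dz nc]; apply/eqP => /eqP; rewrite subr_eq0 => /eqP x12; apply: nc.
by rewrite x12; exact: (x2_on_conic hC).
Qed.

Lemma vsmooth_sub_dom n (f : phase R 6 -> 'rV[R]_n) : vsmooth Dom f -> vsmooth Reg f.
Proof. by move=> fs i; exact: smooth_subset RD (fs i). Qed.

Let rx1 := vsmooth_sub_dom vx1.
Let rx2 := vsmooth_sub_dom vx2.
Let rL := vsmooth_sub_dom vsmooth_angmom.

Lemma vsmooth_gap : vsmooth Reg gap.
Proof. exact: (vsmooth_sub Ro rx1 rx2). Qed.

Lemma smooth_invgap : smooth_on Reg invgap.
Proof.
apply: smooth_invsqrt => //; last by move=> z Rz; rewrite dot_gt0 gap_neq0.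
exact: (smooth_dot Ro vsmooth_gap vsmooth_gap).
Qed.

Lemma smooth_torque : smooth_on Reg torque.
Proof. exact: (smooth_dot Ro rx1 (vsmooth_cross Ro rx2 rL)). Qed.

Lemma smooth_multipole k : smooth_on Reg (multipole k).
Proof. exact: (smooth_mul Ro smooth_torque (smooth_pow Ro k smooth_invgap)). Qed.

Lemma periodic_C (X : Type) (f : phase R 6 -> X) : ell_periodic Reg (fun z => f (C z)).
Proof. by move=> z /RD Dz; rewrite (pk_periodic hC). Qed.

Lemma h2E z : h2 C z = (2 * pi)^-1 * avg invgap z.
Proof. by []. Qed.

(** Along a Hamiltonian vector field whose Hamiltonian is constant on the Kepler
    orbits, differentiation commutes with averaging. *)
Lemma avg_along (g f : phase R 6 -> R) (u : phase R 6 -> phase R 6) z :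
  ell_invariant Dom g ->
  (forall z b, Dom z -> 'D_b g z = two_form (u z) ('D_b C z)) ->
  smooth_on Reg f -> ell_periodic Reg f -> Reg z ->
  'D_(symp_lift C z (u z)) (avg f) z =
  avg (fun z' => 'D_(symp_lift C z' (u z')) f z') z.
Proof.
move=> gi gu fs fp Rz.
have hamE z' : Dom z' -> ham g z' = symp_lift C z' (u z').
  by move=> Dz'; apply: ham_symp_lift => b; exact: gu.
have hi : ell_invariant Dom (ham g).
  move=> w t Dw; congr (_, - _); apply/rowP => i; rewrite !mxE.
    exact: (ell_invariant_derive Do (basis_q i) gi t Dw).
  by rewrite (ell_invariant_derive Do (basis_p i) gi t Dw).
rewrite -hamE; last exact: RD.
rewrite (avg_derive Ro regular_ell _ fs fp Rz).
apply: eq_circle_int => t.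
by rewrite -hamE ?hi//; [exact: RD|apply: coord_domain_ell; exact: RD].
Qed.

Section Lift.
Variables (z u : phase R 6).
Hypothesis Dz : Dom z.
Let v := symp_lift C z u.

Let vE : 'D_v C z = u.
Proof. exact: (derive_symp_lift (C_diff hC Dz) (pk_symplectic hC Dz)). Qed.

Lemma is_derive_lift_x1 : is_derive z v (fun z => x1 (C z)) (x1 u).
Proof. by have := is_derive_x1 hC v Dz; rewrite vE. Qed.
Lemma is_derive_lift_x2 : is_derive z v (fun z => x2 (C z)) (x2 u).
Proof. by have := is_derive_x2 hC v Dz; rewrite vE. Qed.
Lemma is_derive_lift_y2 : is_derive z v (fun z => y2 (C z)) (y2 u).
Proof. by have := is_derive_y2 hC v Dz; rewrite vE. Qed.

Lemma is_derive_lift_angmom :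
  is_derive z v L (cross (x2 u) (y2 (C z)) + cross (x2 (C z)) (y2 u)).
Proof. exact: is_derive_cross is_derive_lift_x2 is_derive_lift_y2. Qed.

Lemma is_derive_lift_gap : is_derive z v gap (x1 u - x2 u).
Proof. exact: is_derive_sub is_derive_lift_x1 is_derive_lift_x2. Qed.

End Lift.

Lemma is_derive_lift_invgap z u : Reg z ->
  is_derive z (symp_lift C z u) invgap
    (- invgap z ^+ 3 * dot (gap z) (x1 u - x2 u)).
Proof.
move=> Rz; have gd := is_derive_lift_gap u (RD Rz).
have g0 : 0 < dot (gap z) (gap z) by rewrite dot_gt0 gap_neq0.
have := @is_derive_invsqrt _ _ (fun z => dot (gap z) (gap z)) z _ _ g0 (is_derive_dot gd gd).
move=> H; apply: (is_derive_eq H).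
by rewrite -/(enorm _) -/(invgap z) (dotC (x1 u - x2 u)); field.
Qed.

Lemma is_derive_lift_torque z u : Dom z -> is_derive z (symp_lift C z u) torque
  (dot (x1 u) (cross (x2 (C z)) (L z)) +
   dot (x1 (C z)) (cross (x2 u) (L z) + cross (x2 (C z))
     (cross (x2 u) (y2 (C z)) + cross (x2 (C z)) (y2 u)))).
Proof.
move=> Dz; exact: (is_derive_dot (is_derive_lift_x1 u Dz)
  (is_derive_cross (is_derive_lift_x2 u Dz) (is_derive_lift_angmom u Dz))).
Qed.

(** Displacement of [x1], generated by [- a . y1]. *)
Definition displace a z := symp_lift C z (cart 0 0 a 0).

(** Infinitesimal rotation of [(y2, x2)] with axis along [a], generated by
    [a . (x2 x y2)]. *)
Definition rotation a z :=
  symp_lift C z (cart 0 (cross (y2 (C z)) a) 0 (cross (x2 (C z)) a)).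

Lemma avg_displace a f z : smooth_on Reg f -> ell_periodic Reg f -> Reg z ->
  'D_(displace a z) (avg f) z = avg (fun z' => 'D_(displace a z') f z') z.
Proof.
apply: (@avg_along (fun z => dot (- a) (y1 (C z))) f (fun=> cart 0 0 a 0)).
  by move=> w t Dw; rewrite (y1_invariant hm hM hC).
move=> w b Dw.
have H := is_derive_dot (is_derive_const (- a) w b) (is_derive_y1 hC b Dw).
rewrite (@derive_val _ _ _ _ _ _ _ H) two_form_cart !cartE !dot0l !dot0r dotNl.
by rewrite (dotC a); ring.
Qed.

Lemma dot_angmom_generator a b (x y dx dy : 'rV[R]_3) :
  dot a (cross dx y + cross x dy) = dot (cross y a) dx - dot dy (cross x a).
Proof. by rewrite ?vecE !(vecE, mxE); ring. Qed.

Lemma avg_rotation a f z : smooth_on Reg f -> ell_periodic Reg f -> Reg z ->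
  'D_(rotation a z) (avg f) z = avg (fun z' => 'D_(rotation a z') f z') z.
Proof.
apply: (@avg_along (fun z => dot a (L z)) f
  (fun z => cart 0 (cross (y2 (C z)) a) 0 (cross (x2 (C z)) a))).
  by move=> w t Dw; rewrite (angmom_invariant hm hM hC).
move=> w b Dw.
have H := is_derive_dot (is_derive_const a w b)
  (is_derive_cross (is_derive_x2 hC b Dw) (is_derive_y2 hC b Dw)).
rewrite (@derive_val _ _ _ _ _ _ _ H) two_form_cart !cartE !dot0l !dot0r.
by rewrite add0r subr0 add0r (dot_angmom_generator a b).
Qed.

Lemma derive_displace_invgap a z : Reg z ->
  is_derive z (displace a z) invgap (- invgap z ^+ 3 * dot (gap z) a).
Proof.
by move=> Rz; have := is_derive_lift_invgap (cart 0 0 a 0) Rz; rewrite !cartE subr0.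
Qed.

Lemma derive_displace_torque a z : Reg z ->
  is_derive z (displace a z) torque (dot a (cross (x2 (C z)) (L z))).
Proof.
move=> Rz; have := is_derive_lift_torque (cart 0 0 a 0) (RD Rz).
by rewrite !cartE !(cross0l, cross0r, addr0) dot0r addr0.
Qed.

Lemma derive_displace_multipole a k z : Reg z ->
  is_derive z (displace a z) (multipole k.+1)
    (dot a (cross (x2 (C z)) (L z)) * invgap z ^+ k.+1
     - k.+1%:R * (multipole k.+3 z * dot (gap z) a)).
Proof.
move=> Rz; have H := is_derive_mul (derive_displace_torque a Rz)
  (is_derive_pow k.+1 (derive_displace_invgap a Rz)).
apply: (is_derive_eq H); rewrite /multipole /= !exprS; ring.
Qed.

(** The angular momentum is constant along the orbit, so that the axis of rotation
    may be taken equal to it at each point of the average. *)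
Lemma avg_rotation_invgap z : Reg z ->
  'D_(rotation (L z) z) (avg invgap) z = avg (multipole 3) z.
Proof.
move=> Rz.
rewrite (avg_rotation (L z) smooth_invgap (periodic_C (fun w => (enorm (x1 w - x2 w))^-1)) Rz).
apply: eq_circle_int => t; have Rt := regular_ell t Rz.
rewrite -(angmom_invariant hm hM hC t (RD Rz)).
have H := is_derive_lift_invgap (cart 0 (cross (y2 (C (set_ell2 t z))) (L (set_ell2 t z))) 0
  (cross (x2 (C (set_ell2 t z))) (L (set_ell2 t z)))) Rt.
rewrite (@derive_val _ _ _ _ _ _ _ H) !cartE sub0r dotNr /gap dotDl dotNl dot_crossl.
by rewrite subr0 /multipole /torque; ring.
Qed.

(** Displacing [x1] by [a] is a direction in which functions that vanish on [Z]
    are stationary: any [a] for an open [Z], the vectors of the plane when [Z]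
    consists of planar states. *)
Definition tangent (Z : set (phase R 6)) z a :=
  forall f : phase R 6 -> R, smooth_on Reg f -> (forall z', Z z' -> f z' = 0) -> 'D_(displace a z) f z = 0.

Section Vanishing.
Variable Z : set (phase R 6).
Hypothesis ZR : Z `<=` Reg.

Lemma tangent_avg f z a : Z z -> tangent Z z a ->
  smooth_on Reg f -> ell_periodic Reg f -> (forall z', Z z' -> avg f z' = 0) ->
  avg (fun z' => 'D_(displace a z') f z') z = 0.
Proof.
move=> Zz tz fs fp f0; rewrite -avg_displace//; last exact: ZR.
exact: tz (smooth_avg Ro regular_ell fs) f0.
Qed.

Lemma multipole_periodic k : ell_periodic Reg (multipole k).
Proof.
exact: (periodic_C (fun w => dot (x1 w) (cross (x2 w) (cross (x2 w) (y2 w))) *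
  (enorm (x1 w - x2 w))^-1 ^+ k)).
Qed.

(** Displacing [x1] along the normal of the orbit does not change [torque], and
    changes the square of [gap] by the same amount at all points of the orbit.
    Off the orbital plane this amount is of first order, and differentiating the
    multipole raises its order by two. *)
Lemma vertical_step k :
  (forall z, Z z -> dot (x1 (C z)) (L z) != 0) ->
  (forall z, Z z -> tangent Z z (L z)) ->
  (forall z, Z z -> avg (multipole k.+1) z = 0) ->
  (forall z, Z z -> avg (multipole k.+3) z = 0).
Proof.
move=> h0 tZ fk z Zz; have Rz := ZR Zz.
have := tangent_avg Zz (tZ z Zz) (smooth_multipole k.+1) (@multipole_periodic k.+1) fk.
rewrite /avg; rewrite (@eq_circle_int _ _ (fun t =>
  (- (k.+1%:R * dot (x1 (C z)) (L z))) * multipole k.+3 (set_ell2 t z))).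
  rewrite circle_intZ; last exact: (orbit_continuous regular_ell (smooth_multipole _) Rz).
  rewrite -/(avg (multipole k.+3) z) => /eqP.
  by rewrite mulf_eq0 oppr_eq0 mulf_eq0 pnatr_eq0 (negbTE (h0 z Zz)) /= => /eqP.
move=> t; have Rt := regular_ell t Rz.
rewrite -{1}(angmom_invariant hm hM hC t (RD Rz)).
rewrite (@derive_val _ _ _ _ _ _ _ (derive_displace_multipole _ k Rt)) dot_crossr.
rewrite /gap dotDl dotNl {2}/angmom dot_crossl subr0 -/(angmom C _).
rewrite (x1_invariant hm hM hC t (RD Rz)) (angmom_invariant hm hM hC t (RD Rz)).
by ring.
Qed.

(** In the orbital plane the normal derivatives of first order vanish. The Laplacian
    of the plane, computed along the orthonormal pair [a1], [a2], maps
    [torque * invgap ^+ q] to [q * (q - 2)] times [torque * invgap ^+ (q + 2)]. *)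
Lemma planar_step k (a1 a2 : 'rV[R]_3) : (0 < k)%N ->
  (forall z (u v : 'rV[R]_3), Z z -> dot u (L z) = 0 -> dot v (L z) = 0 ->
     dot a1 u * dot a1 v + dot a2 u * dot a2 v = dot u v) ->
  dot a1 a1 = 1 -> dot a2 a2 = 1 ->
  (forall z, Z z -> dot (x1 (C z)) (L z) = 0) ->
  (forall z, Z z -> tangent Z z a1) -> (forall z, Z z -> tangent Z z a2) ->
  (forall z, Z z -> avg (multipole k.+2) z = 0) ->
  (forall z, Z z -> avg (multipole k.+4) z = 0).
Proof.
move=> k0 frame n1 n2 inplane t1 t2 fk z Zz.
(* The first derivative of the multipole along [a]. *)
pose f1 a z := dot a (cross (x2 (C z)) (L z)) * invgap z ^+ k.+2
     - k.+2%:R * (multipole k.+4 z * dot (gap z) a).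
have fs a : smooth_on Reg (f1 a).
  apply: smooth_sub => //; apply: smooth_mul => //.
  - exact: (smooth_dot Ro (vsmooth_cst Ro a) (vsmooth_cross Ro rx2 rL)).
  - exact: (smooth_pow Ro _ smooth_invgap).
  - exact: smooth_cst.
  - apply: smooth_mul => //; first exact: smooth_multipole.
    exact: (smooth_dot Ro vsmooth_gap (vsmooth_cst Ro a)).
have fp a : ell_periodic Reg (f1 a).
  move=> w Rw; rewrite /f1 /multipole /torque /invgap /gap /angmom.
  by rewrite (pk_periodic hC)//; exact: RD.
have f10 a : (forall z, Z z -> tangent Z z a) -> forall z, Z z -> avg (f1 a) z = 0.
  move=> ta w Zw; have := tangent_avg Zw (ta w Zw) (smooth_multipole k.+2)
    (@multipole_periodic k.+2) fk.
  move=> <-; apply: eq_circle_int => t; have Rt := regular_ell t (ZR Zw).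
  by rewrite (@derive_val _ _ _ _ _ _ _ (derive_displace_multipole a k.+1 Rt)).
have f2 a z' : Reg z' -> is_derive z' (displace a z') (f1 a)
    (- (2 * k.+2%:R) * (dot a (cross (x2 (C z')) (L z')) * dot a (gap z')) * invgap z' ^+ k.+4
     + k.+2%:R * k.+4%:R * torque z' * invgap z' ^+ k.+4 * invgap z' ^+ 2 *
       (dot a (gap z') * dot a (gap z'))
     - k.+2%:R * torque z' * invgap z' ^+ k.+4 * dot a a).
  move=> Rz'.
  have xd : is_derive z' (displace a z') (fun z => cross (x2 (C z)) (L z)) 0.
    have := is_derive_cross (is_derive_lift_x2 (cart 0 0 a 0) (RD Rz'))
      (is_derive_lift_angmom (cart 0 0 a 0) (RD Rz')).
    by rewrite !cartE !(cross0l, cross0r, addr0).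
  have gd : is_derive z' (displace a z') gap a.
    by have := is_derive_lift_gap (cart 0 0 a 0) (RD Rz'); rewrite !cartE subr0.
  have H := is_derive_sub
    (is_derive_mul (is_derive_dot (is_derive_const a z' (displace a z')) xd)
      (is_derive_pow k.+2 (derive_displace_invgap a Rz')))
    (is_derive_mul (is_derive_const (k.+2%:R : R) z' (displace a z'))
      (is_derive_mul (derive_displace_multipole a k.+3 Rz')
        (is_derive_dot gd (is_derive_const a z' (displace a z'))))).
  apply: (is_derive_eq H).
  rewrite !(dot0l, dot0r) (dotC (gap z') a) /multipole /= !exprS; ring.
have A1 := tangent_avg Zz (t1 z Zz) (fs a1) (fp a1) (f10 a1 t1).
have A2 := tangent_avg Zz (t2 z Zz) (fs a2) (fp a2) (f10 a2 t2).
have Rz := ZR Zz.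
have ds a : smooth_on Reg (fun z' => - (2 * k.+2%:R) * (dot a (cross (x2 (C z')) (L z')) * dot a (gap z')) * invgap z' ^+ k.+4
     + k.+2%:R * k.+4%:R * torque z' * invgap z' ^+ k.+4 * invgap z' ^+ 2 *
       (dot a (gap z') * dot a (gap z'))
     - k.+2%:R * torque z' * invgap z' ^+ k.+4 * dot a a).
  have ag := smooth_dot Ro (vsmooth_cst Ro a) vsmooth_gap.
  have ax := smooth_dot Ro (vsmooth_cst Ro a) (vsmooth_cross Ro rx2 rL).
  have ip n := smooth_pow Ro n smooth_invgap.
  have sc (c : R) := @smooth_cst _ _ _ Reg Ro c.
  have tq := smooth_torque.
  by apply: smooth_sub => //; first apply: smooth_add => //;
    do ?[apply: smooth_mul => //].
(* The sum of the two second derivatives; [frame] contracts its scalar products. *)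
have := congr2 +%R A1 A2; rewrite addr0.
rewrite /avg (@eq_circle_int _ _ _ (fun t => @derive_val _ _ _ _ _ _ _
  (f2 a1 _ (regular_ell t Rz)))).
rewrite (@eq_circle_int _ (fun t => 'D_(displace a2 (set_ell2 t z)) (f1 a2) (set_ell2 t z)) _
  (fun t => @derive_val _ _ _ _ _ _ _ (f2 a2 _ (regular_ell t Rz)))).
rewrite -circle_intD; last 2 first.
- exact: (orbit_continuous regular_ell (ds a1) Rz).
- exact: (orbit_continuous regular_ell (ds a2) Rz).
rewrite (@eq_circle_int _ _ (fun t => k.+2%:R * k%:R * multipole k.+4 (set_ell2 t z))).
  rewrite circle_intZ; last exact: (orbit_continuous regular_ell (smooth_multipole _) Rz).
  rewrite -/(avg (multipole k.+4) z) => /eqP.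
  by rewrite !mulf_eq0 !pnatr_eq0 (gtn_eqF k0) /= => /eqP.
move=> t; set w := set_ell2 t z; have Rt : Reg w := regular_ell t Rz.
have Lw : L w = L z := angmom_invariant hm hM hC t (RD Rz).
have xw : x1 (C w) = x1 (C z) := x1_invariant hm hM hC t (RD Rz).
have gL : dot (gap w) (L z) = 0.
  by rewrite /gap dotDl dotNl xw inplane// -Lw /angmom dot_crossl subrr.
have xL : dot (cross (x2 (C w)) (L w)) (L z) = 0 by rewrite -Lw dotC dot_crossr.
have F1 := frame z _ _ Zz xL gL; have F2 := frame z _ _ Zz gL gL.
have T : dot (cross (x2 (C w)) (L w)) (gap w) = torque w.
  by rewrite /gap dotDr dotNr (dotC _ (x2 _)) dot_crossl subr0 dotC.
have i2 : invgap w ^+ 2 * dot (gap w) (gap w) = 1.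
  by rewrite -enorm_sqr -exprMn mulVf ?expr1n// gt_eqF// enorm_gt0 gap_neq0.
rewrite T in F1.
transitivity (- (2 * k.+2%:R) * (dot a1 (cross (x2 (C w)) (L w)) * dot a1 (gap w) +
     dot a2 (cross (x2 (C w)) (L w)) * dot a2 (gap w)) * invgap w ^+ k.+4
   + k.+2%:R * k.+4%:R * torque w * invgap w ^+ k.+4 * (invgap w ^+ 2 *
     (dot a1 (gap w) * dot a1 (gap w) + dot a2 (gap w) * dot a2 (gap w)))
   - k.+2%:R * torque w * invgap w ^+ k.+4 * (dot a1 a1 + dot a2 a2)).
  by ring.
rewrite F1 F2 i2 n1 n2 /multipole -/w; ring.
Qed.

(** If all odd moments vanish on [Z], so does by [moments_vanish] the mean of
    [torque], which is linear in [x1]. Displacing [x1] along the cross product of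
    the eccentricity vector and the angular momentum changes it by a positive multiple of
    the mean of the component of [x2] along the eccentricity vector, which is
    negative. *)
Lemma multipoles_not_all_zero z : Z z ->
  tangent Z z (cross (e z) (L z)) ->
  (forall j z, Z z -> avg (multipole (3 + j.*2)) z = 0) -> False.
Proof.
move=> Zz tz mj; have Rz := ZR Zz; have Dz := RD Rz.
have W0 z' : Z z' -> avg torque z' = 0.
  move=> Zz'; have Rz' := ZR Zz'.
  apply: (@moments_vanish _ (fun t => invgap (set_ell2 t z'))).
  - exact: (orbit_continuous regular_ell smooth_invgap Rz').
  - exact: (orbit_continuous regular_ell smooth_torque Rz').
  - by move=> t; rewrite invr_gt0 enorm_gt0 gap_neq0//; exact: regular_ell.
  - by move=> j; exact: mj.
have tp : ell_periodic Reg torque.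
  exact: (periodic_C (fun w => dot (x1 w) (cross (x2 w) (cross (x2 w) (y2 w))))).
have := tangent_avg Zz tz smooth_torque tp W0.
rewrite /avg (@eq_circle_int _ _ (fun t => dot (L z) (L z) *
  dot (e z) (x2 (C (set_ell2 t z))))); last first.
  move=> t; have Rt := regular_ell t Rz.
  rewrite (@derive_val _ _ _ _ _ _ _ (derive_displace_torque _ Rt)).
  rewrite (angmom_invariant hm hM hC t Dz) dot_cross_cross.
  by rewrite (dotC (e z) (L z)) dot_angmom_ecc mul0r subr0 mulrC.
rewrite circle_intZ; last first.
  apply: (orbit_continuous (f := fun z' => dot (e z) (x2 (C z'))) regular_ell) Rz.
  exact: (smooth_dot Ro (vsmooth_cst Ro (e z)) rx2).
move/eqP; rewrite mulf_eq0 dot_eq0 (negbTE (angmom_neq0 hC Dz)) /=.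
by rewrite lt_eqF// (mean_dot_ecc_lt0 hm hM hC Dz).
Qed.

End Vanishing.

End Potential.

(** * Integrability in space *)

Lemma independent_step (R : realType) n (F : 'I_n -> phase R n -> R) z
    (c : 'I_n -> R) (i0 : 'I_n) (v : phase R n) :
  (forall v, \sum_(i < n) c i * 'D_v (F i) z = 0) ->
  (forall i, i != i0 -> c i * 'D_v (F i) z = 0) -> 'D_v (F i0) z != 0 -> c i0 = 0.
Proof.
move=> H Hi D0; have := H v; rewrite (bigD1 i0)//= big1// addr0 => /eqP.
by rewrite mulf_eq0 (negbTE D0) orbF => /eqP.
Qed.

Section Spatial.
Context {R : realType} (m M : R) (hm : 0 < m) (hM : 0 < M).
Variables (A : set R) (V : set (phase R 5)) (C : phase R 6 -> phase R 6).
Hypothesis hC : partial_kepler_map m M A V C.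
Implicit Types (z v b : phase R 6) (a : 'rV[R]_3).

Let Dom := coord_domain A V.
Let Reg := regular_region m M A V C.
Let Do : open Dom := coord_domain_open hC.
Let Ro : open Reg := regular_open hC.
Let RD : Reg `<=` Dom := @regular_dom _ m M A V C.
Let Rell z t : Reg z -> Reg (set_ell2 t z) := @regular_ell _ m M hm hM A V C hC z t.
Local Notation L := (angmom C).

Definition coord1 (k : 'I_3) z := x1 (C z) ord0 k.
Definition axial z := dot (x1 (C z)) (L z).
(** [h2] comes last: the first five commute for elementary reasons. *)
Definition spatial_integrals : seq (phase R 6 -> R) :=
  [:: coord1 0; coord1 1; coord1 2; @Lambda2 R; axial; h2 C].
Definition spatial_integral (i : 'I_6) := nth (fun=> 0) spatial_integrals i.

Lemma invgap_periodic : ell_periodic Reg (invgap C).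
Proof. exact: (periodic_C hC (fun w => (enorm (x1 w - x2 w))^-1)). Qed.

Lemma smooth_h2 : smooth_on Reg (h2 C).
Proof.
exact: (smooth_mul Ro (smooth_cst Ro _)
  (smooth_avg Ro Rell (smooth_invgap hC))).
Qed.

Lemma smooth_coord1 k : smooth_on Reg (coord1 k).
Proof. exact: (vsmooth_sub_dom m M C (vsmooth_x1 hC)). Qed.

Lemma smooth_axial : smooth_on Reg axial.
Proof.
exact: (smooth_dot Ro (vsmooth_sub_dom m M C (vsmooth_x1 hC))
  (vsmooth_sub_dom m M C (vsmooth_angmom hC))).
Qed.

Lemma smooth_Lambda2 (D : set (phase R 6)) : open D -> smooth_on D (@Lambda2 R).
Proof. by move=> Do'; apply: (smooth_lincomp Do' (@Lambda2_continuous R) (smooth_id Do')). Qed.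

Lemma derive_Lambda2 v z : is_derive z v (@Lambda2 R) (Lambda2 v).
Proof. exact: (is_derive_lincomp (@Lambda2_continuous R) (is_derive_id z v)). Qed.

(** The energy determines [Lambda2], hence also its variations. *)
Lemma Lambda2_C z b : Dom z ->
  Lambda2 b = kappa m M z * two_form (kepler_energy_gradient m M (C z)) ('D_b C z).
Proof.
move=> Dz; have := pk_symplectic hC Dz ell_dir b.
by rewrite (ell_dir_derive hm hM hC Dz) two_formZl two_form_ell_dir mulNr => /oppr_inj.
Qed.

Lemma Lambda2_lift z u : Dom z -> Lambda2 (symp_lift C z u) = kappa m M z *
  (m * M * inv_radius C z ^+ 3 * dot (x2 (C z)) (x2 u) + m^-1 * dot (y2 u) (y2 (C z))).
Proof.
move=> Dz; rewrite (Lambda2_C _ Dz).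
rewrite (derive_symp_lift (C_diff hC Dz) (pk_symplectic hC Dz)).
rewrite two_form_cart /kepler_energy_gradient !cartE !(dot0l, dot0r) dotZl dotZr.
by rewrite /inv_radius; ring.
Qed.

Lemma ham_coord1 k z : Dom z ->
  ham (coord1 k) z = symp_lift C z (cart (delta_mx ord0 k) 0 0 0).
Proof.
move=> Dz; apply: ham_symp_lift => b.
rewrite (@derive_val _ _ _ _ _ _ _ (is_derive_coord ord0 k (is_derive_x1 hC b Dz))).
by rewrite two_form_cart !cartE !(dot0l, dot0r) (dotC (delta_mx _ _)) dot_delta; ring.
Qed.

Lemma ham_Lambda2 z : ham (@Lambda2 R) z = - ell_dir.
Proof.
apply: two_form_inj => b; rewrite two_form_ham; last first.
  exact: (smooth_differentiable (smooth_Lambda2 openT)).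
rewrite (@derive_val _ _ _ _ _ _ _ (derive_Lambda2 b z)).
by rewrite -scaleN1r two_formZl two_form_ell_dir; ring.
Qed.

(** The Hamiltonian vector field of [x1 . (x2 x y2)]: rotation of [(y2, x2)] about
    [x1], with the reaction of [y1]. *)
Definition axial_gradient z : phase R 6 :=
  cart (L z) (cross (y2 (C z)) (x1 (C z))) 0 (cross (x2 (C z)) (x1 (C z))).

Lemma derive_axial z b : Dom z ->
  'D_b axial z = two_form (axial_gradient z) ('D_b C z).
Proof.
move=> Dz; have H := is_derive_dot (is_derive_x1 hC b Dz)
  (is_derive_cross (is_derive_x2 hC b Dz) (is_derive_y2 hC b Dz)).
rewrite (@derive_val _ _ _ _ _ _ _ H) two_form_cart !cartE !dot0r.
rewrite (@dot_angmom_generator R _ b) (dotC (x1 _)) /angmom; ring.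
Qed.

Lemma ham_axial z : Dom z -> ham axial z = symp_lift C z (axial_gradient z).
Proof. by move=> Dz; apply: ham_symp_lift => b; exact: derive_axial. Qed.

Lemma axial_invariant : ell_invariant Dom axial.
Proof.
by move=> z t Dz; rewrite /axial (x1_invariant hm hM hC)// (angmom_invariant hm hM hC).
Qed.

Lemma derive_h2 v z : Reg z -> 'D_v (h2 C) z = (2 * pi)^-1 * 'D_v (avg (invgap C)) z.
Proof.
move=> Rz.
have H := smooth_is_derive v (smooth_avg Ro Rell (smooth_invgap hC)) Rz.
exact: (@derive_val _ _ _ _ _ _ _ (is_derive_scal (2 * pi)^-1 H)).
Qed.

(** Displacing [y1] is the flow of [a . x1], which is constant on the Kepler orbits,
    and [y1] does not occur in the averaged function. *)
Lemma derive_h2_y1 a z : Reg z -> 'D_(symp_lift C z (cart a 0 0 0)) (h2 C) z = 0.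
Proof.
move=> Rz; rewrite derive_h2//.
rewrite (avg_along hm hM hC (g := fun z => dot a (x1 (C z)))
  (u := fun=> cart a 0 0 0) _ _ (smooth_invgap hC) invgap_periodic Rz).
- rewrite /avg (@eq_circle_int _ _ (fun=> 0)) ?circle_int_cst ?mulr0// => t.
  have := is_derive_lift_invgap hC (cart a 0 0 0) (Rell t Rz).
  move=> H; rewrite (@derive_val _ _ _ _ _ _ _ H).
  by rewrite !cartE subrr dot0r mulr0.
- by move=> w t Dw; rewrite (x1_invariant hm hM hC).
- move=> w b Dw.
  have H := is_derive_dot (is_derive_const a w b) (is_derive_x1 hC b Dw).
  rewrite (@derive_val _ _ _ _ _ _ _ H).
  by rewrite two_form_cart !cartE !(dot0l, dot0r); ring.
Qed.

(** A rotation of [x2] about [x1] preserves their distance. *)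
Lemma poisson_h2_axial z : Reg z -> 'D_(ham axial z) (h2 C) z = 0.
Proof.
move=> Rz; rewrite derive_h2// ham_axial; last exact: RD.
rewrite (avg_along hm hM hC axial_invariant (u := axial_gradient)
  _ (smooth_invgap hC) invgap_periodic Rz); last by move=> w b Dw; exact: derive_axial.
rewrite /avg (@eq_circle_int _ _ (fun=> 0)) ?circle_int_cst ?mulr0// => t.
have := is_derive_lift_invgap hC (axial_gradient (set_ell2 t z)) (Rell t Rz).
move=> H; rewrite (@derive_val _ _ _ _ _ _ _ H).
by rewrite !cartE sub0r dotNr /gap dotDl dotNl dot_crossr dot_crossl subrr oppr0 mulr0.
Qed.

Lemma poisson_h2_ell z : Reg z -> 'D_ell_dir (h2 C) z = 0.
Proof.
move=> Rz; rewrite derive_h2//.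
have [_ ->] := avg_diff Ro Rell (smooth_invgap hC) Rz.
rewrite /avg (@eq_circle_int _ _ (fun=> 0)) ?circle_int_cst ?mulr0// => t.
by rewrite (set_ell2E 0 ell_dir) ell2_ell_dir sub0r scaleN1r subrr derive0.
Qed.

(** The second condition is the bracket with [Lambda2], whose Hamiltonian vector
    field is [- ell_dir]. *)
Definition commutes (f : phase R 6 -> R) z := [/\ differentiable f z, 'D_ell_dir f z = 0,
  forall k, 'D_(ham (coord1 k) z) f z = 0 & 'D_(ham axial z) f z = 0].

Lemma commutes_coord1 k z : Reg z -> commutes (coord1 k) z.
Proof.
move=> Rz; have Dz := RD Rz; split.
- exact: smooth_differentiable (smooth_coord1 k) Rz.
- rewrite (@derive_val _ _ _ _ _ _ _
    (is_derive_coord ord0 k (is_derive_ell_x1 hm hM hC Dz))) mxE //.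
- move=> j; rewrite ham_coord1// (@derive_val _ _ _ _ _ _ _
    (is_derive_coord ord0 k (is_derive_lift_x1 hC _ Dz))) cartE mxE //.
- rewrite ham_axial// (@derive_val _ _ _ _ _ _ _
    (is_derive_coord ord0 k (is_derive_lift_x1 hC _ Dz))) cartE mxE //.
Qed.

Lemma commutes_axial z : Reg z -> commutes axial z.
Proof.
move=> Rz; have Dz := RD Rz; have df := smooth_differentiable smooth_axial Rz; split=> //.
- rewrite derive_axial// (ell_dir_derive hm hM hC Dz) two_formZr two_form_cart.
  rewrite /kepler_energy_gradient !cartE !(dot0l, dot0r) !dotZr !dotZl.
  by rewrite (dotC _ (cross _ _)) (dotC (cross _ _) (y2 _)) dot_crossl
    (dotC (cross _ _)) dot_crossl; ring.
- move=> k; rewrite ham_coord1// derive_axial//.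
  rewrite (derive_symp_lift (C_diff hC Dz) (pk_symplectic hC Dz)).
  by rewrite two_form_cart !cartE !(dot0l, dot0r); ring.
- by rewrite -poissonE// /poisson big1// => i _; rewrite subrr.
Qed.

Lemma commutes_h2 z : Reg z -> commutes (h2 C) z.
Proof.
move=> Rz; split.
- exact: smooth_differentiable smooth_h2 Rz.
- exact: poisson_h2_ell.
- by move=> k; rewrite (ham_coord1 _ (RD Rz)); exact: derive_h2_y1.
- exact: poisson_h2_axial.
Qed.

Lemma commutes_Lambda2 z : Reg z -> commutes (@Lambda2 R) z.
Proof.
move=> Rz; have Dz := RD Rz.
have dL : differentiable (@Lambda2 R) z.
  exact: (smooth_differentiable (smooth_Lambda2 openT)).
have swap (g : phase R 6 -> R) : differentiable g z -> 'D_ell_dir g z = 0 -> 'D_(ham g z) (@Lambda2 R) z = 0.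
  move=> dg g0; rewrite -poissonE// poissonC poissonE// ham_Lambda2.
  by rewrite deriveNv// g0 !oppr0.
split=> //.
- by rewrite (@derive_val _ _ _ _ _ _ _ (derive_Lambda2 _ z)) -[LHS]opprK
    -two_form_ell_dir /two_form subrr oppr0.
- by move=> k; have [d e _ _] := commutes_coord1 k Rz; exact: swap.
- by have [d e _ _] := commutes_axial Rz; exact: swap.
Qed.

Lemma spatial_commutes i z : Reg z -> commutes (spatial_integral i) z.
Proof.
move=> Rz; case: i => -[|[|[|[|[|[|//]]]]]] ?; rewrite /spatial_integral /=;
  [exact: commutes_coord1 | exact: commutes_coord1 | exact: commutes_coord1
  | exact: commutes_Lambda2 | exact: commutes_axial | exact: commutes_h2].
Qed.

Lemma spatial_poisson i j z : Reg z ->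
  poisson (spatial_integral i) (spatial_integral j) z = 0.
Proof.
move=> Rz.
have elem (k : 'I_6) (f : phase R 6 -> R) : (k < 5)%N -> commutes f z -> poisson f (spatial_integral k) z = 0.
  move=> k5 [df fe fx fa]; rewrite (poissonE _ df).
  case: k k5 => -[|[|[|[|[|k]]]]] k6 k5; rewrite /spatial_integral /=.
  - exact: fx.
  - exact: fx.
  - exact: fx.
  - by rewrite ham_Lambda2 (deriveNv _ df) fe oppr0.
  - exact: fa.
  - by exfalso.
have [j5|j5] := ltnP j 5; first exact: elem j5 (spatial_commutes i Rz).
have [i5|i5] := ltnP i 5.
  by rewrite poissonC (elem _ _ i5 (spatial_commutes j Rz)) oppr0.
have -> : i = j.
  by apply: val_inj => /=; have := ltn_ord i; have := ltn_ord j; move: i5 j5; lia.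
by rewrite /poisson big1// => k _; rewrite subrr.
Qed.

Lemma smooth_spatial_integral i : smooth_on Reg (spatial_integral i).
Proof.
case: i => -[|[|[|[|[|[|k]]]]]] k6; rewrite /spatial_integral.
- exact: smooth_coord1.
- exact: smooth_coord1.
- exact: smooth_coord1.
- exact: smooth_Lambda2.
- exact: smooth_axial.
- exact: smooth_h2.
- by exfalso.
Qed.

Lemma h2_periodic z : h2 C (z + ell2_period R) = h2 C z.
Proof.
have E t : set_ell2 t (z + ell2_period R) = set_ell2 t z.
  rewrite addrC set_ell2D ell2_periodE set_ell2E ell2Z ell2_ell_dir mulr1 sub0r.
  by rewrite scaleNr subrr add0r.
rewrite !h2E /avg.
by rewrite (@eq_circle_int _ _ (fun t => invgap C (set_ell2 t z))) // => t; rewrite E.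
Qed.

Lemma spatial_integral_periodic i z : Reg z ->
  spatial_integral i (z + ell2_period R) = spatial_integral i z.
Proof.
move=> Rz; have CE := pk_periodic hC (RD Rz).
case: i => -[|[|[|[|[|[|k]]]]]] k6; rewrite /spatial_integral /=.
- by rewrite /coord1 CE.
- by rewrite /coord1 CE.
- by rewrite /coord1 CE.
- by rewrite /Lambda2 /= !mxE addr0.
- by rewrite /axial /angmom CE.
- exact: h2_periodic.
- by exfalso.
Qed.

Lemma derive_lift_coord1 k z u : Dom z ->
  'D_(symp_lift C z u) (coord1 k) z = x1 u ord0 k.
Proof.
move=> Dz; exact: (@derive_val _ _ _ _ _ _ _
  (is_derive_coord ord0 k (is_derive_lift_x1 hC u Dz))).
Qed.

Lemma derive_lift_axial z u : Dom z ->
  'D_(symp_lift C z u) axial z = two_form (axial_gradient z) u.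
Proof.
move=> Dz; rewrite derive_axial//.
by rewrite (derive_symp_lift (C_diff hC Dz) (pk_symplectic hC Dz)).
Qed.

Lemma derive_rotation_Lambda2 a z : Dom z -> 'D_(rotation C a z) (@Lambda2 R) z = 0.
Proof.
move=> Dz; rewrite (@derive_val _ _ _ _ _ _ _ (derive_Lambda2 _ z)) Lambda2_lift//.
rewrite !cartE dot_crossl (dotC (cross _ _)) dot_crossl; ring.
Qed.

Lemma derive_rotation_axial a z : Dom z ->
  'D_(rotation C a z) axial z = dot (x1 (C z)) (cross (L z) a).
Proof.
move=> Dz; rewrite derive_lift_axial// two_form_cart !cartE !(dot0l, dot0r).
by rewrite /angmom ?vecE !(vecE, mxE); ring.
Qed.

(** Test directions: the rotation about the angular momentum isolates [h2], a
    further rotation the axial integral, a dilation of [x2] isolates [Lambda2]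
    and the displacements of [x1] its components. *)
Lemma spatial_independent z : Reg z -> avg (multipole C 3) z != 0 ->
  independent_at spatial_integral z.
Proof.
move=> Rz mu0 c H; have Dz := RD Rz.
pose o3 : 'I_6 := @Ordinal 6 3 isT; pose o4 : 'I_6 := @Ordinal 6 4 isT.
pose o5 : 'I_6 := @Ordinal 6 5 isT.
have F3 : spatial_integral o3 = @Lambda2 R by [].
have F4 : spatial_integral o4 = axial by [].
have F5 : spatial_integral o5 = h2 C by [].
have Fx (i : 'I_6) : (i < 3)%N -> exists2 k : 'I_3, val k = i & spatial_integral i = coord1 k.
  case: i => -[|[|[|i]]] i6 i3.
  - by exists 0.
  - by exists 1.
  - by exists 2.
  - by exfalso.
have split6 (i : 'I_6) : [\/ (i < 3)%N, i = o3, i = o4 | i = o5].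
  case: i => -[|[|[|[|[|[|i]]]]]] i6.
  - exact: Or41.
  - exact: Or41.
  - exact: Or41.
  - by apply: Or42; exact: val_inj.
  - by apply: Or43; exact: val_inj.
  - by apply: Or44; exact: val_inj.
  - by exfalso.
have Dx u (i : 'I_6) : x1 u = 0 -> (i < 3)%N ->
    'D_(symp_lift C z u) (spatial_integral i) z = 0.
  move=> u0 /Fx[k _ ->]; rewrite (derive_lift_coord1 k u Dz) u0; exact: mxE.
have c5 : c o5 = 0.
  apply: (@independent_step _ _ _ z c o5 (rotation C (L z) z) H).
    move=> i i5; have [i3|->|->|iE] := split6 i.
    - rewrite (Dx _ _ _ i3) ?mulr0// cartE //.
    - by rewrite F3 (derive_rotation_Lambda2 _ Dz) mulr0.
    - by rewrite F4 (derive_rotation_axial _ Dz) crossvv dot0r mulr0.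
    - by rewrite iE eqxx in i5.
  rewrite F5 (derive_h2 _ Rz) (avg_rotation_invgap hm hM hC Rz) mulf_neq0//.
  by rewrite invr_neq0// mulf_neq0// gt_eqF// pi_gt0.
(* [torque] is [(x1 x L) . x2] up to sign. *)
have xL0 : cross (x1 (C z)) (L z) != 0.
  apply: contra_neq mu0 => xL; rewrite /avg (@eq_circle_int _ _ (fun=> 0)).
    by rewrite circle_int_cst mulr0.
  move=> t; rewrite /multipole /torque (x1_invariant hm hM hC _ Dz).
  rewrite (angmom_invariant hm hM hC _ Dz) dot_cross_cyc crossC xL oppr0 dot0r.
  by rewrite mul0r.
have c4 : c o4 = 0.
  apply: (@independent_step _ _ _ z c o4 (rotation C (cross (x1 (C z)) (L z)) z) H).
    move=> i i4; have [i3|->|iE|->] := split6 i.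
    - rewrite (Dx _ _ _ i3) ?mulr0// cartE //.
    - by rewrite F3 (derive_rotation_Lambda2 _ Dz) mulr0.
    - by rewrite iE eqxx in i4.
    - by rewrite c5 mul0r.
  rewrite F4 (derive_rotation_axial _ Dz) dot_cross_cyc dot_cross_cyc.
  by rewrite dot_eq0.
have c3 : c o3 = 0.
  apply: (@independent_step _ _ _ z c o3 (symp_lift C z (cart 0 0 0 (x2 (C z)))) H).
    move=> i ii; have [i3|iE|->|->] := split6 i.
    - rewrite (Dx _ _ _ i3) ?mulr0// cartE //.
    - by rewrite iE eqxx in ii.
    - by rewrite c4 mul0r.
    - by rewrite c5 mul0r.
  rewrite F3 (@derive_val _ _ _ _ _ _ _ (derive_Lambda2 _ z)) (Lambda2_lift _ Dz).
  rewrite !cartE dot0l mulr0 addr0 mulf_neq0 ?(kappa_neq0 hm hM hC Dz)//.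
  apply: mulf_neq0; last by rewrite dot_eq0 (x2_neq0 hC Dz).
  apply: mulf_neq0; first by rewrite gt_eqF// mulr_gt0.
  by rewrite expf_neq0// gt_eqF// (inv_radius_gt0 hC Dz).
move=> i; have [i3|->|->|->] := split6 i => //.
have [k kE Fk] := Fx i i3.
apply: (@independent_step _ _ _ z c i (displace C (delta_mx ord0 k) z) H).
  move=> j ji; have [j3|->|->|->] := split6 j.
  - have [l lE ->] := Fx j j3; rewrite (derive_lift_coord1 l _ Dz) cartE mxE eqxx /=.
    rewrite (_ : l == k = false) ?mulr0//; apply/negbTE; apply: contra_neq ji => lk.
    by apply: val_inj; rewrite -[LHS]lE -[RHS]kE lk.
  - by rewrite c3 mul0r.
  - by rewrite c4 mul0r.
  - by rewrite c5 mul0r.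
by rewrite Fk (derive_lift_coord1 k _ Dz) cartE mxE !eqxx oner_eq0.
Qed.

Lemma nonparallel_open : open (nonparallel_region m M A V C).
Proof.
pose f z := cross (cross (x1 (C z)) (y1 (C z))) (cross (x2 (C z)) (y2 (C z))).
have fs : vsmooth Dom f.
  apply: vsmooth_cross => //; apply: vsmooth_cross => //.
  - exact: vsmooth_x1 hC. - exact: vsmooth_y1 hC.
  - exact: vsmooth_x2 hC. - exact: vsmooth_y2 hC.
rewrite openE => z [Rz /eqP f0].
have ffc : {for z, continuous (fun z => dot (f z) (f z))}.
  exact: (smooth_continuous (smooth_dot Do fs fs) (RD Rz)).
have : \forall y \near z, Reg y /\ dot (f y) (f y) != 0.
  apply: filterI; first exact: open_nbhs_nbhs.
  by apply: (cvgr_neq0 _ ffc); rewrite dot_eq0.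
by apply: filterS => y [Ry]; rewrite dot_eq0 => /eqP fy; split.
Qed.

Lemma open_tangent (Z : set (phase R 6)) z a : open Z -> Z z ->
  tangent m M A V C Z z a.
Proof.
move=> Zo Zz f fs f0.
have : \forall y \near z, cst 0 y = f y.
  have : \forall y \near z, Z y by exact: open_nbhs_nbhs.
  by apply: filterS => y /f0 ->.
by move=> /near_eq_derive <-; rewrite derive_cst.
Qed.

(** Displacing [x1] along the angular momentum shows that [axial] does not vanish
    identically on [Z]. Where it does not vanish, [vertical_step] would propagate
    the vanishing of the moment of order three to all odd orders. *)
Lemma exists_torque (Z : set (phase R 6)) z0 : open Z -> Z `<=` Reg -> Z z0 ->
  exists2 z, Z z & avg (multipole C 3) z != 0.
Proof.
move=> Zo ZR Zz0; apply: contrapT => none.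
have mu z : Z z -> avg (multipole C 3) z = 0.
  by move=> Zz; apply: contrapT => /eqP mu0; apply: none; exists z.
have [z1 Zz1 ax1] : exists2 z, Z z & axial z != 0.
  apply: contrapT => noz.
  have ax0 z : Z z -> axial z = 0.
    by move=> Zz; apply: contrapT => /eqP a0; apply: noz; exists z.
  have Dz0 := RD (ZR _ Zz0).
  have := open_tangent (L z0) Zo Zz0 smooth_axial ax0.
  rewrite derive_lift_axial// two_form_cart !cartE !(dot0l, dot0r) subr0 addr0 subr0.
  by move/eqP; rewrite dot_eq0 (negbTE (angmom_neq0 hC Dz0)).
pose Z1 := Z `&` [set z | axial z != 0].
have Z1o : open Z1.
  rewrite openE => z [Zz az].
  have : \forall y \near z, Z y /\ axial y != 0.
    apply: filterI; first exact: open_nbhs_nbhs.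
    exact: (cvgr_neq0 _ (smooth_continuous smooth_axial (ZR _ Zz)) az).
  by apply: filterS.
have Z1R : Z1 `<=` Reg by move=> z [/ZR].
have mj j z : Z1 z -> avg (multipole C (3 + j.*2)) z = 0.
  elim: j z => [|j IH] z Z1z; first by case: Z1z => Zz _; exact: mu.
  have -> : (3 + j.+1.*2 = (2 + j.*2).+3)%N by lia.
  apply: (vertical_step hm hM hC Z1R (k := 2 + j.*2)) Z1z.
  - by move=> w [].
  - by move=> w Z1w; exact: open_tangent.
  - by move=> w Z1w; rewrite (_ : (2 + j.*2).+1 = 3 + j.*2)%N ?IH//; lia.
exact: (multipoles_not_all_zero hm hM hC Z1R (conj Zz1 ax1)
  (open_tangent _ Z1o (conj Zz1 ax1)) mj).
Qed.

Theorem spatial_integrability :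
  integrable_by_quadratures (ell2_period R) (nonparallel_region m M A V C) (h2 C).
Proof.
have NR : nonparallel_region m M A V C `<=` Reg by move=> z [].
exists spatial_integral; split.
- by exists (@Ordinal 6 5 isT).
- by move=> i; exact: smooth_subset NR (smooth_spatial_integral i).
- by move=> i z /NR; exact: spatial_integral_periodic.
- by move=> i j z /NR; exact: spatial_poisson.
move=> z0 Nz0 B Bz0.
have [U [Uo Uz0] UB] : exists2 U, open_nbhs z0 U & U `<=` B.
  by move: Bz0; rewrite nbhsE => -[U UU UB]; exists U.
pose Z := U `&` nonparallel_region m M A V C.
have Zo : open Z by apply: openI => //; exact: nonparallel_open.
have ZR : Z `<=` Reg by move=> z [_ /NR].
have [z [Uz Nz] mu] := exists_torque Zo ZR (conj Uz0 Nz0).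
exists z; split; last exact: UB.
split=> //; apply: spatial_independent => //; exact: NR.
Qed.

End Spatial.

(** * Local inversion of symplectic maps *)

Section LinearBound.
Context {R : realType} {k n : nat}.

Lemma phase_norm_le (v : phase R n) (c : R) : 0 <= c ->
  (forall i, `|v.1 ord0 i| <= c) -> (forall i, `|v.2 ord0 i| <= c) -> `|v| <= c.
Proof.
move=> c0 h1 h2; rewrite prod_normE ge_max; apply/andP; split.
  rewrite {1}/Num.Def.normr/= mx_normrE; apply/bigmax_leP; split=> //= -[i j] _ /=.
  by rewrite ord1.
rewrite {1}/Num.Def.normr/= mx_normrE; apply/bigmax_leP; split=> //= -[i j] _ /=.
by rewrite ord1.
Qed.

Lemma linear_phase_bounded (L : phase R k -> phase R n) : linear L ->
  exists2 K, 0 < K & forall v, `|L v| <= K * `|v|.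
Proof.
move=> Llin.
pose f1 i v := (L v).1 ord0 i; pose f2 i v := (L v).2 ord0 i.
have l1 i : scalar (f1 i) by move=> a u v; rewrite /f1 Llin /= !mxE.
have l2 i : scalar (f2 i) by move=> a u v; rewrite /f2 Llin /= !mxE.
have b0 (f : phase R k -> R) : 0 <= basis_sum f.
  by rewrite addr_ge0// sumr_ge0.
pose K := \sum_i basis_sum (f1 i) + \sum_i basis_sum (f2 i).
have K0 : 0 <= K by rewrite addr_ge0// sumr_ge0.
exists (K + 1); first by rewrite ltr_wpDl.
move=> v; have Kv : K * `|v| <= (K + 1) * `|v| by rewrite ler_wpM2r// lerDl.
apply: phase_norm_le => [|i|i].
- by rewrite mulr_ge0// addr_ge0.
- apply: le_trans (scalar_phase_bound v (l1 i)) _; apply: le_trans Kv.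
  rewrite ler_wpM2r// /K (bigD1 i)//= -addrA lerDl addr_ge0//; exact: sumr_ge0.
- apply: le_trans (scalar_phase_bound v (l2 i)) _; apply: le_trans Kv.
  rewrite ler_wpM2r// /K addrC (bigD1 i)//= -addrA lerDl addr_ge0//; exact: sumr_ge0.
Qed.

End LinearBound.

Section LocalInverse.
Context {R : realType} {n : nat}.
Variables (D : set (phase R n)) (C : phase R n -> phase R n).
Hypotheses (Do : open D) (Cd : forall z, D z -> differentiable C z).
Hypothesis sC : forall z, D z -> forall a b : phase R n,
  two_form ('D_a C z) ('D_b C z) = two_form a b.
Implicit Types (u v w z h : phase R n).

Lemma symp_lift_linear z : linear (symp_lift C z).
Proof.
move=> a u v; rewrite [RHS]surjective_pairing /symp_lift /=.
congr (_, _); apply/rowP => i; rewrite !mxE two_formDl two_formZl//.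
by rewrite opprD mulrN.
Qed.

Lemma phase_ball_compact z (r : R) : compact [set y | `|y - z| <= r].
Proof.
have cb (x : 'rV[R]_n) : compact [set y | `|y - x| <= r].
  apply: bounded_closed_compact.
    exists (`|x| + r); split; first by rewrite num_real.
    move=> M' xM y /= yx; apply: (le_trans _ (ltW xM)).
    have := ler_normD (y - x) x; rewrite subrK => h; apply: le_trans h _.
    by rewrite addrC lerD2l.
  apply: (@closed_comp _ _ (fun y : 'rV[R]_n => `|y - x|) [set s | s <= r]).
    move=> y _; exact: (cvg_norm (cvgB cvg_id (cvg_cst x))).
  exact: closed_le.
rewrite (_ : [set y | _] =
    [set y | `|y - z.1| <= r] `*` [set y | `|y - z.2| <= r]).
  exact: compact_setX.
apply/seteqP; split=> y /=; rewrite prod_normE ge_max /=.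
  by case/andP.
by case=> -> ->.
Qed.

Let sq v := dot v.1 v.1 + dot v.2 v.2.

Lemma sq_eq0 v : sq v = 0 -> v = 0.
Proof.
have d0 (x : 'rV[R]_n) : 0 <= dot x x by apply: sumr_ge0 => i _; rewrite -expr2 sqr_ge0.
have e0 (x : 'rV[R]_n) : dot x x = 0 -> x = 0.
  move=> /eqP; rewrite psumr_eq0 => [/allP a0|i _]; last by rewrite -expr2 sqr_ge0.
  apply/rowP => i; rewrite mxE; have := a0 i (mem_index_enum _).
  by rewrite /= -expr2 sqrf_eq0 => /eqP.
move=> /eqP; rewrite paddr_eq0// => /andP[/eqP/e0 v1 /eqP/e0 v2].
by rewrite [v]surjective_pairing v1 v2.
Qed.

Lemma sq_le v : sq v <= 2 * n%:R * `|v| ^+ 2.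
Proof.
have : forall (x : 'rV[R]_n), `|x| <= `|v| -> dot x x <= n%:R * `|v| ^+ 2.
  move=> x xv; rewrite /dot; apply: le_trans (_ : \sum_(i < n) `|v| ^+ 2 <= _).
    apply: ler_sum => i _; rewrite -expr2 -real_normK ?num_real//.
    by rewrite lerXn2r ?nnegrE//; apply: le_trans xv; exact: coord_le_norm.
  by rewrite sumr_const card_ord mulr_natl.
move=> H; rewrite -mulrA mulr_natl mulr2n; apply: lerD; apply: H;
  by rewrite [leRHS]prod_normE le_max lexx ?orbT.
Qed.

Lemma sq_ge v : `|v| ^+ 2 <= sq v.
Proof.
have d0 (x : 'rV[R]_n) : 0 <= dot x x by apply: sumr_ge0 => i _; rewrite -expr2 sqr_ge0.
have s0 : 0 <= sq v by rewrite addr_ge0.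
have di (x : 'rV[R]_n) i : `|x ord0 i| ^+ 2 <= dot x x.
  rewrite /dot (bigD1 i)//= real_normK ?num_real// expr2 lerDl.
  by apply: sumr_ge0 => j _; rewrite -expr2 sqr_ge0.
rewrite -[leRHS]sqr_sqrtr// lerXn2r ?nnegrE ?sqrtr_ge0//.
have le2 (x : R) : `|x| ^+ 2 <= sq v -> `|x| <= Num.sqrt (sq v).
  by move=> h; rewrite -[`|x|]ger0_norm// -sqrtr_sqr ler_sqrt.
apply: phase_norm_le => [|i|i]; first exact: sqrtr_ge0.
  by apply: le2; apply: le_trans (di _ i) _; rewrite lerDl.
by apply: le2; apply: le_trans (di _ i) _; rewrite lerDr.
Qed.

(** Local surjectivity with a linear estimate, by minimizing the distance
    to the target: a minimum in the interior of the ball is critical, hence a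
    preimage since the differential is onto. *)
Lemma local_surjectivity z0 : D z0 ->
  exists2 K, 0 < K & \forall w \near C z0,
    exists z, [/\ D z, C z = w & `|z - z0| <= K * `|w - C z0|].
Proof.
move=> Dz0.
have [K1 K10 SK] := linear_phase_bounded (symp_lift_linear z0).
(* The inverse of the differential at [z0] is [symp_lift], of norm at most [K1]; near
   [z0] the map [C] is therefore expanding with factor [(2 * K1)^-1]. *)
have hK h : `|h| <= K1 * `|'D_h C z0|.
  by rewrite -{1}[h](symp_lift_derive (Cd Dz0) (sC Dz0)); exact: SK.
have e0 : 0 < (2 * K1)^-1 by rewrite invr_gt0 mulr_gt0.
have lower : \forall h \near (0 : phase R n), `|h| <= 2 * K1 * `|C (h + z0) - C z0|.
  apply: filterS (differentiable_expansion (Cd Dz0) e0) => h hh.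
  have h1 : `|'D_h C z0| <= `|C (h + z0) - C z0| + (2 * K1)^-1 * `|h|.
    have := ler_normD ('D_h C z0 - (C (h + z0) - C z0)) (C (h + z0) - C z0).
    rewrite subrK => h1; apply: le_trans h1 _.
    by rewrite addrC lerD2l distrC.
  have h2 := le_trans (hK h) (ler_wpM2l (ltW K10) h1).
  have h3 : K1 * ((2 * K1)^-1 * `|h|) = `|h| / 2 by field; rewrite gt_eqF.
  rewrite mulrDr h3 in h2; lra.
have Dn : \forall h \near (0 : phase R n), D (h + z0).
  have : \forall y \near z0, D y by exact: open_nbhs_nbhs.
  by rewrite (near_shift 0) subr0.
have [r0 /= r00 rP] := nbhs_norm0P.1 (filterI lower Dn).
pose r := r0 / 2; have r_gt0 : 0 < r by rewrite divr_gt0.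
have ballP z : `|z - z0| <= r -> D z /\ `|z - z0| <= 2 * K1 * `|C z - C z0|.
  move=> zr; have [] := rP (z - z0).
    by rewrite /=; apply: le_lt_trans zr _; rewrite /r ltr_pdivrMr// ltr_pMr// ltr1n.
  by rewrite subrK.
exists (2 * K1); first by rewrite mulr_gt0.
pose s := r / (2 * K1); have s0 : 0 < s by rewrite divr_gt0// mulr_gt0.
(* [s] bounds from below the displacement of [C] on the sphere of radius [r]. The
   denominator absorbs the comparison of the sup norm with the Euclidean one,
   so that the minimum is smaller at the centre than on the sphere. *)
pose d := s / (2 * n%:R + 2).
have n2 : 0 < 2 * n%:R + 2 :> R by rewrite ltr_wpDl// mulr_ge0.
have d0 : 0 < d by rewrite divr_gt0.
near=> w.
have wd : `|C z0 - w| < d by near: w; exact: cvgr_dist_lt.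
pose B := [set y | `|y - z0| <= r].
pose f z := sq (C z - w).
have Cc z : D z -> {for z, continuous C}.
  by move=> Dz; apply: differentiable_continuous; exact: Cd.
have fder z v : D z -> is_derive z v f
    (2 * (dot ('D_v C z).1 (C z - w).1 + dot ('D_v C z).2 (C z - w).2)).
  move=> Dz.
  have Cv : is_derive z v (fun z => C z - w) ('D_v C z).
    have := is_derive_sub (derivableP (diff_derivable (v := v) (Cd Dz)))
      (is_derive_const w z v).
    by rewrite subr0.
  have c1 : is_derive z v (fun z => (C z - w).1) ('D_v C z).1.
    by apply: (@is_derive_lincomp _ _ _ _ fst) Cv; move=> y; exact: cvg_fst.
  have c2 : is_derive z v (fun z => (C z - w).2) ('D_v C z).2.
    by apply: (@is_derive_lincomp _ _ _ _ snd) Cv; move=> y; exact: cvg_snd.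
  apply: (is_derive_eq (is_derive_add (is_derive_dot c1 c1) (is_derive_dot c2 c2))).
  by rewrite (dotC _ ('D_v C z).1) (dotC _ ('D_v C z).2); ring.
have f_cont z : D z -> {for z, continuous f}.
  move=> Dz; have gc : {for z, continuous (fun z => C z - w)}.
    by apply: cvgB; [exact: Cc|exact: cvg_cst].
  have sumc (g : phase R n -> 'rV[R]_n) : {for z, continuous g} ->
      {for z, continuous (fun z => dot (g z) (g z))}.
    move=> gc'; apply: cvg_big => [|i _]; first exact: add_continuous.
    have ci : {for z, continuous (fun z => g z ord0 i)}.
      apply: (@continuous_comp _ _ _ g (fun x : 'rV[R]_n => x ord0 i)) => //.
      by apply: differentiable_continuous; exact: differentiable_coord.
    exact: cvgM.
  apply: cvgD; apply: sumc.
    by apply: (@cvg_comp _ _ _ (fun z => C z - w) fst _ _ _ gc); exact: cvg_fst.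
  by apply: (@cvg_comp _ _ _ (fun z => C z - w) snd _ _ _ gc); exact: cvg_snd.
have fc : {within B, continuous f}.
  apply: continuous_in_subspaceT => z /set_mem /ballP[Dz _]; exact: f_cont.
have Bz0 : B z0 by rewrite /B /= subrr normr0 ltW.
have [c /set_mem Bc cmin] := compact_EVT_min (ex_intro _ z0 Bz0)
  (phase_ball_compact (z := z0) (r := r)) fc.
have [Dc clow] := ballP c Bc.
have inside : `|c - z0| < r.
  rewrite ltNge; apply/negP => rc.
  have cz : s <= `|C c - C z0|.
    by rewrite /s ler_pdivrMr ?mulr_gt0// mulrC; apply: le_trans clow.
  have cw : (2 * n%:R + 1) * d <= `|C c - w|.
    have sE : s = (2 * n%:R + 2) * d by rewrite /d mulrC divfK// gt_eqF.
    have := ler_normD (C c - w) (w - C z0); rewrite subrKA.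
    rewrite [`|w - _|]distrC; move: wd cz; rewrite sE; lra.
  have f1 : f c <= f z0 by apply: cmin; exact/mem_set.
  have f2 := le_trans (sq_ge (C c - w)) (le_trans f1 (sq_le (C z0 - w))).
  have q0 : 0 <= (n%:R : R) by [].
  have f3 : `|C z0 - w| ^+ 2 <= d ^+ 2 by rewrite lerXn2r ?nnegrE// ltW.
  have f4 : ((2 * n%:R + 1) * d) ^+ 2 <= `|C c - w| ^+ 2.
    by rewrite lerXn2r ?nnegrE// mulr_ge0// ?ltW// addr_ge0// mulr_ge0.
  have f5 : 2 * n%:R * `|C z0 - w| ^+ 2 <= 2 * n%:R * d ^+ 2.
    by rewrite ler_wpM2l// mulr_ge0.
  have : (2 * n%:R + 1) ^+ 2 * d ^+ 2 <= 2 * n%:R * d ^+ 2.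
    by rewrite -exprMn; apply: le_trans f4 (le_trans f2 f5).
  rewrite ler_pM2r ?exprn_gt0// sqrrD1; nra.
have crit v : 'D_v f c = 0.
  have near_in : \forall h \near (0 : R), `|h *: v + c - z0| < r.
    have nc : (fun h : R => `|h *: v + c - z0|) @ 0 --> `|0 *: v + c - z0|.
      apply: cvg_norm; apply: cvgB; last exact: cvg_cst.
      by apply: cvgD; [apply: cvgZr_tmp; exact: cvg_id|exact: cvg_cst].
    by apply: (cvgr_lt _ nc); rewrite scale0r add0r.
  have [t /= t0 tB] := nbhs_norm0P.1 near_in.
  have inB (h : R) : h \in `]-t, t[%R -> B (h *: v + c).
    by rewrite in_itv/= => /andP[h1 h2]; apply/ltW/tB; rewrite /= ltr_norml h1.
  apply: (@derive_val _ _ _ _ _ _ _ (_ : is_derive c v f 0)); apply/is_derive_line.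
  apply: (@derive1_at_min _ _ (- t) t); first by rewrite ltW// gtrN.
  - move=> h /inB/ballP[Dh _].
    have H := @is_derive_along _ _ _ f (fun s : R => s *: v + c) h v _ _ (fder _ v Dh).
    by case: H => // k; rewrite scalerDl addrA.
  - by rewrite in_itv/= oppr_lt0 t0.
  - by move=> h /inB Bh; rewrite scale0r add0r; apply: cmin; exact/mem_set.
have wC : C c = w.
  apply/subr0_eq/sq_eq0; have [v vE] := derive_surj (Cd Dc) (sC Dc) (C c - w).
  have := crit v; rewrite (@derive_val _ _ _ _ _ _ _ (fder c v Dc)) vE => /eqP.
  by rewrite mulf_eq0 pnatr_eq0 /= => /eqP.
by exists c; split=> //; rewrite -wC.
Unshelve. all: by end_near. Qed.

Section Chart.
Context {k : nat}.
Variables (emb : phase R k -> phase R n) (Z : set (phase R n)).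
Hypotheses (emb_lin : linear emb) (Zo : open Z) (ZD : Z `<=` D).

Definition chart : set (phase R k) := [set w : phase R k | exists2 z, Z z & C z = emb w].

Lemma embD (u' v' : phase R k) : emb (u' + v') = emb u' + emb v'.
Proof. by have := emb_lin 1 u' v'; rewrite !scale1r. Qed.

Lemma emb_near (w0 : phase R k) (P : set (phase R n)) :
  nbhs (emb w0) P -> \forall w \near w0, P (emb w).
Proof.
have [K K0 eK] := linear_phase_bounded emb_lin.
pose e' : {linear phase R k -> phase R n} := HB.pack_for {linear phase R k -> phase R n}
  emb (GRing.isLinear.Build R (phase R k) (phase R n) _ emb emb_lin).
have ec : continuous e'.
  apply/linear_bounded_continuous/linear_boundedP; near=> r => x.
  by apply: le_trans (eK x) _; rewrite ler_wpM2r.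
by move=> Pw; exact: (ec w0 _ Pw).
Unshelve. all: by end_near. Qed.

(** Local surjectivity with preimages close to the given one. *)
Lemma chart_open : open chart.
Proof.
rewrite openE => w0 [z0 Zz0 Cz0].
have [K K0 loc] := local_surjectivity (ZD Zz0).
have [r /= r0 rZ] : exists2 r, 0 < r & forall y, `|y - z0| < r -> Z y.
  have /nbhs_normP[r r0 rZ] : nbhs z0 Z by exact: open_nbhs_nbhs.
  by exists r => // y yr; apply: rZ; rewrite /= distrC.
rewrite Cz0 in loc.
have close : \forall w \near emb w0, K * `|w - emb w0| < r.
  have rK : 0 < r / K by rewrite divr_gt0.
  have : \forall w \near emb w0, `|emb w0 - w| < r / K.
    by apply/nbhs_normP; exists (r / K).
  by apply: filterS => w; rewrite distrC ltr_pdivlMr// mulrC.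
apply: filterS (emb_near (filterI loc close)) => w [[z [Dz Cz zK]] wr].
by exists z => //; apply: rZ; exact: le_lt_trans wr.
Qed.

(** The differential of the inverse of [C] is [symp_lift]. *)
Lemma chart_derive (O : set (phase R k)) (G : phase R k -> R) (f : phase R n -> R)
    z0 (w0 : phase R k) :
  nbhs w0 O -> Z z0 -> C z0 = emb w0 -> differentiable f z0 ->
  (forall z (w : phase R k), Z z -> O w -> C z = emb w -> G w = f z) ->
  differentiable G w0 /\ forall v : phase R k, 'D_v G w0 = 'D_(symp_lift C z0 (emb v)) f z0.
Proof.
move=> On Zz0 Cz0 df Gf; have Dz0 := ZD Zz0.
have [Ke Ke0 eK] := linear_phase_bounded emb_lin.
have Slin := symp_lift_linear z0.
have SB (u v : phase R n) : symp_lift C z0 (u + v) = symp_lift C z0 u + symp_lift C z0 v.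
  by have := Slin 1 u v; rewrite !scale1r.
have [Ks Ks0 SK] := linear_phase_bounded Slin.
pose L (v : phase R k) := 'D_(symp_lift C z0 (emb v)) f z0.
have Llin : scalar L.
  move=> a u v; rewrite /L emb_lin Slin deriveDv// deriveZv//.
have flin : scalar (fun h => 'D_h f z0) by move=> a u v; exact: derive_linear.
pose Kf := basis_sum (fun h => 'D_h f z0) + 1.
have Kf0 : 0 < Kf by rewrite ltr_wpDl// addr_ge0// sumr_ge0.
have fK h : `|'D_h f z0| <= Kf * `|h|.
  apply: le_trans (scalar_phase_bound h flin) _.
  by rewrite ler_wpM2r// lerDl.
apply: (@differentiable_of_expansion _ _ _ _ _ L (basis_sum L)) => //.
  by move=> h; exact: scalar_phase_bound.
move=> e e0.
have [K K0 loc] := local_surjectivity Dz0.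
(* [e1] is the error of [f] and [e2] that of [C], seen through [symp_lift] and the
   differential of [f]. *)
pose e1 := e / (2 * (K * Ke)); pose e2 := e / (2 * (Kf * Ks * K * Ke)).
have e10 : 0 < e1 by rewrite divr_gt0// !mulr_gt0.
have e20 : 0 < e2 by rewrite divr_gt0// !mulr_gt0.
have Zn : \forall h \near (0 : phase R n), Z (h + z0).
  have : \forall y \near z0, Z y by exact: open_nbhs_nbhs.
  by rewrite (near_shift 0) subr0.
have [r /= r0 rP] := nbhs_norm0P.1 (filterI Zn (filterI
  (differentiable_expansion df e10) (differentiable_expansion (Cd Dz0) e20))).
rewrite Cz0 in loc.
have close : \forall w \near emb w0, K * `|w - emb w0| < r.
  have rK : 0 < r / K by rewrite divr_gt0.
  have : \forall w \near emb w0, `|emb w0 - w| < r / K.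
    by apply/nbhs_normP; exists (r / K).
  by apply: filterS => w; rewrite distrC ltr_pdivlMr// mulrC.
have near_w0 : \forall h \near (0 : phase R k), (exists z,
    [/\ D z, C z = emb (h + w0) & `|z - z0| <= K * `|emb (h + w0) - emb w0|]) /\
    K * `|emb (h + w0) - emb w0| < r.
  have := emb_near (filterI loc close).
  rewrite (near_shift 0) subr0 => H; exact: H.
have near_O : \forall h \near (0 : phase R k), O (h + w0).
  have : \forall w \near w0, O w by [].
  rewrite (near_shift 0) subr0 => H; exact: H.
apply: filterS2 near_O near_w0 => h Oh [[z [Dz Cz zK]] wr].
rewrite embD addrK in zK wr.
have zr : `|z - z0| < r := le_lt_trans zK wr.
have [Zz [fz Cz']] := rP _ zr; rewrite subrK in Zz fz Cz'.
set d := z - z0 in zK fz Cz' zr.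
rewrite (Gf z (h + w0) Zz Oh Cz) (Gf z0 w0 Zz0 (nbhs_singleton On) Cz0).
have Ch : C z - C z0 = emb h by rewrite Cz Cz0 embD addrK.
rewrite Ch in Cz'.
have LE : L h = 'D_d f z0 + 'D_(symp_lift C z0 (emb h - 'D_d C z0)) f z0.
  rewrite /L -(deriveDv _ _ df); congr ('D_ _ f z0).
  by rewrite -[X in X + _](symp_lift_derive (Cd Dz0) (sC Dz0)) -SB addrC subrK.
have dK : `|d| <= K * Ke * `|h|.
  by apply: le_trans zK _; rewrite -mulrA ler_wpM2l ?(ltW K0).
have t2 : `|'D_(symp_lift C z0 (emb h - 'D_d C z0)) f z0| <= Kf * (Ks * (e2 * `|d|)).
  apply: le_trans (fK _) _; rewrite ler_wpM2l ?(ltW Kf0)//.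
  by apply: le_trans (SK _) _; rewrite ler_wpM2l ?(ltW Ks0).
rewrite LE opprD addrA.
apply: le_trans (ler_normB _ _) _.
have a1 : e1 * `|d| <= e / 2 * `|h|.
  apply: le_trans (ler_wpM2l (ltW e10) dK) _.
  by rewrite le_eqVlt /e1; apply/orP; left; apply/eqP; field; rewrite !gt_eqF.
have a2 : Kf * (Ks * (e2 * `|d|)) <= e / 2 * `|h|.
  have p : 0 <= Kf * Ks * e2 by apply/ltW/mulr_gt0 => //; exact: mulr_gt0.
  have -> : Kf * (Ks * (e2 * `|d|)) = Kf * Ks * e2 * `|d| by rewrite -!mulrA.
  apply: le_trans (ler_wpM2l p dK) _.
  by rewrite le_eqVlt /e2; apply/orP; left; apply/eqP; field; rewrite !gt_eqF.
have -> : e * `|h| = e / 2 * `|h| + e / 2 * `|h| by field.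
by apply: lerD; [apply: le_trans fz a1|apply: le_trans t2 a2].
Qed.

Hypothesis Cs : smooth_on D C.

(** By definition [symp_lift] depends on the first derivatives of [C]
    polynomially. *)
Lemma smooth_lift_derive (f : phase R n -> R) u : smooth_on Z f ->
  smooth_on Z (fun z => 'D_(symp_lift C z u) f z).
Proof.
move=> fs.
have tlin : scalar (two_form u) by move=> a x y; rewrite two_formDr two_formZr.
pose t : {scalar phase R n} := HB.pack_for {scalar phase R n} (two_form u)
  (GRing.isLinear.Build R (phase R n) R _ (two_form u) tlin).
have tc : continuous t.
  apply/linear_bounded_continuous/linear_boundedP; near=> r => x.
  by apply: le_trans (scalar_phase_bound x tlin) _; rewrite ler_wpM2r.
have ts b : smooth_on Z (fun z => two_form u ('D_b C z)).
  apply: (smooth_subset ZD).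
  exact: (@smooth_lincomp _ _ _ _ _ t _ Do tc (smooth_derive b Cs)).
apply: (@smooth_eq _ _ _ _ Zo (fun z =>
  \sum_i two_form u ('D_(basis_q i) C z) * 'D_(basis_p i) f z +
  \sum_i (-1 * two_form u ('D_(basis_p i) C z)) * 'D_(basis_q i) f z)).
  move=> z Zz; rewrite (derive_phase _ (smooth_differentiable fs Zz)) /symp_lift /=.
  by congr (_ + _); apply: eq_bigr => i _; rewrite !mxE// mulN1r.
apply: smooth_add => //; apply: smooth_sum => // i; apply: smooth_mul => //.
- exact: smooth_derive.
- by apply: smooth_mul => //; exact: smooth_cst.
- exact: smooth_derive.
Unshelve. all: by end_near. Qed.

(** Derivatives of functions of the given form are again of this form, by
    [chart_derive]; the inverse of [C] never appears explicitly. *)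
Lemma chart_smooth (G : phase R k -> R) (f : phase R n -> R) :
  smooth_on Z f -> (forall z (w : phase R k), Z z -> C z = emb w -> G w = f z) ->
  smooth_on chart G.
Proof.
move=> fs Gf.
pose P (G : phase R k -> R) := exists2 f : phase R n -> R, smooth_on Z f &
  forall z (w : phase R k), Z z -> C z = emb w -> G w = f z.
have PG : P G by exists f.
apply: (smooth_coind chart_open _ PG) => {PG Gf fs f} {}G [f fs Gf].
split=> [w [z Zz Cz]|v].
  by case: (@chart_derive setT G f z w filterT Zz Cz (smooth_differentiable fs Zz)
    (fun z' _ Zz' _ => Gf z' _ Zz')).
exists (fun w : phase R k => 'D_v G w); split=> //.
exists (fun z => 'D_(symp_lift C z (emb v)) f z); first exact: smooth_lift_derive.
move=> z w Zz Cz.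
by have [_ ->] := @chart_derive setT G f z w filterT Zz Cz (smooth_differentiable fs Zz)
  (fun z' _ Zz' _ => Gf z' _ Zz').
Qed.

End Chart.
End LocalInverse.

(** * Integrability of the planar problem *)

Section Frame.
Context {R : realType} (E : 'M[R]_(2, 3)).
Hypothesis hE : orthonormal_frame E.

Lemma dotE n (a b : 'rV[R]_n) : dot a b = (a *m b^T) ord0 ord0.
Proof. by rewrite mxE; apply: eq_bigr => i _; rewrite mxE. Qed.

Lemma dot_frame (a b : 'rV[R]_2) : dot (a *m E) (b *m E) = dot a b.
Proof. by rewrite !dotE trmx_mul mulmxA -(mulmxA a) hE mulmx1. Qed.

Definition frame_normal := cross (row 0 E) (row 1 E).

Lemma mul_frame (a : 'rV[R]_2) : a *m E = a ord0 0 *: row 0 E + a ord0 1 *: row 1 E.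
Proof.
apply/rowP => k; rewrite !mxE !big_ord_recr big_ord0 /= add0r.
by congr (_ + _); congr (_ * _); congr (fun_of_matrix _ _ _); exact: val_inj.
Qed.

Lemma dot_rows i j : dot (row i E) (row j E) = (i == j)%:R.
Proof.
have := congr1 (fun A : 'M[R]_2 => A i j) hE; rewrite !mxE => <-.
by apply: eq_bigr => k _; rewrite !mxE.
Qed.

Lemma dot_normal_frame (a : 'rV[R]_2) : dot frame_normal (a *m E) = 0.
Proof.
rewrite mul_frame dotDr !dotZr /frame_normal (dotC (cross _ _)) dot_crossl.
by rewrite (dotC (cross _ _)) dot_crossr; ring.
Qed.

Lemma cross_frame (a b : 'rV[R]_2) : cross (a *m E) (b *m E) =
  (a ord0 0 * b ord0 1 - a ord0 1 * b ord0 0) *: frame_normal.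
Proof.
rewrite !mul_frame /frame_normal.
by apply: row3P; rewrite !(vecE, mxE); ring.
Qed.

(** The residual is orthogonal to both rows and to the normal, so that its
    cross product with the normal vanishes. *)
Lemma frame_decomp (u : 'rV[R]_3) : dot frame_normal u = 0 ->
  u = dot (row 0 E) u *: row 0 E + dot (row 1 E) u *: row 1 E.
Proof.
move=> nu; set p := (X in _ = X); apply/subr0_eq/eqP; rewrite -dot_eq0.
pose r := u - p; rewrite -/r.
have d00 := dot_rows 0 0; have d11 := dot_rows 1 1; have d01 := dot_rows 0 1.
rewrite /= in d00 d11 d01.
have r0 : dot r (row 0 E) = 0.
  rewrite /r /p dotDl dotNl dotDl !dotZl d00 (dotC (row 1 E) (row 0 E)) d01.
  by rewrite (dotC u); ring.
have r1 : dot r (row 1 E) = 0.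
  rewrite /r /p dotDl dotNl dotDl !dotZl d11 d01 (dotC u); ring.
have rn : dot r frame_normal = 0.
  rewrite /r /p dotDl dotNl dotDl !dotZl /frame_normal dot_crossl dot_crossr.
  by rewrite (dotC u) -/frame_normal nu; ring.
have n1 : dot frame_normal frame_normal = 1.
  by rewrite /frame_normal dot_cross_cross d00 d11 (dotC (row 1 E)) d01; ring.
have rxn : cross r frame_normal = 0.
  by rewrite /frame_normal cross_cross r0 r1 !scale0r subrr.
have := dot_cross_cross r frame_normal r frame_normal.
by rewrite rxn dot0l n1 rn mul0r subr0 mulr1 => <-.
Qed.

Lemma frame_range (u : 'rV[R]_3) : dot frame_normal u = 0 -> (u *m E^T) *m E = u.
Proof.
move=> nu; rewrite [RHS]frame_decomp// mul_frame.
by congr (_ *: _ + _ *: _); rewrite mxE; apply: eq_bigr => k _; rewrite !mxE mulrC.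
Qed.

Lemma frame_dot (u v : 'rV[R]_3) : dot frame_normal u = 0 -> dot frame_normal v = 0 ->
  dot (row 0 E) u * dot (row 0 E) v + dot (row 1 E) u * dot (row 1 E) v = dot u v.
Proof.
move=> nu nv; rewrite [in RHS](frame_decomp nu) dotDl !dotZl //.
Qed.

Local Notation emb := (planar_embedding E).

Lemma emb_cart (w : phase R 4) : emb w =
  cart (lsubmx (w.1 : 'rV[R]_(2 + 2)) *m E) (rsubmx (w.1 : 'rV[R]_(2 + 2)) *m E)
       (lsubmx (w.2 : 'rV[R]_(2 + 2)) *m E) (rsubmx (w.2 : 'rV[R]_(2 + 2)) *m E).
Proof. by []. Qed.

Lemma emb_linear : linear emb.
Proof.
move=> k u v; rewrite -[RHS]cart_eta y1_linear y2_linear x1_linear x2_linear.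
by rewrite !emb_cart !cartE /= !linearP /= !mulmxDl -!scalemxAl.
Qed.

Definition flat (a b c d : 'rV[R]_3) : phase R 4 :=
  (row_mx (a *m E^T) (b *m E^T) : 'rV[R]_(2 + 2),
   row_mx (c *m E^T) (d *m E^T) : 'rV[R]_(2 + 2)).

Lemma emb_flat (a b c d : 'rV[R]_3) :
  dot frame_normal a = 0 -> dot frame_normal b = 0 ->
  dot frame_normal c = 0 -> dot frame_normal d = 0 ->
  emb (flat a b c d) = cart a b c d.
Proof.
by move=> a0 b0 c0 d0; rewrite emb_cart /= !(row_mxKl, row_mxKr) !frame_range.
Qed.

Lemma two_form_emb (u v : phase R 4) : two_form (emb u) (emb v) = two_form u v.
Proof.
have eta (p : 'rV[R]_4) :
  p = row_mx (lsubmx (p : 'rV[R]_(2 + 2))) (rsubmx (p : 'rV[R]_(2 + 2))).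
  by rewrite (@hsubmxK R 1 2 2).
have D (a b c d : 'rV[R]_2) :
  @dot R 4 (row_mx a b) (row_mx c d) = dot a c + dot b d := dot_row_mx a c b d.
rewrite two_form_cart !emb_cart !cartE !dot_frame /two_form.
by rewrite [in RHS](eta u.1) [in RHS](eta u.2) [in RHS](eta v.1) [in RHS](eta v.2) !D;
  ring.
Qed.

End Frame.

Section Planar.
Context {R : realType} (m M : R) (hm : 0 < m) (hM : 0 < M).
Variables (A : set R) (V : set (phase R 5)) (C : phase R 6 -> phase R 6).
Hypothesis hC : partial_kepler_map m M A V C.
Variables (E : 'M[R]_(2, 3)) (H : phase R 4 -> R).
Hypotheses (hE : orthonormal_frame E) (hH : planar_restriction m M A V C E H).
Implicit Types (z v b : phase R 6) (w : phase R 4).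

Let Dom := coord_domain A V.
Let Reg := regular_region m M A V C.
Let Do : open Dom := coord_domain_open hC.
Let Ro : open Reg := regular_open hC.
Let RD : Reg `<=` Dom := @regular_dom _ m M A V C.
Let Rell z t : Reg z -> Reg (set_ell2 t z) := @regular_ell _ m M hm hM A V C hC z t.
Let Cd z : Dom z -> differentiable C z := @C_diff _ m M A V C hC z.
Let sC := pk_symplectic hC.
Let Cs := pk_smooth hC.
Local Notation L := (angmom C).
Local Notation emb := (planar_embedding E).
Local Notation nu := (frame_normal E).

Definition planar_coord (k : 'I_2) w : R := (w.2 : 'rV[R]_(2 + 2)) ord0 (lshift 2 k).
Definition planar_energy w := kepler_energy m M (y2 (emb w)) (x2 (emb w)).
Definition planar_integral (i : 'I_4) :=
  nth (fun=> 0) [:: planar_coord 0; planar_coord 1; planar_energy; H] i.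

(** The same functions before restriction, on the coordinates of [C]. *)
Let coordE k z := dot (row k E) (x1 (C z)).
Let energy z := kepler_energy m M (y2 (C z)) (x2 (C z)).
Definition planar_source (i : 'I_4) :=
  nth (fun=> 0) [:: coordE 0; coordE 1; energy; h2 C] i.

Lemma planar_coordE k z w : C z = emb w -> planar_coord k w = coordE k z.
Proof.
move=> Cz; rewrite /coordE Cz emb_cart cartE.
have -> : row k E = delta_mx ord0 k *m E.
  by apply/rowP => j; rewrite -rowE.
by rewrite (dot_frame hE) dotC dot_delta mxE.
Qed.

Lemma planar_integralE i z w : Reg z -> C z = emb w ->
  planar_integral i w = planar_source i z.
Proof.
move=> Rz Cz; case: i => -[|[|[|[|i]]]] i4; rewrite /planar_integral /planar_source /=.
- exact: planar_coordE.
- exact: planar_coordE.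
- by rewrite /planar_energy /energy Cz.
- exact: hH.
- by exfalso.
Qed.

Lemma smooth_energy : smooth_on Reg energy.
Proof.
have vy := vsmooth_sub_dom m M C (vsmooth_y2 hC).
have vx := vsmooth_sub_dom m M C (vsmooth_x2 hC).
apply: (@smooth_eq _ _ _ _ Ro (fun z => dot (y2 (C z)) (y2 (C z)) * (2 * m)^-1
  - m * M * inv_radius C z)).
  by move=> z Rz; rewrite /energy /kepler_energy enorm_sqr.
apply: (smooth_sub Ro); apply: (smooth_mul Ro).
- exact: (smooth_dot Ro vy vy).
- exact: smooth_cst.
- exact: smooth_cst.
- exact: (smooth_subset RD (smooth_inv_radius hC)).
Qed.

Lemma smooth_planar_source i : smooth_on Reg (planar_source i).
Proof.
have vx := vsmooth_sub_dom m M C (vsmooth_x1 hC).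
case: i => -[|[|[|[|i]]]] i4; rewrite /planar_source /=.
- exact: (smooth_dot Ro (vsmooth_cst Ro _) vx).
- exact: (smooth_dot Ro (vsmooth_cst Ro _) vx).
- exact: smooth_energy.
- exact: smooth_h2.
- by exfalso.
Qed.

Lemma derive_planar i z w (v : phase R 4) : Reg z -> C z = emb w ->
  differentiable (planar_integral i) w /\
  'D_v (planar_integral i) w = 'D_(symp_lift C z (emb v)) (planar_source i) z.
Proof.
move=> Rz Cz.
have [d dE] := @chart_derive _ _ Dom C Do Cd sC 4 emb Reg (emb_linear E) Ro RD setT
  (planar_integral i) (planar_source i) z w filterT Rz Cz
  (smooth_differentiable (smooth_planar_source i) Rz)
  (fun z' w' Rz' _ Cz' => planar_integralE i Rz' Cz').
by split.
Qed.

Lemma derive_energy z b : Dom z ->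
  'D_b energy z = two_form (kepler_energy_gradient m M (C z)) ('D_b C z).
Proof.
move=> Dz.
have d1 := is_derive_kepler_energy M hm (y := fun z => y2 (C z))
  (x := fun z => x2 (C z)) (x2_neq0 hC Dz) (is_derive_y2 hC b Dz) (is_derive_x2 hC b Dz).
rewrite (@derive_val _ _ _ _ _ _ _ d1) two_form_cart !cartE !(dot0l, dot0r).
rewrite dotZl dotZr (dotC (y2 ('D_b C z))); ring.
Qed.

(** The Kepler flow is a translation of [ell2]. *)
Lemma lift_energy_gradient z : Dom z ->
  symp_lift C z (kepler_energy_gradient m M (C z)) = - (kappa m M z)^-1 *: ell_dir.
Proof.
move=> Dz; apply: two_form_inj => b.
rewrite (two_form_symp_lift (Cd Dz)) two_formZl two_form_ell_dir.
by rewrite (Lambda2_C hm hM hC b Dz) mulrNN mulKf// (kappa_neq0 hm hM hC Dz).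
Qed.

Section At.
Variables (z : phase R 6) (w : phase R 4).
Hypotheses (Rz : Reg z) (Cz : C z = emb w).

Let Dz : Dom z := RD Rz.

(** [x2] and [y2] lie in the plane of the frame. *)
Lemma normal_angmom : exists2 l, l != 0 & L z = l *: nu.
Proof.
have [l lE] : exists l, L z = l *: nu.
  rewrite /angmom Cz emb_cart !cartE cross_frame.
  by eexists.
exists l => //; apply: contraTneq (angmom_neq0 hC Dz) => l0.
by rewrite -/(angmom C z) lE l0 scale0r eqxx.
Qed.

Lemma normal_perp u : dot (L z) u = 0 -> dot nu u = 0.
Proof.
have [l l0 ->] := normal_angmom; rewrite dotZl => /eqP.
by rewrite mulf_eq0 (negbTE l0) /= => /eqP.
Qed.

Lemma perp_emb_x1 : dot (L z) (x1 (C z)) = 0.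
Proof.
by have [l _ ->] := normal_angmom; rewrite dotZl Cz emb_cart cartE dot_normal_frame mulr0.
Qed.

Lemma emb_ham i u :
  (forall b, 'D_b (planar_source i) z = two_form u ('D_b C z)) ->
  (exists u', emb u' = u) -> emb (ham (planar_integral i) w) = u.
Proof.
move=> fu [u' uE]; rewrite -uE in fu *; congr planar_embedding; apply: two_form_inj => b.
have [dG dE] := derive_planar i b Rz Cz.
rewrite (two_form_ham _ dG) dE fu (derive_symp_lift (Cd Dz) (sC Dz)).
exact: two_form_emb.
Qed.

(** The Hamiltonian vector fields of the elementary planar integrals, lifted to
    the coordinates of [C]: displacements of [y1], and the Kepler motion. *)
Lemma planar_poisson_elem i (j : 'I_4) : (j < 3)%N ->
  poisson (planar_integral i) (planar_integral j) w = 0.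
Proof.
move=> j3; have [dG _] := derive_planar i 0 Rz Cz.
rewrite (poissonE _ dG); have [_ ->] := derive_planar i (ham (planar_integral j) w) Rz Cz.
have y1_zero a : 'D_(symp_lift C z (cart a 0 0 0)) (planar_source i) z = 0.
  have x1z k : 'D_(symp_lift C z (cart a 0 0 0)) (coordE k) z = 0.
    have h := is_derive_dot (is_derive_const (row k E) z (symp_lift C z (cart a 0 0 0)))
      (is_derive_lift_x1 hC (cart a 0 0 0) Dz).
    by rewrite (@derive_val _ _ _ _ _ _ _ h) cartE dot0l dot0r addr0.
  case: i {dG} => -[|[|[|[|i]]]] i4; rewrite /planar_source /=.
  - exact: x1z.
  - exact: x1z.
  - rewrite (derive_energy _ Dz) (derive_symp_lift (Cd Dz) (sC Dz)).
    by rewrite two_form_cart !cartE !(dot0l, dot0r); ring.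
  - exact: (derive_h2_y1 hm hM hC a Rz).
  - by exfalso.
have coord_u k : 'D_(symp_lift C z (cart (row k E) 0 0 0)) (planar_source i) z = 0.
  exact: y1_zero.
have nrow k : dot nu (row k E) = 0.
  have -> : row k E = delta_mx ord0 k *m E by apply/rowP => l; rewrite -rowE.
  exact: dot_normal_frame.
have ham_coord k (l : 'I_4) : planar_source l = coordE k ->
    emb (ham (planar_integral l) w) = cart (row k E) 0 0 0.
  move=> lk; apply: emb_ham; last first.
    by exists (flat E (row k E) 0 0 0); rewrite emb_flat// ?dot0r//; exact: nrow.
  move=> b; rewrite lk.
  have h := is_derive_dot (is_derive_const (row k E) z b) (is_derive_x1 hC b Dz).
  rewrite (@derive_val _ _ _ _ _ _ _ h) two_form_cart !cartE !(dot0l, dot0r); ring.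
case: j j3 => -[|[|[|j]]] j4 j3; last by exfalso.
- by rewrite (ham_coord 0); [exact: coord_u|].
- by rewrite (ham_coord 1); [exact: coord_u|].
rewrite (@emb_ham _ (kepler_energy_gradient m M (C z))); last 2 first.
- by move=> b; exact: derive_energy.
- have x2n : dot nu (x2 (C z)) = 0 by rewrite Cz emb_cart cartE dot_normal_frame.
  have y2n : dot nu (y2 (C z)) = 0 by rewrite Cz emb_cart cartE dot_normal_frame.
  exists (flat E 0 (m * M * (enorm (x2 (C z)))^-1 ^+ 3 *: x2 (C z)) 0
    (- m^-1 *: y2 (C z))).
  by rewrite emb_flat// ?dot0r// dotZr ?x2n ?y2n mulr0.
rewrite (lift_energy_gradient Dz).
rewrite (deriveZv _ _ (smooth_differentiable (smooth_planar_source i) Rz)).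
suff -> : 'D_ell_dir (planar_source i) z = 0 by rewrite scaler0.
have x1z k : 'D_ell_dir (coordE k) z = 0.
  have h := is_derive_dot (is_derive_const (row k E) z ell_dir)
    (is_derive_ell_x1 hm hM hC Dz).
  by rewrite (@derive_val _ _ _ _ _ _ _ h) dot0l dot0r addr0.
case: i {dG y1_zero coord_u} => -[|[|[|[|i]]]] i4; rewrite /planar_source /=.
- exact: x1z.
- exact: x1z.
- rewrite (derive_energy _ Dz) (ell_dir_derive hm hM hC Dz) two_formZr.
  by rewrite /two_form subrr mulr0.
- exact: (poisson_h2_ell hm hM hC Rz).
- by exfalso.
Qed.

Lemma planar_poisson i j : poisson (planar_integral i) (planar_integral j) w = 0.
Proof.
have [j3|j3] := ltnP j 3; first exact: planar_poisson_elem.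
have [i3|i3] := ltnP i 3.
  by rewrite poissonC (planar_poisson_elem _ i3) oppr0.
have -> : i = j.
  by apply: val_inj => /=; have := ltn_ord i; have := ltn_ord j; move: i3 j3; lia.
by rewrite /poisson big1// => k _; rewrite subrr.
Qed.

(** As in space: rotation of [(y2, x2)] in the plane, dilation of [x2], and
    displacements of [x1] isolate the integrals one after the other. *)
Lemma planar_independent : avg (multipole C 3) z != 0 ->
  independent_at planar_integral w.
Proof.
move=> mu0 c Hc.
have derive_flat (i : 'I_4) (a b d e : 'rV[R]_3) : dot nu a = 0 -> dot nu b = 0 -> dot nu d = 0 ->
    dot nu e = 0 -> 'D_(flat E a b d e) (planar_integral i) w =
    'D_(symp_lift C z (cart a b d e)) (planar_source i) z.
  by move=> a0 b0 d0 e0; have [_ ->] := derive_planar i (flat E a b d e) Rz Cz;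
    rewrite emb_flat.
have x1z (k : 'I_2) (u : phase R 6) : 'D_(symp_lift C z u) (coordE k) z = dot (row k E) (x1 u).
  have h := is_derive_dot (is_derive_const (row k E) z (symp_lift C z u))
    (is_derive_lift_x1 hC u Dz).
  by rewrite (@derive_val _ _ _ _ _ _ _ h) dot0l add0r.
have ez (u : phase R 6) : 'D_(symp_lift C z u) energy z =
    two_form (kepler_energy_gradient m M (C z)) u.
  by rewrite (derive_energy _ Dz) (derive_symp_lift (Cd Dz) (sC Dz)).
pose o2 : 'I_4 := @Ordinal 4 2 isT; pose o3 : 'I_4 := @Ordinal 4 3 isT.
have F2 : planar_source o2 = energy by [].
have F3 : planar_source o3 = h2 C by [].
have split4 (i : 'I_4) : [\/ exists2 k : 'I_2, val k = i & planar_source i = coordE k,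
    i = o2 | i = o3].
  case: i => -[|[|[|[|i]]]] i4.
  - by apply: Or31; exists 0.
  - by apply: Or31; exists 1.
  - by apply: Or32; exact: val_inj.
  - by apply: Or33; exact: val_inj.
  - by exfalso.
have z0 : dot nu 0 = 0 := dot0r nu.
have x2n : dot nu (x2 (C z)) = 0 by rewrite Cz emb_cart cartE dot_normal_frame.
have nL (u : 'rV[R]_3) : dot nu (cross u (L z)) = 0.
  by apply: normal_perp; rewrite dot_crossr.
(* Rotation of [(y2, x2)] about the angular momentum. *)
have c3 : c o3 = 0.
  apply: (@independent_step _ _ _ w c o3
    (flat E 0 (cross (y2 (C z)) (L z)) 0 (cross (x2 (C z)) (L z))) Hc).
    move=> i i3; rewrite (derive_flat i) //.
    have [[k _ ->]|->|iE] := split4 i.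
    - by rewrite x1z cartE dot0r mulr0.
    - rewrite F2 ez two_form_cart !cartE !(dot0l, dot0r) !dotZl !dotZr dot_crossl.
      rewrite (dotC (cross _ _) (y2 _)) dot_crossl; ring.
    - by rewrite iE eqxx in i3.
  rewrite (derive_flat o3) // F3 (derive_h2 hm hM hC _ Rz) (avg_rotation_invgap hm hM hC Rz).
  by rewrite mulf_neq0// invr_neq0// mulf_neq0// gt_eqF// pi_gt0.
(* Dilation of [x2]. *)
have c2 : c o2 = 0.
  apply: (@independent_step _ _ _ w c o2 (flat E 0 0 0 (x2 (C z))) Hc).
    move=> i i2; rewrite (derive_flat i) //.
    have [[k _ ->]|iE|->] := split4 i.
    - by rewrite x1z cartE dot0r mulr0.
    - by rewrite iE eqxx in i2.
    - by rewrite c3 mul0r.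
  rewrite (derive_flat o2) // F2 ez two_form_cart !cartE !(dot0l, dot0r) dotZl.
  rewrite add0r !subr0; apply: mulf_neq0; last by rewrite dot_eq0 (x2_neq0 hC Dz).
  apply: mulf_neq0; first by rewrite gt_eqF// mulr_gt0.
  by rewrite expf_neq0// gt_eqF// (inv_radius_gt0 hC Dz).
move=> i; have [[k kE Fk]|->|->] := split4 i => //.
have nrow (l : 'I_2) : dot nu (row l E) = 0.
  have -> : row l E = delta_mx ord0 l *m E by apply/rowP => j; rewrite -rowE.
  exact: dot_normal_frame.
apply: (@independent_step _ _ _ w c i (flat E 0 0 (row k E) 0) Hc).
  move=> j ji; rewrite (derive_flat j) //.
  have [[l lE ->]|->|->] := split4 j.
  - rewrite x1z cartE (dot_rows hE) (_ : l == k = false) ?mulr0//.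
    apply/negbTE; apply: contra_neq ji => lk.
    by apply: val_inj; rewrite -[LHS]lE -[RHS]kE lk.
  - by rewrite c2 mul0r.
  - by rewrite c3 mul0r.
by rewrite (derive_flat i) // Fk x1z cartE (dot_rows hE) eqxx oner_eq0.
Qed.

End At.

(** Planar states near a given one form a set whose tangent displacements of [x1]
    are those of the plane: the zero function of the planar phase space has the
    same lifted derivatives as a function vanishing on these states. *)
Lemma planar_exists_torque (O : set (phase R 4)) z0 w0 : open O -> O w0 ->
  Reg z0 -> C z0 = emb w0 ->
  exists z w, [/\ Reg z, O w, C z = emb w & avg (multipole C 3) z != 0].
Proof.
move=> Oo Ow0 Rz0 Cz0; apply: contrapT => none.
pose Z := [set z | Reg z /\ exists2 w, O w & C z = emb w].
have ZR : Z `<=` Reg by move=> z [].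
have mu z : Z z -> avg (multipole C 3) z = 0.
  move=> [Rz [w Ow Cz]]; apply: contrapT => /eqP mu0; apply: none.
  by exists z, w; split.
have nrow (l : 'I_2) : dot nu (row l E) = 0.
  have -> : row l E = delta_mx ord0 l *m E by apply/rowP => j; rewrite -rowE.
  exact: dot_normal_frame.
have tangentZ z (a : 'rV[R]_3) : Z z -> dot nu a = 0 -> tangent m M A V C Z z a.
  move=> [Rz [w Ow Cz]] na f fs f0.
  have On : nbhs w O by exact: open_nbhs_nbhs.
  have f0' z' w' : Reg z' -> O w' -> C z' = emb w' -> (fun=> 0) w' = f z'.
    by move=> Rz' Ow' Cz'; rewrite f0//; split=> //; exists w'.
  have [_ dE] := @chart_derive _ _ Dom C Do Cd sC 4 emb Reg (emb_linear E) Ro RD O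
    (fun=> 0) f z w On Rz Cz (smooth_differentiable fs Rz) f0'.
  have := dE (flat E 0 0 a 0); rewrite emb_flat ?dot0r// /displace => <-.
  exact: derive_cst.
have mj (j : nat) z : Z z -> avg (multipole C (3 + j.*2)) z = 0.
  elim: j z => [|j IH] z Zz; first exact: mu.
  have -> : (3 + j.+1.*2 = (1 + j.*2).+4)%N by lia.
  apply: (planar_step hm hM hC ZR (k := 1 + j.*2) (a1 := row 0 E) (a2 := row 1 E)) Zz.
  - by [].
  - move=> z' u v' [Rz' [w' _ Cz']] uL vL.
    by apply: (frame_dot hE); apply: (normal_perp Rz' Cz'); rewrite dotC.
  - exact: dot_rows hE 0 0.
  - exact: dot_rows hE 1 1.
  - by move=> z' [Rz' [w' _ Cz']]; rewrite dotC; exact: perp_emb_x1 Rz' Cz'.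
  - by move=> z' Zz'; exact: tangentZ.
  - by move=> z' Zz'; exact: tangentZ.
  - by move=> z' Zz'; rewrite (_ : (1 + j.*2).+2 = 3 + j.*2)%N ?IH//; lia.
have Zz0 : Z z0 by split=> //; exists w0.
apply: (multipoles_not_all_zero hm hM hC ZR Zz0 _ mj).
by apply: tangentZ => //; apply: (normal_perp Rz0 Cz0); rewrite dot_crossr.
Qed.

Theorem planar_integrability :
  integrable_by_quadratures (0 : phase R 4) (planar_region m M A V C E) H.
Proof.
exists planar_integral; split.
- by exists (@Ordinal 4 3 isT).
- move=> i; exact: (@chart_smooth _ _ Dom C Do Cd sC 4 emb Reg (emb_linear E) Ro RD
    Cs (planar_integral i) (planar_source i) (smooth_planar_source i)
    (fun z w Rz Cz => planar_integralE i Rz Cz)).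
- by move=> i w _; rewrite addr0.
- by move=> i j w [z Rz Cz]; exact: planar_poisson Rz Cz _ _.
move=> w0 [z0 Rz0 Cz0] B Bw0.
have [U [Uo Uw0] UB] : exists2 U, open_nbhs w0 U & U `<=` B.
  by move: Bw0; rewrite nbhsE => -[U UU UB]; exists U.
have [z [w [Rz Uw Cz mu]]] := planar_exists_torque Uo Uw0 Rz0 Cz0.
exists w; split; last exact: UB.
by split; [exists z|exact: planar_independent Rz Cz mu].
Qed.

End Planar.

Theorem theorem1 (R : realType) (m2 M2 : R) (hm2 : 0 < m2) (hM2 : 0 < M2)
    (A : set R) (V : set (phase R 5)) (C : phase R 6 -> phase R 6)
    (hC : partial_kepler_map m2 M2 A V C) :
  integrable_by_quadratures (ell2_period R)
    (nonparallel_region m2 M2 A V C) (h2 C)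
  /\
  (forall (E : 'M[R]_(2, 3)) (H : phase R 4 -> R),
     orthonormal_frame E ->
     planar_restriction m2 M2 A V C E H ->
     integrable_by_quadratures (0 : phase R 4)
       (planar_region m2 M2 A V C E) H).
Proof.
split; first exact: spatial_integrability.
by move=> E H hE hH; exact: planar_integrability.
Qed.
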